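(* Let $G$ be a discrete group and $(A,G,\alpha)$ a C*-dynamical system with $A\subseteq \mathcal{B}(H)$ a non-degenerate C*-algebra. If $A\rtimes_{\alpha,r}G$ possesses the strong operator approximation property (SOAP), then every completely compact Herz-Schur $(A,G,\alpha)$-multiplier $F$ is a limit, in the norm $\|\cdot\|_{\rm m}$, of Herz-Schur $(A,G,\alpha)$-multipliers of finite rank (that is, multipliers $F'$ for which the map $S_{F'}$ on $A\rtimes_{\alpha,r}G$ has finite rank).
   Context: Here $G$ is a discrete group, $A\subseteq\mathcal{B}(H)$ is a non-degenerate C*-algebra, $\alpha:G\to\mathrm{Aut}(A)$ is a homomorphism. On $\mathcal{H}=\ell^2(G,H)$ put $(\lambda_t\xi)(s)=\xi(t^{-1}s)$ and $(\pi(a)\xi)(s)=\alpha_{s^{-1}}(a)(\xi(s))$. For $f\in\ell^1(G,A)$ let $\tilde\pi(f)=\sum_{s\in G}\pi(f(s))\lambda_s$; the reduced crossed product $A\rtimes_{\alpha,r}G$ is the norm closure of $\tilde\pi(\ell^1(G,A))$ in $\mathcal{B}(\mathcal{H})$. A bounded map $F:G\to\mathrm{CB}(A)$ is a Herz-Schur $(A,G,\alpha)$-multiplier if the map $S_F:\tilde\pi(f)\mapsto\tilde\pi(F\cdot f)$, where $(F\cdot f)(t)=F(t)(f(t))$, is completely bounded; $S_F$ also denotes its completely bounded extension to $A\rtimes_{\alpha,r}G$, and $\|F\|_{\rm m}=\|S_F\|_{\rm cb}$. The multiplier $F$ is called completely compact if $S_F$ is completely compact. A completely bounded map $\Psi:\mathcal{X}\to\mathcal{Z}$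 between operator spaces is completely compact if for every $\epsilon>0$ there is a finite dimensional subspace $\mathcal{Y}\subseteq\mathcal{Z}$ such that $\mathrm{dist}(\Psi^{(m)}(x),M_m(\mathcal{Y}))<\epsilon$ for all $m\in\mathbb{N}$ and all $x\in M_m(\mathcal{X})$ with $\|x\|\le1$. An operator space $\mathcal{X}$ has the SOAP if there is a net $(\Phi_i)$ of completely bounded finite rank maps on $\mathcal{X}$ such that $\|(\mathrm{id}\otimes\Phi_i)(x)-x\|\to0$ for every Hilbert space $K$ and every $x\in\mathcal{B}(K)\otimes_{\min}\mathcal{X}$. *)

(* Defs.v *)
From HB Require Import structures.
From mathcomp Require Import all_boot all_order all_algebra finmap complex.
From mathcomp Require Import sesquilinear ring lra.
From mathcomp Require Import boolp classical_sets functions cardinality fsbigop.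
From mathcomp Require Import reals ereal topology normedtype numfun esum.

Set Implicit Arguments.
Unset Strict Implicit.
Unset Printing Implicit Defensive.
Import Order.TTheory GRing.Theory Num.Theory.
Import Normc numFieldNormedType.Exports.

Local Open Scope classical_set_scope.
Local Open Scope ring_scope.

(* Complex Hilbert spaces.  The norm is kept real valued ([hilnorm x : R]):   *)
(* library [normedModType R[i]] would have a norm with values in [R[i]].      *)

HB.mixin Record Lmodule_hasDot (R : realType) V & GRing.Lmodule R[i] V := {
  dotp : {dot V for @Num.conj R[i]}
}.

#[short(type="preHilbertType")]
HB.structure Definition PreHilbert (R : realType) :=
  {V of GRing.Lmodule R[i] V & Lmodule_hasDot R V}.

Definition hilnorm (R : realType) (V : preHilbertType R) (x : V) : R :=
  Num.sqrt (complex.Re (dotp x x)).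

HB.mixin Record PreHilbert_isComplete (R : realType) V & PreHilbert R V := {
  hilbert_complete : forall u : nat -> V,
    (forall e : R, 0 < e -> exists N, forall m n, (N <= m)%N -> (N <= n)%N ->
       hilnorm (u m - u n) < e) ->
    exists l : V, forall e : R, 0 < e -> exists N, forall n, (N <= n)%N ->
      hilnorm (u n - l) < e
}.

#[short(type="hilbertType")]
HB.structure Definition Hilbert (R : realType) :=
  {V of PreHilbert R V & PreHilbert_isComplete R V}.

Section hilnorm_theory.
Variables (R : realType) (V : preHilbertType R).
Implicit Types (x y : V) (a : R[i]).

Lemma dotpC x y : dotp y x = Num.conj (dotp x y).
Proof. by rewrite hermitian_subproof expr0 mul1r. Qed.

Lemma Re_dotpC x y : complex.Re (dotp y x) = complex.Re (dotp x y).
Proof. by rewrite dotpC; case: (dotp x y). Qed.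

Lemma dotp_ge0 x : 0 <= dotp x x.
Proof.
have [->|x0] := eqVneq x 0; first by rewrite linear0l.
exact/ltW/neq0_dnorm_gt0.
Qed.

Lemma Re_dotp_ge0 x : 0 <= complex.Re (dotp x x).
Proof. by have := dotp_ge0 x; case: (dotp x x) => a b; rewrite lecE => /andP[]. Qed.

Lemma dotpE x : dotp x x = (hilnorm x ^+ 2)%:C%C.
Proof.
rewrite /hilnorm sqr_sqrtr ?Re_dotp_ge0//; have := dotp_ge0 x.
by case: (dotp x x) => a b; rewrite lecE/= => /andP[/eqP-> _].
Qed.

Lemma hilnorm_ge0 x : 0 <= hilnorm x. Proof. exact: sqrtr_ge0. Qed.

Lemma hilnorm_sqr x : hilnorm x ^+ 2 = complex.Re (dotp x x).
Proof. by rewrite dotpE. Qed.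

Lemma hilnorm_eq0 x : hilnorm x = 0 -> x = 0.
Proof.
move=> x0; apply/eqP/negPn/negP => /(neq0_dnorm_gt0 (s := dotp)).
by rewrite dotpE x0 expr0n ltxx.
Qed.

Lemma hilnorm0 : hilnorm (0 : V) = 0.
Proof. by rewrite /hilnorm linear0l sqrtr0. Qed.

Lemma hilnormZ a x : hilnorm (a *: x) = normc a * hilnorm x.
Proof.
have ax0 : 0 <= normc a * hilnorm x.
  by rewrite mulr_ge0 ?hilnorm_ge0//; case: a => b c; exact: sqrtr_ge0.
rewrite -(ger0_norm ax0) -sqrtr_sqr.
congr Num.sqrt; rewrite linearZl_LR linearZr_LR/= dotpE exprMn mulrA.
case: a {ax0} => a b /=; rewrite !sqr_sqrtr ?addr_ge0 ?sqr_ge0 ?Re_dotp_ge0//; ring.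
Qed.

Lemma hilnorm_sqrD x y :
  hilnorm (x + y) ^+ 2 = hilnorm x ^+ 2 + hilnorm y ^+ 2 + 2 * complex.Re (dotp x y).
Proof.
by rewrite !hilnorm_sqr linearDl linearDr/= !raddfD/= (Re_dotpC x y); ring.
Qed.

Lemma hilnormN x : hilnorm (- x) = hilnorm x.
Proof. by rewrite /hilnorm linearNl linearNr opprK. Qed.

Lemma hilnormB x y : hilnorm (x - y) = hilnorm (y - x).
Proof. by rewrite -hilnormN opprB. Qed.

Lemma Re_dotp_le x y : complex.Re (dotp x y) <= hilnorm x * hilnorm y.
Proof.
have [x0|x0] := eqVneq (hilnorm x) 0; first by rewrite (hilnorm_eq0 x0) linear0l hilnorm0 mul0r.
have [y0|y0] := eqVneq (hilnorm y) 0; first by rewrite (hilnorm_eq0 y0) linear0r hilnorm0 mulr0.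
have xy0 : 0 < hilnorm x * hilnorm y by rewrite mulr_gt0// lt_def hilnorm_ge0 ?x0 ?y0.
have := sqr_ge0 (hilnorm ((hilnorm y)%:C%C *: x + (- hilnorm x)%:C%C *: y)).
have normcR (r : R) : normc r%:C%C = `|r| by rewrite /= expr0n addr0 sqrtr_sqr.
rewrite hilnorm_sqrD !hilnormZ !normcR normrN !ger0_norm ?hilnorm_ge0//.
rewrite linearZl_LR linearZr_LR/=; case: (dotp x y) => a b /=.
by move=> h; rewrite -(ler_pM2l xy0); nra.
Qed.

Lemma ler_hilnormD x y : hilnorm (x + y) <= hilnorm x + hilnorm y.
Proof.
rewrite -(ler_pXn2r (n:=2))// ?nnegrE ?addr_ge0 ?hilnorm_ge0// hilnorm_sqrD sqrrD.
have := Re_dotp_le x y; lra.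
Qed.

Lemma hilnorm_sqrD_le x y :
  hilnorm (x + y) ^+ 2 <= 2 * hilnorm x ^+ 2 + 2 * hilnorm y ^+ 2.
Proof.
have := ler_hilnormD x y; have := hilnorm_ge0 (x + y).
have := sqr_ge0 (hilnorm x - hilnorm y); have := hilnorm_ge0 x; have := hilnorm_ge0 y.
nra.
Qed.

End hilnorm_theory.

Section usum.
Variables (R : realType) (I : choiceType).
Implicit Types (f g : I -> R) (c : R).

Definition usum f : R :=
  fine (esum setT (EFin \o f)^\+ - esum setT (EFin \o f)^\-)%E.

Definition usummable f : Prop := summable setT (EFin \o f).

Lemma usummableE f :
  usummable f <-> (\esum_(i in setT) `|f i|%:E < +oo)%E.
Proof. by []. Qed.

Lemma usummable_le f g : (forall i, `|f i| <= g i) -> usummable g -> usummable f.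
Proof.
move=> fg /usummableE sg; apply/usummableE; apply: le_lt_trans sg.
by apply: le_esum => i _; rewrite lee_fin (le_trans (fg i))// ler_norm.
Qed.

Lemma usummableD f g : usummable f -> usummable g -> usummable (f \+ g).
Proof. exact: summableD. Qed.

Lemma usummableN f : usummable f -> usummable (\- f).
Proof. by move=> sf; rewrite /usummable (summableN setT (EFin \o f)) in sf. Qed.

Lemma esumZ c f : 0 <= c -> (forall i, 0 <= f i) ->
  (\esum_(i in setT) (c * f i)%:E = c%:E * \esum_(i in setT) (f i)%:E)%E.
Proof.
move=> c0 f0.
have le d g : 0 <= d -> (forall i, 0 <= g i) ->
    (\esum_(i in setT) (d * g i)%:E <= d%:E * \esum_(i in setT) (g i)%:E)%E.
  move=> d0 g0; apply: ge_ereal_sup => _ [A [finA _] <-].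
  under eq_fsbigr do rewrite EFinM.
  rewrite -ge0_mule_fsumr//.
  by apply: lee_wpmul2l => //; apply: esum_ge; exists A.
have [->|cn0] := eqVneq c 0.
  by rewrite mul0e esum1// => i _; rewrite mul0r.
apply/le_anti/andP; split; first exact: le.
have cp : 0 < c by rewrite lt_def cn0.
rewrite -lee_pdivlMl//; apply: le_trans (le _ _ _ _); rewrite ?invr_ge0//.
  by apply: le_esum => i _; rewrite mulKf.
by move=> i; rewrite mulr_ge0.
Qed.

Lemma usummableZ c f : usummable f -> usummable (fun i => c * f i).
Proof.
move=> /usummableE sf; apply/usummableE.
under eq_esum do rewrite normrM.
rewrite esumZ//; rewrite -ge0_fin_numE in sf; last exact: esum_ge0.
by rewrite -(fineK sf) -EFinM ltry.
Qed.

Lemma usum_ge0E f : (forall i, 0 <= f i) ->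
  usum f = fine (\esum_(i in setT) (f i)%:E).
Proof.
move=> f0; rewrite /usum [X in (_ - X)%E]esum1 ?sube0; last first.
  by move=> i _; rewrite (@ge0_funenegE _ _ setT) ?inE// => x _; rewrite lee_fin.
congr fine; apply: eq_esum => i _.
by rewrite (@ge0_funeposE _ _ setT) ?inE// => x _; rewrite lee_fin.
Qed.

Lemma ge0_usummable f : (forall i, 0 <= f i) ->
  usummable f <-> (\esum_(i in setT) (f i)%:E < +oo)%E.
Proof.
by move=> f0; rewrite usummableE; under eq_esum do rewrite ger0_norm//.
Qed.

Lemma ge0_usummable_fin f : (forall i, 0 <= f i) -> usummable f ->
  (\esum_(i in setT) (f i)%:E)%E \is a fin_num.
Proof.
move=> f0 /(ge0_usummable f0) sf.
by rewrite ge0_fin_numE//; apply: esum_ge0 => i _; rewrite lee_fin.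
Qed.

Lemma ge0_usumD f g : (forall i, 0 <= f i) -> (forall i, 0 <= g i) ->
  usummable f -> usummable g -> usum (f \+ g) = usum f + usum g.
Proof.
move=> f0 g0 sf sg; rewrite !usum_ge0E//; last by move=> i; rewrite addr_ge0.
rewrite -fineD ?ge0_usummable_fin// -esumD// => i _; by rewrite lee_fin.
Qed.

Lemma usumB f g : (forall i, 0 <= f i) -> (forall i, 0 <= g i) ->
  usummable f -> usummable g -> usum (f \- g) = usum f - usum g.
Proof.
move=> f0 g0 sf sg; rewrite (usum_ge0E f0) (usum_ge0E g0) -fineB ?ge0_usummable_fin//.
by rewrite -esumB//= => i _; rewrite lee_fin.
Qed.

Let pos f i := Num.max (f i) 0.
Let neg f i := Num.max (- f i) 0.

Let pos_ge0 f i : 0 <= pos f i. Proof. by rewrite le_max lexx orbT. Qed.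
Let neg_ge0 f i : 0 <= neg f i. Proof. by rewrite le_max lexx orbT. Qed.

Let posnegE f : f = pos f \- neg f.
Proof. by apply/funext => i; rewrite /pos /neg/=; case: (leP (f i) 0); case: (leP (- f i) 0); lra. Qed.

Let pos_summable f : usummable f -> usummable (pos f).
Proof.
move=> sf; apply: (@usummable_le _ (fun i => `|f i|)).
  by move=> i; rewrite ger0_norm// ge_max normr_ge0 ler_norm.
by apply/usummableE; under eq_esum do rewrite normr_id.
Qed.

Let neg_summable f : usummable f -> usummable (neg f).
Proof. by move=> /usummableN; exact: pos_summable. Qed.

Lemma usumD f g : usummable f -> usummable g ->
  usum (f \+ g) = usum f + usum g.
Proof.
move=> sf sg.
have -> : f \+ g = (pos f \+ pos g) \- (neg f \+ neg g).
  by apply/funext => i /=; rewrite {1}(posnegE f) {1}(posnegE g) /=; ring.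
have [pf pg] := (pos_summable sf, pos_summable sg).
have [nf ng] := (neg_summable sf, neg_summable sg).
rewrite usumB; [|by move=> i; exact: addr_ge0|by move=> i; exact: addr_ge0
  |exact: usummableD|exact: usummableD].
rewrite !ge0_usumD// [in RHS](posnegE f) [in RHS](posnegE g) !usumB//; ring.
Qed.

Lemma usumN f : usummable f -> usum (\- f) = - usum f.
Proof.
move=> sf; have -> : \- f = neg f \- pos f.
  by apply/funext => i /=; rewrite {1}(posnegE f) /=; ring.
have [pf nf] := (pos_summable sf, neg_summable sf).
by rewrite [in RHS](posnegE f) !usumB//; ring.
Qed.

Lemma usumZ c f : usummable f -> usum (fun i => c * f i) = c * usum f.
Proof.
have ge0Z d g : 0 <= d -> (forall i, 0 <= g i) -> usummable g ->
    usum (fun i => d * g i) = d * usum g.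
  move=> d0 g0 sg; rewrite !usum_ge0E//; last by move=> i; rewrite mulr_ge0.
  by rewrite esumZ// fineM// ge0_usummable_fin.
have pZ d g : 0 <= d -> usummable g -> usum (fun i => d * g i) = d * usum g.
  move=> d0 sg.
  have -> : (fun i => d * g i) = (fun i => d * pos g i) \- (fun i => d * neg g i).
    by apply/funext => i /=; rewrite {1}(posnegE g) /=; ring.
  have [pg ng] := (pos_summable sg, neg_summable sg).
  rewrite usumB; [|by move=> i; exact: mulr_ge0|by move=> i; exact: mulr_ge0
    |exact: usummableZ|exact: usummableZ].
  by rewrite [in RHS](posnegE g) usumB// !ge0Z//; ring.
move=> sf; have [c0|/ltW c0] := leP 0 c; first exact: pZ.
have -> : (fun i => c * f i) = \- (fun i => - c * f i).
  by apply/funext => i /=; ring.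
rewrite usumN; last exact: usummableZ.
by rewrite pZ ?oppr_ge0//; ring.
Qed.

Lemma usum_le_ge0 f g : (forall i, 0 <= f i <= g i) -> usummable g ->
  usum f <= usum g.
Proof.
move=> fg sg; have f0 i : 0 <= f i by case/andP: (fg i).
have g0 i : 0 <= g i by case/andP: (fg i) => /le_trans; apply.
have sf : usummable f.
  by apply: usummable_le sg => i; rewrite ger0_norm//; case/andP: (fg i).
rewrite !usum_ge0E//; apply: fine_le; rewrite ?ge0_usummable_fin//.
by apply: le_esum => i _; rewrite lee_fin; case/andP: (fg i).
Qed.

Lemma usum_ge_term f i : (forall j, 0 <= f j) -> usummable f -> f i <= usum f.
Proof.
move=> f0 sf; rewrite usum_ge0E// -lee_fin fineK ?ge0_usummable_fin//.
apply: esum_ge; exists [set i]; first by split => //; exact: finite_set1.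
by rewrite fsbig_set1.
Qed.

End usum.

Section l2.
Variables (R : realType) (I : choiceType) (V : hilbertType R).

Definition sqsummable (f : I -> V) : Prop :=
  (\esum_(i in setT) (hilnorm (f i) ^+ 2)%:E < +oo)%E.

Definition l2_pred : {pred I -> V} := fun f => `[< sqsummable f >].

Lemma sqsummableE (f : I -> V) :
  sqsummable f <-> usummable (fun i => hilnorm (f i) ^+ 2).
Proof. by rewrite ge0_usummable// => i; exact: sqr_ge0. Qed.

Lemma l2_submod : submod_closed l2_pred.
Proof.
split=> [|a f g].
  apply/asboolP; rewrite /sqsummable esum1// => i _.
  by rewrite [X in hilnorm X](_ : _ = 0)// hilnorm0 expr0n.
move=> /asboolP/sqsummableE sf /asboolP/sqsummableE sg.
apply/asboolP/sqsummableE.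
apply: (@usummable_le _ _ _ (fun i => 2 * normc a ^+ 2 * hilnorm (f i) ^+ 2
                                   + 2 * hilnorm (g i) ^+ 2)); last first.
  by apply: usummableD; exact: usummableZ.
move=> i; rewrite ger0_norm ?sqr_ge0//.
apply: (le_trans (hilnorm_sqrD_le _ _)).
by rewrite hilnormZ exprMn mulrA.
Qed.

HB.instance Definition _ := GRing.isSubmodClosed.Build R[i] (I -> V) l2_pred l2_submod.

Record l2 := L2 { l2_fun :> I -> V; _ : l2_fun \in l2_pred }.

HB.instance Definition _ := [isSub for l2_fun].
HB.instance Definition _ := [Choice of l2 by <:].
HB.instance Definition _ := [SubChoice_isSubLmodule of l2 by <:].

Lemma l2_summable (f : l2) : usummable (fun i => hilnorm (f i) ^+ 2).
Proof. by case: f => f /= /asboolP/sqsummableE. Qed.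

Lemma l2_Re_summable (f g : l2) :
  usummable (fun i => complex.Re (dotp (f i) (g i))).
Proof.
apply: (@usummable_le _ _ _ (fun i => hilnorm (f i) ^+ 2 + hilnorm (g i) ^+ 2)).
  move=> i; have h := Re_dotp_le (f i) (g i); have := Re_dotp_le (- f i) (g i).
  rewrite linearNl raddfN hilnormN => k; rewrite ler_norml; apply/andP.
  have := sqr_ge0 (hilnorm (f i) - hilnorm (g i)).
  have := hilnorm_ge0 (f i); have := hilnorm_ge0 (g i).
  by split; nra.
by apply: usummableD; exact: l2_summable.
Qed.

Lemma l2_Im_summable (f g : l2) :
  usummable (fun i => complex.Im (dotp (f i) (g i))).
Proof.
have := l2_Re_summable (- 'i%C *: f) g; congr usummable; apply/funext => i /=.
by rewrite linearZl_LR/=; case: (dotp _ _) => a b /=; ring.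
Qed.

Definition l2_dot (f g : l2) : R[i] :=
  (usum (fun i => complex.Re (dotp (f i) (g i))) +i*
   usum (fun i => complex.Im (dotp (f i) (g i))))%C.

Lemma l2_dotC (f g : l2) : l2_dot f g = (-1) ^+ false * Num.conj (l2_dot g f).
Proof.
rewrite expr0 mul1r /l2_dot; apply/eqP; rewrite eq_complex/=.
rewrite -usumN; last exact: l2_Im_summable.
apply/andP; split; apply/eqP; congr usum; apply/funext => i /=;
  by rewrite (dotpC (g i)); case: (dotp _ _).
Qed.

Lemma l2_dot_linearl (g : l2) a (f h : l2) :
  l2_dot (a *: f + h) g = a * l2_dot f g + l2_dot h g.
Proof.
have [sr si] := (l2_Re_summable f g, l2_Im_summable f g).
have [tr ti] := (l2_Re_summable h g, l2_Im_summable h g).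
case: a => a b; rewrite /l2_dot.
rewrite [X in (usum X +i* _)%C = _](_ : _ =
  (fun i => a * complex.Re (dotp (f i) (g i))) \+
  (fun i => - b * complex.Im (dotp (f i) (g i))) \+
  (fun i => complex.Re (dotp (h i) (g i)))); last first.
  apply/funext => i /=; rewrite linearDl linearZl_LR/= raddfD/=.
  by case: (dotp (f i) _) => x y /=; ring.
rewrite [X in (_ +i* usum X)%C = _](_ : _ =
  (fun i => a * complex.Im (dotp (f i) (g i))) \+
  (fun i => b * complex.Re (dotp (f i) (g i))) \+
  (fun i => complex.Im (dotp (h i) (g i)))); last first.
  apply/funext => i /=; rewrite linearDl linearZl_LR/= raddfD/=.
  by case: (dotp (f i) _) => x y /=; ring.
have zr c := usummableZ c sr; have zi c := usummableZ c si.
rewrite !usumD ?usumZ//; try exact: usummableD.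
by apply/eqP; rewrite eq_complex/=; apply/andP; split; apply/eqP; ring.
Qed.

Lemma l2_dot_bilinear : bilinear_for *%R (@Num.conj R[i] \; *%R) l2_dot.
Proof.
split=> [g a f h|f a g h]; first exact: l2_dot_linearl.
by rewrite l2_dotC l2_dot_linearl/= expr0 mul1r rmorphD rmorphM/=
  [in RHS](l2_dotC f g) [in RHS](l2_dotC f h) !expr0 !mul1r.
Qed.

HB.instance Definition _ := @bilinear_isBilinear.Build R[i] l2 l2 R[i]
  *%R (@Num.conj R[i] \; *%R) l2_dot l2_dot_bilinear.
HB.instance Definition _ := @isHermitianSesquilinear.Build R[i] l2 false
  (@Num.conj R[i]) l2_dot l2_dotC.

Lemma l2_dotE (f : l2) : l2_dot f f = (usum (fun i => hilnorm (f i) ^+ 2))%:C%C.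
Proof.
rewrite /l2_dot; apply/eqP; rewrite eq_complex/=; apply/andP; split; apply/eqP.
  by congr usum; apply/funext => i; rewrite hilnorm_sqr.
rewrite usum_ge0E; last by move=> i; rewrite dotpE.
by rewrite esum1// => i _; rewrite dotpE.
Qed.

Lemma l2_dot_gt0 (f : l2) : f != 0 -> 0 < l2_dot f f.
Proof.
move=> f0; rewrite l2_dotE ltcE/= eqxx/=.
have [i fi0] : exists i, f i != 0.
  apply: contrapT => f_eq0; move/eqP: f0; apply; apply/val_inj/funext => i /=.
  by apply/eqP/negPn/negP => fi; apply: f_eq0; exists i.
apply: (lt_le_trans _ (usum_ge_term i _ (l2_summable f))) => [|j].
  rewrite exprn_gt0// lt_def hilnorm_ge0 andbT.
  by apply: contra fi0 => /eqP/hilnorm_eq0/eqP.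
exact: sqr_ge0.
Qed.

HB.instance Definition _ := @isDotProduct.Build R[i] l2 l2_dot l2_dot_gt0.
HB.instance Definition _ := Lmodule_hasDot.Build R l2 l2_dot.

Lemma l2_hilnorm_sqr (f : l2) : hilnorm f ^+ 2 = usum (fun i => hilnorm (f i) ^+ 2).
Proof. by rewrite hilnorm_sqr [dotp f f]l2_dotE. Qed.

Lemma l2_hilnorm_ge (f : l2) i : hilnorm (f i) <= hilnorm f.
Proof.
rewrite -(ler_pXn2r (n:=2))// ?nnegrE ?hilnorm_ge0// l2_hilnorm_sqr.
by apply: (usum_ge_term (f := fun i => hilnorm (f i) ^+ 2)) => [j|];
  [exact: sqr_ge0|exact: l2_summable].
Qed.

Lemma l2_hilnorm_ge_sum (f : l2) (s : seq I) : uniq s ->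
  \sum_(i <- s) hilnorm (f i) ^+ 2 <= hilnorm f ^+ 2.
Proof.
move=> us; rewrite l2_hilnorm_sqr usum_ge0E; last by move=> i; exact: sqr_ge0.
rewrite -lee_fin fineK; last first.
  by apply: (ge0_usummable_fin (f := fun i => hilnorm (f i) ^+ 2)) => [i|];
    [exact: sqr_ge0|exact: l2_summable].
apply: esum_ge; exists [set` s]; first by split => //; exact: finite_seq.
by rewrite -fsbig_seq// sumEFin.
Qed.

Lemma l2_complete (u : nat -> l2) :
  (forall e : R, 0 < e -> exists N, forall m n, (N <= m)%N -> (N <= n)%N ->
     hilnorm (u m - u n) < e) ->
  exists l : l2, forall e : R, 0 < e -> exists N, forall n, (N <= n)%N ->
    hilnorm (u n - l) < e.
Proof.
move=> uC.
have uCi i : exists l : V, forall e : R, 0 < e -> exists N, forall n, (N <= n)%N ->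
    hilnorm (u n i - l) < e.
  apply: hilbert_complete => e /uC[N uN]; exists N => m n Nm Nn.
  exact: le_lt_trans (l2_hilnorm_ge (u m - u n) i) (uN _ _ Nm Nn).
have [l ul] := choice uCi.
have sum_small (s : seq I) (d : R) : 0 < d -> exists M, forall m, (M <= m)%N ->
    \sum_(i <- s) hilnorm (u m i - l i) ^+ 2 < d.
  elim: s d => [|i s IH] d d0; first by exists 0%N => m _; rewrite big_nil.
  have [M uM] := IH _ (divr_gt0 d0 (ltr0n _ 2)).
  have sd0 : 0 < Num.sqrt (d / 2) by rewrite sqrtr_gt0 divr_gt0.
  have [N uN] := ul i _ sd0.
  exists (maxn M N) => m; rewrite geq_max => /andP[/uM sM /uN sN].
  rewrite big_cons [ltRHS](splitr d) ltrD//.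
  rewrite -(sqr_sqrtr (ltW (divr_gt0 d0 (ltr0n R 2)))).
  by rewrite ltr_pXn2r// nnegrE ?hilnorm_ge0// ltW.
have bound e : 0 < e -> exists N, forall n, (N <= n)%N ->
    (\esum_(i in setT) (hilnorm (u n i - l i) ^+ 2)%:E <= (4 * e ^+ 2)%:E)%E.
  move=> e0; have [N uN] := uC e e0; exists N => n Nn.
  apply: ge_ereal_sup => _ [A [finA _] <-].
  rewrite fsbig_finite// sumEFin lee_fin.
  have [M uM] := sum_small (fset_set A) _ (exprn_gt0 2 e0).
  have [m [Nm Mm]] : exists m, (N <= m)%N /\ (M <= m)%N.
    by exists (maxn N M); rewrite leq_maxl leq_maxr.
  apply: (@le_trans _ _ (2 * (\sum_(i <- fset_set A) hilnorm (u n i - u m i) ^+ 2)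
      + 2 * (\sum_(i <- fset_set A) hilnorm (u m i - l i) ^+ 2))).
    rewrite !mulr_sumr -big_split/=; apply: ler_sum => i _.
    rewrite -[u n i](subrK (u m i)) -addrA.
    by apply: (le_trans (hilnorm_sqrD_le _ _)); rewrite addrK.
  have := uM _ Mm; have := l2_hilnorm_ge_sum (u n - u m) (fset_uniq (fset_set A)).
  have := uN _ _ Nn Nm; have := hilnorm_ge0 (u n - u m).
  rewrite /= => ? ? ? ?; nra.
have lP : l \in l2_pred.
  have [N /(_ N (leqnn N)) lN] := bound 1 ltr01.
  have wP : ((u N : I -> V) - l) \in l2_pred.
    by apply/asboolP; apply: (le_lt_trans lN); rewrite ltry.
  rewrite -[l](subKr (u N : I -> V)); apply: rpredB => //; exact: valP.
exists (L2 lP) => e e0.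
have e30 : 0 < e / 3 by rewrite divr_gt0.
have [N uN] := bound _ e30; exists N => n /uN.
move=> un_le; rewrite -(ltr_pXn2r (n:=2))// ?nnegrE ?hilnorm_ge0 ?ltW//.
rewrite l2_hilnorm_sqr usum_ge0E; last by move=> i; exact: sqr_ge0.
rewrite -lte_fin fineK; last first.
  by apply: (ge0_usummable_fin (f := fun i => hilnorm ((u n - L2 lP) i) ^+ 2)) => [i|];
    [exact: sqr_ge0|exact: l2_summable].
by apply: (le_lt_trans un_le); rewrite lte_fin; nra.
Qed.

HB.instance Definition _ := PreHilbert_isComplete.Build R l2 l2_complete.

End l2.

Section bop.
Variables (R : realType) (V : hilbertType R).

Definition bop_pred : {pred V -> V} := fun f =>
  `[< linear f /\ exists M : R, forall x, hilnorm (f x) <= M * hilnorm x >].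

Lemma bop_submod : submod_closed bop_pred.
Proof.
split=> [|a f g].
  apply/asboolP; split=> [b x y|]; first by rewrite /= scaler0 addr0.
  by exists 0 => x; rewrite mul0r hilnorm0.
move=> /asboolP[lf [M fM]] /asboolP[lg [N gN]]; apply/asboolP; split.
  move=> b x y; rewrite [in LHS]/GRing.add/= [in LHS]/GRing.scale/= lf lg.
  rewrite !scalerDr !scalerA [b * a]mulrC.
  by rewrite -!addrA; congr (_ + _); rewrite addrCA.
exists (normc a * M + N) => x.
apply: (le_trans (ler_hilnormD _ _)); rewrite hilnormZ mulrDl -mulrA lerD//.
by rewrite ler_wpM2l//; case: a => b c; exact: sqrtr_ge0.
Qed.

HB.instance Definition _ :=
  GRing.isSubmodClosed.Build R[i] (V -> V) bop_pred bop_submod.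

Record bop := Bop { bop_fun :> V -> V; _ : bop_fun \in bop_pred }.

HB.instance Definition _ := [isSub for bop_fun].
HB.instance Definition _ := [Choice of bop by <:].
HB.instance Definition _ := [SubChoice_isSubLmodule of bop by <:].

Lemma bop_comp_subproof (S T : bop) : (S \o T) \in bop_pred.
Proof.
have /asboolP[lS [M SM]] : (S : V -> V) \in bop_pred := valP S.
have /asboolP[lT [N TN]] : (T : V -> V) \in bop_pred := valP T.
apply/asboolP; split=> [b x y|]; first by rewrite /= lT lS.
exists (`|M| * N) => x; apply: (le_trans (SM _)).
apply: (@le_trans _ _ (`|M| * hilnorm (T x))).
  by rewrite ler_wpM2r ?hilnorm_ge0 ?ler_norm.
by rewrite -mulrA ler_wpM2l.
Qed.

Definition bop_comp (S T : bop) : bop := Bop (bop_comp_subproof S T).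

Definition is_adjoint (S T : bop) : Prop :=
  forall x y, dotp (S x) y = dotp x (T y).

Definition opnorm (T : bop) : R :=
  sup [set hilnorm (T x) | x in [set x | hilnorm x <= 1]].

(* The norm of M_m(B(V)) = B(V^m).                                            *)
Definition mxopnorm m (x : 'M[bop]_m) : R :=
  sup [set Num.sqrt (\sum_i hilnorm (\sum_j x i j (xi j)) ^+ 2)
      | xi in [set xi : 'I_m -> V | \sum_j hilnorm (xi j) ^+ 2 <= 1]].

Definition op_closure (X : set bop) : set bop :=
  [set T | forall e : R, 0 < e -> exists2 S, X S & opnorm (T - S) < e].

(* [T] is the norm limit of the finite partial sums of [u].                   *)
Definition op_has_sum (I : choiceType) (u : I -> bop) (T : bop) : Prop :=
  forall e : R, 0 < e -> exists J0 : {fset I}, forall J : {fset I},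
    (J0 `<=` J)%fset -> opnorm (T - \sum_(i <- J) u i) < e.

Definition op_sum (I : choiceType) (u : I -> bop) : bop :=
  xget 0 [set T | op_has_sum u T].

End bop.

Section linear_spans.
Variables (R : realType) (U W : lmodType R[i]).

Definition lspan (X : set U) : set U :=
  [set v | exists n (c : 'I_n -> R[i]) (x : 'I_n -> U),
    (forall i, X (x i)) /\ v = \sum_i c i *: x i].

Definition finite_dim (Y : set U) : Prop :=
  exists ys : seq U, Y = lspan [set` ys].

Definition linear_on (X : set U) (Phi : U -> W) : Prop :=
  forall (a : R[i]) x y, X x -> X y -> Phi (a *: x + y) = a *: Phi x + Phi y.

End linear_spans.

(* Maps between operator spaces.  An operator space is a subspace [X] of some *)
(* B(V), and a map on it is a function on B(V) of which only the values on    *)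
(* [X] matter.                                                                *)

Section cb_maps.
Variables (R : realType) (V W : hilbertType R).
Implicit Types (X : set (bop V)) (Z : set (bop W)) (Phi : bop V -> bop W).

Definition mx_in (U : hilbertType R) (X : set (bop U)) m : set 'M[bop U]_m :=
  [set x | forall i j, X (x i j)].

Definition cbnorm X Phi : \bar R :=
  ereal_sup [set r | exists m (x : 'M[bop V]_m),
    [/\ mx_in X x, mxopnorm x <= 1 & r = (mxopnorm (map_mx Phi x))%:E]].

Definition completely_bounded X Z Phi : Prop :=
  [/\ forall x, X x -> Z (Phi x), linear_on X Phi & (cbnorm X Phi < +oo)%E].

Definition completely_compact X Z Psi : Prop :=
  completely_bounded X Z Psi /\
  forall e : R, 0 < e -> exists Y : set (bop W),
    [/\ finite_dim Y, Y `<=` Z &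
     forall m (x : 'M[bop V]_m), mx_in X x -> mxopnorm x <= 1 ->
       inf [set mxopnorm (map_mx Psi x - y) | y in mx_in Y (m := m)] < e].

Definition finite_rank X Phi : Prop := finite_dim (Phi @` X).

End cb_maps.

Section soap.
Variables (R : realType) (K V T : hilbertType R) (tau : K -> V -> T).

(* [T], with [tau k v] as elementary tensors, is the Hilbert space tensor     *)
(* product of [K] and [V].                                                    *)
Definition hilbert_tensor : Prop :=
  [/\ forall v, linear (tau ^~ v),
      forall k, linear (tau k),
      forall k k' v v', dotp (tau k v) (tau k' v') = dotp k k' * dotp v v' &
      forall (t : T) (e : R), 0 < e ->
        exists2 s, lspan [set tau p.1 p.2 | p in [set: K * V]] s &
                   hilnorm (t - s) < e].

(* The operator b (x) x, determined by its values on elementary tensors.      *)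
Definition op_tensor (b : bop K) (x : bop V) : bop T :=
  xget 0 [set S : bop T | forall k v, S (tau k v) = tau (b k) (x v)].

Definition min_tensor (X : set (bop V)) : set (bop T) :=
  op_closure (lspan [set S | exists (b : bop K) x, X x /\ S = op_tensor b x]).

(* [Theta] is id (x) Phi on B(K) (x)_min X: the bounded linear extension of   *)
(* b (x) x |-> b (x) Phi x, which is unique on B(K) (x)_min X.                *)
Definition is_amplification (X : set (bop V)) (Phi : bop V -> bop V)
    (Theta : bop T -> bop T) : Prop :=
  [/\ linear_on (min_tensor X) Theta,
      exists M : R, forall y, min_tensor X y ->
        opnorm (Theta y) <= M * opnorm y &
      forall (b : bop K) x, X x ->
        Theta (op_tensor b x) = op_tensor b (Phi x)].

End soap.

Definition directed (I : Type) (le : I -> I -> Prop) : Prop :=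
  [/\ exists i : I, True, forall i, le i i,
      forall i j k, le i j -> le j k -> le i k &
      forall i j, exists k, le i k /\ le j k].

Definition SOAP (R : realType) (V : hilbertType R) (X : set (bop V)) : Prop :=
  exists (I : Type) (le : I -> I -> Prop) (Phi : I -> bop V -> bop V),
    [/\ directed le,
        forall i, completely_bounded X X (Phi i),
        forall i, finite_rank X (Phi i) &
        forall (K T : hilbertType R) (tau : K -> V -> T), hilbert_tensor tau ->
          exists Theta : I -> bop T -> bop T,
            (forall i, is_amplification tau X (Phi i) (Theta i)) /\
            forall x, min_tensor tau X x -> forall e : R, 0 < e ->
              exists i0, forall i, le i0 i -> opnorm (Theta i x - x) < e].

Section dynamical_systems.
Variables (R : realType) (G : groupType) (H : hilbertType R).
Implicit Types (A : set (bop H)) (phi : bop H -> bop H).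

Definition cstar_algebra A : Prop :=
  [/\ A 0, forall (a : R[i]) x y, A x -> A y -> A (a *: x + y),
      forall x y, A x -> A y -> A (bop_comp x y),
      forall x, A x -> exists2 y, A y & is_adjoint x y &
      op_closure A `<=` A].

Definition nondegenerate_algebra A : Prop :=
  forall (h : H) (e : R), 0 < e ->
    exists2 s, lspan [set v | exists (a : bop H) x, A a /\ v = a x] s &
               hilnorm (h - s) < e.

Definition star_automorphism A phi : Prop :=
  [/\ set_bij A A phi, linear_on A phi,
      forall x y, A x -> A y ->
        phi (bop_comp x y) = bop_comp (phi x) (phi y) &
      forall x y, A x -> A y -> is_adjoint x y ->
        is_adjoint (phi x) (phi y)].

Definition cstar_action A (alpha : G -> bop H -> bop H) : Prop :=
  (forall t, star_automorphism A (alpha t)) /\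
  forall s t a, A a -> alpha (s * t)%g a = alpha s (alpha t a).

End dynamical_systems.

(* The operator on ell^2(I, V) acting as [g] on families.  The default 0 is   *)
(* not used below: translations are isometric, and so are *-automorphisms,    *)
(* so the operators alpha_{s^-1}(a) are bounded uniformly in s.               *)
Definition l2_op (R : realType) (I : choiceType) (V : hilbertType R)
    (g : (I -> V) -> I -> V) : bop (l2 I V) :=
  xget 0 [set T : bop (l2 I V) | forall xi : l2 I V, T xi = g xi :> (I -> V)].

Section crossed_product.
Variables (R : realType) (G : groupType) (H : hilbertType R).
Variables (A : set (bop H)) (alpha : G -> bop H -> bop H).

Definition lam (t : G) : bop (l2 G H) :=
  l2_op (fun xi s => xi (t^-1 * s)%g).

Definition pi_rep (a : bop H) : bop (l2 G H) :=
  l2_op (fun xi s => alpha s^-1%g a (xi s)).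

Definition ell1 : set (G -> bop H) :=
  [set f | (forall s, A (f s)) /\
           (\esum_(s in setT) (opnorm (f s))%:E < +oo)%E].

Definition pi_tilde (f : G -> bop H) : bop (l2 G H) :=
  op_sum (fun s => bop_comp (pi_rep (f s)) (lam s)).

Definition pi_tilde_ell1 : set (bop (l2 G H)) := pi_tilde @` ell1.

Definition reduced_crossed_product : set (bop (l2 G H)) :=
  op_closure pi_tilde_ell1.

Implicit Types F : G -> bop H -> bop H.

Definition bounded_CB F : Prop :=
  (forall t, completely_bounded A A (F t)) /\
  exists M : R, forall t, (cbnorm A (F t) <= M%:E)%E.

(* [S] is completely bounded from [X] to [X] and maps each pi_tilde(f) to     *)
(* pi_tilde(F . f).                                                           *)
Definition multiplier_map F (X : set (bop (l2 G H)))
    (S : bop (l2 G H) -> bop (l2 G H)) : Prop :=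
  completely_bounded X X S /\
  forall f, ell1 f -> S (pi_tilde f) = pi_tilde (fun t => F t (f t)).

Definition herz_schur F : Prop :=
  bounded_CB F /\ exists S, multiplier_map F pi_tilde_ell1 S.

(* The completely bounded extension of S_F to the reduced crossed product,    *)
(* on which it is unique.                                                     *)
Definition S_ F : bop (l2 G H) -> bop (l2 G H) :=
  xget (fun=> 0) [set S | multiplier_map F reduced_crossed_product S].

Definition mnorm F : \bar R := cbnorm reduced_crossed_product (S_ F).

End crossed_product.

(* Main.v *)
(* Let [Psi = S_F].  Applied to one block diagonal operator containing all the  *)
(* matrices [Psi(x)] with [|x| <= 1], the SOAP gives a finite rank map [Phi]     *)
(* with [Phi o Psi] close to [Psi] in cb-norm.  Its range can be moved slightly  *)
(* into the span of finitely many [pi(a) lam_t], which gives a map [T].          *)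
(* A completely bounded map [T] of the crossed product induces the multiplier    *)
(* [F_T(t)(a) = E(T(pi(a) lam_t) lam_(t^-1))], [E] the diagonal expectation,      *)
(* and [|F_T|_m <= |T|_cb]: if [x = sum_t pi(x_t) lam_t], the matrix of [S_(F_T) x] *)
(* in ell^2(G, H) has the same (r, q) entry as [T(pi(x_t) lam_t)], [t = r q^-1], *)
(* and the matrix [(pi(x_(r q^-1)) lam_(r q^-1))_(r, q)] has norm at most [|x|], *)
(* being a corner of the coaction image of [x].  Since [F_Psi = F], the          *)
(* multiplier [F_T] is close to [F], and [S_(F_T)] has finite rank because [T]   *)
(* has finitely supported range.                                                 *)

From HB Require Import structures.
Require Import Defs.
From mathcomp Require Import all_boot all_order all_algebra finmap complex.
From mathcomp Require Import sesquilinear ring lra.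
From mathcomp Require Import boolp classical_sets functions cardinality fsbigop.
From mathcomp Require Import reals ereal topology normedtype sequences esum.

Set Implicit Arguments.
Unset Strict Implicit.
Unset Printing Implicit Defensive.
Import Order.TTheory GRing.Theory Num.Theory.
Import Normc numFieldNormedType.Exports.
Local Open Scope classical_set_scope.
Local Open Scope ring_scope.

(** * Bounded operators and operator matrices *)

(** Write X for the crossed product and Psi for S_F. A completely bounded map T on X has a transform
    F_T: the operator F_T(t)(a) is the Fourier coefficient at t of T(pi(a) lam_t). The transform is
    linear in T, satisfies |F_T|_m <= |T|_cb, and returns F when T is Psi ([coef_multiplier]). So it
    is enough to approximate Psi in cb-norm by finite rank maps whose transforms are multipliers of
    finite rank.

    The approximants come from the SOAP ([soap_approx]). Its convergence is pointwise on B(K) tensor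
    X, but K is arbitrary. With K = ell^2(J), J indexing the rows of all square matrices, every
    Psi(x) with x in the unit ball of some M_m(X) becomes a block of one operator u. Complete
    compactness keeps all blocks uniformly close to matrices over one finite-dimensional Y, and a
    bounded block family over Y is a finite sum of elementary tensors ([blk_finite_dim]); hence u
    lies in the minimal tensor product. Convergence at u bounds all blocks at once, so some finite
    rank Phi makes Phi o Psi close to Psi in cb-norm.

    Coordinates ([dual_basis]) write Phi o Psi as a sum of phi_l(.) b_l with bounded functionals
    phi_l. Bounded functionals are completely bounded with the same constant ([functional_mxbound]),
    so each b_l may be replaced by a nearby pi_tilde(f_l) with f_l finitely supported
    ([crossed_fin_approx]). The transform of the resulting map only produces the finitely many
    monomials pi(f_l(t)) lam_t, which gives finite rank ([finite_rank_herz_schur]).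

    The inequality |F_T|_m <= |T|_cb ([transform_multiplier]) is a Schur product argument. The (r,
    q) entry of S_(F_T)(x) on ell^2(G, H) equals that of T(pi(x_t) lam_t) for t = r q^-1. Hence
    S_(F_T)(x) is a compression of T applied entrywise to the matrix [amplified], whose norm is at
    most |x| by [amplified_mxbound]. Finite matrices suffice by [mxbound_fin_test]. *)

Section real_sums.
Variables (R : realType) (P : finType).
Implicit Types a b : P -> R.

(** Cauchy-Schwarz through Lagrange's identity: the double sum of [(a p * b q - a q * b p) ^+ 2] is
    twice the difference of the two sides. *)
Lemma sum_mul_sqr_le a b :
  (\sum_p a p * b p) ^+ 2 <= (\sum_p a p ^+ 2) * (\sum_p b p ^+ 2).
Proof.
have : 0 <= \sum_p \sum_q (a p * b q - a q * b p) ^+ 2.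
  by apply: sumr_ge0 => p _; apply: sumr_ge0 => q _; exact: sqr_ge0.
have -> : \sum_p \sum_q (a p * b q - a q * b p) ^+ 2 =
    \sum_p \sum_q (a p ^+ 2 * b q ^+ 2) + \sum_p \sum_q (a q ^+ 2 * b p ^+ 2)
    - 2 * \sum_p \sum_q ((a p * b p) * (a q * b q)).
  rewrite mulr_sumr -big_split -sumrB; apply: eq_bigr => p _ /=.
  rewrite mulr_sumr -big_split -sumrB; apply: eq_bigr => q _ /=; ring.
rewrite [in X in _ + X - _]exchange_big/=.
rewrite -!big_distrlr/= expr2; lra.
Qed.

Lemma sum_mul_le a b A B : 0 <= A -> 0 <= B ->
  \sum_p a p ^+ 2 <= A ^+ 2 -> \sum_p b p ^+ 2 <= B ^+ 2 ->
  \sum_p a p * b p <= A * B.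
Proof.
move=> A0 B0 aA bB.
apply: (le_trans (ler_norm _)).
rewrite -(ler_pXn2r (n:=2))// ?nnegrE ?mulr_ge0// real_normK ?num_real//.
apply: (le_trans (sum_mul_sqr_le a b)); rewrite exprMn.
by apply: ler_pM => //; apply: sumr_ge0 => p _; exact: sqr_ge0.
Qed.

Lemma sum_sqr_le_sqr_sum a : (forall p, 0 <= a p) ->
  \sum_p a p ^+ 2 <= (\sum_p a p) ^+ 2.
Proof.
move=> a0; rewrite [leRHS]expr2 mulr_suml; apply: ler_sum => p _.
rewrite expr2 ler_wpM2l// (bigD1 p)//= lerDl.
by apply: sumr_ge0 => q _; exact: a0.
Qed.

End real_sums.

Lemma invS_small (R : realType) (e : R) : 0 < e ->
  exists N, forall n, (N <= n)%N -> n.+1%:R^-1 < e.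
Proof.
move=> e0; exists (Num.truncn e^-1) => n Nn.
rewrite -[ltRHS]invrK ltf_pV2 ?posrE ?invr_gt0//.
by apply: lt_le_trans (truncnS_gt _) _; rewrite ler_nat.
Qed.

Section hilbert_sums.
Variables (R : realType) (V : preHilbertType R).

Lemma hilnorm_sum (I : Type) (r : seq I) (Q : pred I) (f : I -> V) :
  hilnorm (\sum_(i <- r | Q i) f i) <= \sum_(i <- r | Q i) hilnorm (f i).
Proof.
elim/big_ind2: _ => [|x a y b xa yb|//]; first by rewrite hilnorm0.
by apply: (le_trans (ler_hilnormD _ _)); exact: lerD.
Qed.

Lemma hilnorm_le_sqr (x : V) (M : R) : 0 <= M ->
  (hilnorm x <= M) = (hilnorm x ^+ 2 <= M ^+ 2).
Proof. by move=> M0; rewrite ler_pXn2r// nnegrE hilnorm_ge0. Qed.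

Lemma normc_ge0 (a : R[i]) : 0 <= normc a.
Proof. by case: a => b c; exact: sqrtr_ge0. Qed.

Lemma normcR (r : R) : normc r%:C%C = `|r|.
Proof. by rewrite /= expr0n addr0 sqrtr_sqr. Qed.

(** Multiplying [x] by the conjugate of [dotp x y] makes the inner product real and nonnegative,
    which reduces the claim to [Re_dotp_le]. *)
Lemma normc_dotp_le (x y : V) : normc (dotp x y) <= hilnorm x * hilnorm y.
Proof.
have [d0|d0] := eqVneq (dotp x y) 0.
  by rewrite d0 normc0 mulr_ge0 ?hilnorm_ge0.
have n0 : 0 < normc (dotp x y).
  by rewrite lt_def normc_ge0 andbT; apply: contra d0 => /eqP/eq0_normc ->.
have := Re_dotp_le (Num.conj (dotp x y) *: x) y.
rewrite hilnormZ linearZl_LR/=.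
have -> : normc (Num.conj (dotp x y)) = normc (dotp x y).
  by case: (dotp x y) => a b /=; rewrite sqrrN.
have -> : complex.Re (Num.conj (dotp x y) * dotp x y) = normc (dotp x y) ^+ 2.
  case: (dotp x y) => a b /=; rewrite sqr_sqrtr ?addr_ge0 ?sqr_ge0//; ring.
by rewrite expr2 -mulrA ler_pM2l.
Qed.

End hilbert_sums.

Section bop_theory.
Variables (R : realType) (V : hilbertType R).
Implicit Types S T : bop V.

Lemma bop_linear T : linear T.
Proof. by have /asboolP[] : (T : V -> V) \in bop_pred (V:=V) := valP T. Qed.

HB.instance Definition _ T :=
  GRing.isLinear.Build R[i] V V *:%R (bop_fun T) (bop_linear T).

Lemma bop0 T : T 0 = 0. Proof. exact: linear0. Qed.
Lemma bopB T x y : T (x - y) = T x - T y. Proof. exact: linearB. Qed.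
Lemma bopZ T a x : T (a *: x) = a *: T x. Proof. exact: linearZ. Qed.
Lemma bopP T a x y : T (a *: x + y) = a *: T x + T y. Proof. exact: linearP. Qed.
Lemma bop_sum T (I : Type) (r : seq I) (Q : pred I) (f : I -> V) :
  T (\sum_(i <- r | Q i) f i) = \sum_(i <- r | Q i) T (f i).
Proof. exact: linear_sum. Qed.

Lemma bop_ext S T : (forall x, S x = T x) -> S = T.
Proof. by move=> h; apply/val_inj/funext. Qed.

Lemma bopDE S T x : (S + T) x = S x + T x. Proof. by []. Qed.
Lemma bopBE S T x : (S - T) x = S x - T x. Proof. by []. Qed.
Lemma bopZE a T x : (a *: T) x = a *: T x. Proof. by []. Qed.
Lemma bop0E x : (0 : bop V) x = 0. Proof. by []. Qed.
Lemma bop_compE S T x : bop_comp S T x = S (T x). Proof. by []. Qed.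
Lemma bop_sumE (I : Type) (r : seq I) (Q : pred I) (f : I -> bop V) x :
  (\sum_(i <- r | Q i) f i) x = \sum_(i <- r | Q i) f i x.
Proof. by elim/big_rec2: _ => // i S v _ <-. Qed.

Lemma opnorm_ubound T :
  has_ubound [set hilnorm (T x) | x in [set x | hilnorm x <= 1]].
Proof.
have /asboolP[_ [M TM]] : (T : V -> V) \in bop_pred (V:=V) := valP T.
exists `|M| => _ [x /= x1 <-]; apply: (le_trans (TM x)).
apply: (@le_trans _ _ (`|M| * hilnorm x)).
  by rewrite ler_wpM2r ?hilnorm_ge0 ?ler_norm.
by rewrite ler_piMr.
Qed.

Lemma opnorm_ge0 T : 0 <= opnorm T.
Proof.
apply: (le_trans (hilnorm_ge0 (T 0))); apply: ub_le_sup (opnorm_ubound T) _ _.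
by exists 0 => //=; rewrite hilnorm0.
Qed.

Lemma hilnorm_scale_inv (x : V) : x != 0 ->
  hilnorm ((hilnorm x)^-1%:C%C *: x) = 1.
Proof.
move=> x0; have n0 : hilnorm x != 0 by apply: contra x0 => /eqP/hilnorm_eq0->.
by rewrite hilnormZ normcR ger0_norm ?invr_ge0 ?hilnorm_ge0// mulVf.
Qed.

Lemma opnormP T x : hilnorm (T x) <= opnorm T * hilnorm x.
Proof.
have [->|x0] := eqVneq x 0; first by rewrite linear0 !hilnorm0 mulr0.
have n0 : 0 < hilnorm x.
  by rewrite lt_def hilnorm_ge0 andbT; apply: contra x0 => /eqP/hilnorm_eq0->.
have : hilnorm (T ((hilnorm x)^-1%:C%C *: x)) <= opnorm T.
  apply: ub_le_sup (opnorm_ubound T) _ _; exists ((hilnorm x)^-1%:C%C *: x) => //=.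
  by rewrite hilnorm_scale_inv.
rewrite linearZ/= hilnormZ normcR ger0_norm ?invr_ge0 ?hilnorm_ge0//.
by rewrite ler_pdivrMl// mulrC.
Qed.

Lemma opnorm_le T M : 0 <= M -> (forall x, hilnorm (T x) <= M * hilnorm x) ->
  opnorm T <= M.
Proof.
move=> M0 TM; apply: ge_sup; first by exists (hilnorm (T 0)), 0 => //=; rewrite hilnorm0.
by move=> _ [x /= x1 <-]; apply: (le_trans (TM x)); rewrite ler_piMr.
Qed.

Lemma opnorm0 : opnorm (0 : bop V) = 0.
Proof.
apply/le_anti; rewrite opnorm_ge0 andbT; apply: opnorm_le => // x.
by rewrite hilnorm0 mul0r.
Qed.

Lemma opnorm_eq0 T : opnorm T = 0 -> T = 0.
Proof.
move=> T0; apply: bop_ext => x; apply: hilnorm_eq0; apply/le_anti.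
by rewrite hilnorm_ge0 andbT (le_trans (opnormP T x))// T0 mul0r.
Qed.

Lemma opnorm_small_eq0 T C : 0 <= C -> (forall e : R, 0 < e -> opnorm T <= C * e) -> T = 0.
Proof.
move=> C0 h; apply: opnorm_eq0; apply/le_anti; rewrite opnorm_ge0 andbT.
apply/ler_addgt0Pr => e e0; rewrite add0r.
have C1 : 0 < C + 1 by lra.
have := h _ (divr_gt0 e0 C1); move/le_trans; apply.
by rewrite mulrA ler_pdivrMr//; nra.
Qed.

Lemma ler_opnormD S T : opnorm (S + T) <= opnorm S + opnorm T.
Proof.
apply: opnorm_le => [|x]; first by rewrite addr_ge0 ?opnorm_ge0.
by rewrite mulrDl (le_trans (ler_hilnormD _ _))// lerD// opnormP.
Qed.

Lemma opnormZ_le a T : opnorm (a *: T) <= normc a * opnorm T.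
Proof.
apply: opnorm_le => [|x]; first by rewrite mulr_ge0 ?opnorm_ge0 ?normc_ge0.
by rewrite hilnormZ -mulrA ler_wpM2l ?normc_ge0 ?opnormP.
Qed.

Lemma opnormN T : opnorm (- T) = opnorm T.
Proof.
have le S : opnorm (- S) <= opnorm S.
  by rewrite -scaleN1r (le_trans (opnormZ_le _ _))// normcN normc1 mul1r.
by apply/le_anti; rewrite le /= -{1}[T]opprK le.
Qed.

Lemma opnormB S T : opnorm (S - T) = opnorm (T - S).
Proof. by rewrite -opnormN opprB. Qed.

Lemma ler_opnormB S T U : opnorm (S - U) <= opnorm (S - T) + opnorm (T - U).
Proof. by rewrite -[S - U](subrKA T) ler_opnormD. Qed.

Lemma opnorm_sum (I : Type) (r : seq I) (Q : pred I) (f : I -> bop V) :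
  opnorm (\sum_(i <- r | Q i) f i) <= \sum_(i <- r | Q i) opnorm (f i).
Proof.
elim/big_ind2: _ => [|x a y b xa yb|//]; first by rewrite opnorm0.
by apply: (le_trans (ler_opnormD _ _)); exact: lerD.
Qed.

Lemma opnorm_comp S T : opnorm (bop_comp S T) <= opnorm S * opnorm T.
Proof.
apply: opnorm_le => [|x]; first by rewrite mulr_ge0 ?opnorm_ge0.
apply: (le_trans (opnormP S (T x))); rewrite -mulrA.
by rewrite ler_wpM2l ?opnorm_ge0 ?opnormP.
Qed.

Lemma mkbop (f : V -> V) M : linear f -> (forall x, hilnorm (f x) <= M * hilnorm x) ->
  f \in bop_pred (V := V).
Proof. by move=> lf fM; apply/asboolP; split => //; exists M. Qed.

(** The limit exists pointwise because [V] is complete; letting one index of the Cauchy estimate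
    tend to infinity makes the convergence uniform on the unit ball. *)
Lemma bop_complete (u : nat -> bop V) :
  (forall e : R, 0 < e -> exists N, forall m n, (N <= m)%N -> (N <= n)%N ->
    opnorm (u m - u n) < e) ->
  exists T, forall e : R, 0 < e -> exists N, forall n, (N <= n)%N ->
    opnorm (u n - T) <= e.
Proof.
move=> uC.
have uCx x : exists l : V, forall e : R, 0 < e -> exists N, forall n, (N <= n)%N ->
    hilnorm (u n x - l) < e.
  apply: hilbert_complete => e e0.
  have x1 : 0 < hilnorm x + 1 by have := hilnorm_ge0 x; lra.
  have [N uN] := uC _ (divr_gt0 e0 x1); exists N => m n Nm Nn.
  have := uN _ _ Nm Nn; rewrite ltr_pdivlMr// => h.
  apply: le_lt_trans (opnormP (u m - u n) x) _.
  by apply: le_lt_trans h; rewrite ler_wpM2l ?opnorm_ge0// lerDl.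
have [l ul] := choice uCx.
have uniq_lim (x y : V) : (forall e : R, 0 < e -> hilnorm (x - y) < e) -> x = y.
  move=> h; apply/eqP; rewrite -subr_eq0; apply/eqP/hilnorm_eq0/le_anti.
  rewrite hilnorm_ge0 andbT; apply/ler_addgt0Pr => e e0.
  by rewrite add0r ltW// h.
have lin : linear l.
  move=> a x y; apply: uniq_lim => e e0.
  have a1 : 0 < normc a + 2 by have := normc_ge0 a; lra.
  have d0 := divr_gt0 e0 a1; set d := e / _ in d0.
  have [N1 h1] := ul (a *: x + y) _ d0.
  have [N2 h2] := ul x _ d0.
  have [N3 h3] := ul y _ d0.
  pose n := maxn N1 (maxn N2 N3).
  have /h1 {}h1 : (N1 <= n)%N by rewrite leq_max leqnn.
  have /h2 {}h2 : (N2 <= n)%N by rewrite !leq_max leqnn orbT.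
  have /h3 {}h3 : (N3 <= n)%N by rewrite !leq_max leqnn !orbT.
  have -> : l (a *: x + y) - (a *: l x + l y) =
      - (u n (a *: x + y) - l (a *: x + y)) + (a *: (u n x - l x) + (u n y - l y)).
    rewrite (bop_linear (u n)) scalerBr [in RHS]addrACA -opprD [in RHS]addrA.
    by rewrite [in RHS]opprB subrK.
  apply: le_lt_trans (ler_hilnormD _ _) _; rewrite hilnormN.
  have : hilnorm (a *: (u n x - l x) + (u n y - l y)) <= normc a * d + d.
    apply: le_trans (ler_hilnormD _ _) _; rewrite hilnormZ lerD//; last exact: ltW.
    by rewrite ler_wpM2l ?normc_ge0// ltW.
  have -> : e = (normc a + 2) * d by rewrite mulrC divfK// gt_eqF.
  lra.
have bnd e : 0 < e -> exists N, forall n, (N <= n)%N ->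
    forall x, hilnorm (u n x - l x) <= e * hilnorm x.
  move=> e0; have [N uN] := uC _ e0; exists N => n Nn x.
  apply/ler_addgt0Pr => d d0; have [M uM] := ul x _ d0.
  pose m := maxn N M.
  have Nm : (N <= m)%N by rewrite leq_max leqnn.
  have /uM {}uM : (M <= m)%N by rewrite leq_max leqnn orbT.
  rewrite -[u n x - l x](subrKA (u m x)).
  apply: le_trans (ler_hilnormD _ _) _; rewrite lerD//; last exact: ltW.
  apply: (le_trans (opnormP (u n - u m) x)).
  by rewrite ler_wpM2r ?hilnorm_ge0// ltW// uN.
have lP : l \in bop_pred (V := V).
  have [N /(_ N (leqnn N)) h] := bnd 1 ltr01.
  apply: (@mkbop _ (1 + opnorm (u N))) => // x.
  rewrite -[l x](subKr (u N x)); apply: (le_trans (ler_hilnormD _ _)).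
  rewrite hilnormN mulrDl addrC lerD ?opnormP//.
exists (Bop lP) => e e0; have [N h] := bnd e e0; exists N => n Nn.
by apply: opnorm_le; [exact: ltW|exact: h].
Qed.

End bop_theory.

(** * Norm bounds for operator matrices *)

Section matrix_bounds.
Variables (R : realType) (V : hilbertType R).

(* Arbitrary finite index types avoid reindexing product index sets as ['I_m]. *)
Definition mxbound (P : finType) (x : P -> P -> bop V) (B : R) : Prop :=
  forall z : P -> V, \sum_p hilnorm (\sum_q x p q (z q)) ^+ 2 <=
    B ^+ 2 * \sum_q hilnorm (z q) ^+ 2.

Section one_index.
Variable P : finType.
Implicit Types (x y : P -> P -> bop V) (z : P -> V).

Lemma sum_hilnorm_sqr_ge0 z : 0 <= \sum_p hilnorm (z p) ^+ 2.
Proof. by apply: sumr_ge0 => p _; exact: sqr_ge0. Qed.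

Lemma hilnorm_le_sqrt_sum z p : hilnorm (z p) <= Num.sqrt (\sum_q hilnorm (z q) ^+ 2).
Proof.
rewrite hilnorm_le_sqr ?sqrtr_ge0// [leRHS]sqr_sqrtr ?sum_hilnorm_sqr_ge0//.
by rewrite (bigD1 p)//= lerDl sumr_ge0// => q _; exact: sqr_ge0.
Qed.

Lemma mxbound_opnorm_sum x : mxbound x (\sum_p \sum_q opnorm (x p q)).
Proof.
move=> z; set N := Num.sqrt (\sum_q hilnorm (z q) ^+ 2).
have -> : \sum_q hilnorm (z q) ^+ 2 = N ^+ 2.
  by rewrite sqr_sqrtr ?sum_hilnorm_sqr_ge0.
rewrite -exprMn mulr_suml.
have le p : hilnorm (\sum_q x p q (z q)) <= (\sum_q opnorm (x p q)) * N.
  rewrite mulr_suml; apply: (le_trans (hilnorm_sum _ _ _)).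
  apply: ler_sum => q _; apply: (le_trans (opnormP _ _)).
  by rewrite ler_wpM2l ?opnorm_ge0 ?hilnorm_le_sqrt_sum.
have ge0 p : 0 <= (\sum_q opnorm (x p q)) * N.
  exact: le_trans (hilnorm_ge0 _) (le p).
apply: le_trans (sum_sqr_le_sqr_sum ge0).
by apply: ler_sum => p _; rewrite -hilnorm_le_sqr.
Qed.

Lemma mxbound_le x A B : 0 <= A -> A <= B -> mxbound x A -> mxbound x B.
Proof.
move=> A0 AB xA z; apply: (le_trans (xA z)).
by rewrite ler_wpM2r ?sum_hilnorm_sqr_ge0// ler_pXn2r// nnegrE (le_trans A0).
Qed.

Lemma eq_mxbound x y B : (forall p q, x p q = y p q) -> mxbound x B -> mxbound y B.
Proof.
move=> xy xB z; under eq_bigr do under eq_bigr do rewrite -xy.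
exact: xB.
Qed.

Lemma mxboundD x y A B : 0 <= A -> 0 <= B -> mxbound x A -> mxbound y B ->
  mxbound (fun p q => x p q + y p q) (A + B).
Proof.
move=> A0 B0 xA yB z; have := xA z; have := yB z.
set N := \sum_q hilnorm (z q) ^+ 2; have N0 : 0 <= N := sum_hilnorm_sqr_ge0 z.
rewrite -(sqr_sqrtr N0) -!exprMn; set n := Num.sqrt N => hy hx.
have n0 : 0 <= n by exact: sqrtr_ge0.
have hxy := sum_mul_le (mulr_ge0 A0 n0) (mulr_ge0 B0 n0) hx hy.
apply: (@le_trans _ _ (\sum_p (hilnorm (\sum_q x p q (z q))
    + hilnorm (\sum_q y p q (z q))) ^+ 2)).
  apply: ler_sum => p _; under eq_bigr do rewrite bopDE.
  by rewrite big_split -hilnorm_le_sqr ?addr_ge0 ?hilnorm_ge0// ler_hilnormD.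
have E (r t : R) : (r + t) ^+ 2 = r ^+ 2 + t ^+ 2 + (r * t + r * t) by ring.
under eq_bigr do rewrite E; rewrite !big_split/= mulrDl E.
by apply: lerD; apply: lerD.
Qed.

Lemma mxboundZ x A a : mxbound x A -> mxbound (fun p q => a *: x p q) (normc a * A).
Proof.
move=> xA z; rewrite exprMn -mulrA.
under eq_bigr do (under eq_bigr do rewrite bopZE; rewrite -scaler_sumr hilnormZ exprMn).
by rewrite -mulr_sumr ler_wpM2l ?sqr_ge0.
Qed.

Lemma mxboundN x A : mxbound x A -> mxbound (fun p q => - x p q) A.
Proof.
move=> /mxboundZ -/(_ (-1)); rewrite normcN normc1 mul1r.
by apply: eq_mxbound => p q; rewrite scaleN1r.
Qed.

Lemma mxbound_entry x B p q : 0 <= B -> mxbound x B -> opnorm (x p q) <= B.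
Proof.
move=> B0 xB; apply: opnorm_le => // v.
rewrite hilnorm_le_sqr ?mulr_ge0 ?hilnorm_ge0// exprMn.
pose z r : V := if r == q then v else 0.
have zq : z q = v by rewrite /z eqxx.
have z0 r : r != q -> z r = 0 by rewrite /z => /negbTE->.
have <- : \sum_r hilnorm (z r) ^+ 2 = hilnorm v ^+ 2.
  rewrite (bigD1 q)//= zq big1 ?addr0// => r /z0->.
  by rewrite hilnorm0 expr0n.
have <- : \sum_r x p r (z r) = x p q v.
  rewrite (bigD1 q)//= zq big1 ?addr0// => r /z0->; exact: linear0.
apply: le_trans (xB z); rewrite [leRHS](bigD1 p)//= lerDl sumr_ge0// => r _.
exact: sqr_ge0.
Qed.

(** A matrix bound is a closed condition on the constant, so later bounds may be proved up to a
    multiple of an arbitrarily small error. *)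
Lemma mxbound_lim x B c : 0 <= B -> 0 <= c ->
  (forall e : R, 0 < e -> mxbound x (B + c * e)) -> mxbound x B.
Proof.
move=> B0 c0 h z; set N := \sum_q hilnorm (z q) ^+ 2; have N0 : 0 <= N := sum_hilnorm_sqr_ge0 z.
apply/ler_addgt0Pr => d d0.
have k0 : 0 <= (2 * B * c + c ^+ 2) * N.
  by rewrite mulr_ge0// addr_ge0 ?sqr_ge0// !mulr_ge0.
(* For [e <= 1] the excess [((B + c * e) ^+ 2 - B ^+ 2) * N] is at most [k * e]; the [+ 1] keeps [k]
   positive when the first term vanishes. *)
pose k := (2 * B * c + c ^+ 2) * N + 1.
have k1 : 0 < k by rewrite /k; lra.
pose e := Num.min 1 (d / k).
have e0 : 0 < e by rewrite lt_min ltr01 divr_gt0.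
have e1 : e <= 1 by rewrite ge_min lexx.
have ek : e * k <= d by rewrite -ler_pdivlMr// ge_min lexx orbT.
apply: (le_trans (h _ e0 z)); rewrite -/N.
have -> : (B + c * e) ^+ 2 * N = B ^+ 2 * N + (2 * B * c + c ^+ 2 * e) * N * e by ring.
rewrite lerD2l; apply: (le_trans _ ek); rewrite [leRHS]mulrC ler_wpM2r ?ltW//.
rewrite /k; have : c ^+ 2 * e * N <= c ^+ 2 * N.
  by rewrite ler_wpM2r// ler_piMr ?sqr_ge0.
lra.
Qed.

End one_index.

Lemma mxbound_unit (x : bop V) : mxbound (fun _ _ : unit => x) (opnorm x).
Proof.
move=> z; rewrite !(big_pred1 tt) -?exprMn -?hilnorm_le_sqr;
  by [rewrite opnormP| rewrite mulr_ge0 ?opnorm_ge0 ?hilnorm_ge0|case].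
Qed.

Lemma mxbound_reindex (P Q : finType) (f : P -> Q) (x : Q -> Q -> bop V) B :
  bijective f -> mxbound (fun p q => x (f p) (f q)) B <-> mxbound x B.
Proof.
move=> bf; have onf : {on [pred _ | true], bijective f} by apply: onW_bij.
split=> xB z; last first.
  case: (bf) => g fK gK; have := xB (z \o g).
  rewrite (reindex f)// [X in _ <= _ * X](reindex f)//=.
  under [X in _ <= _ * X]eq_bigr do rewrite fK.
  move=> /(le_trans _); apply; apply: ler_sum => p _.
  rewrite [in leRHS](reindex f)//=.
  by under [in leRHS]eq_bigr do rewrite fK.
rewrite (reindex f)// [X in _ <= _ * X](reindex f)//=.
apply: le_trans (xB (z \o f)); apply: ler_sum => p _.
by rewrite [in leLHS](reindex f).
Qed.

Section mxopnorm.
Variables (m : nat) (x : 'M[bop V]_m).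

Lemma mxopnorm_ubound : has_ubound
  [set Num.sqrt (\sum_i hilnorm (\sum_j x i j (xi j)) ^+ 2)
      | xi in [set xi : 'I_m -> V | \sum_j hilnorm (xi j) ^+ 2 <= 1]].
Proof.
exists (\sum_p \sum_q opnorm (x p q)) => _ [xi /= xi1 <-].
have B0 : 0 <= \sum_p \sum_q opnorm (x p q).
  by apply: sumr_ge0 => p _; apply: sumr_ge0 => q _; exact: opnorm_ge0.
rewrite -(ger0_norm B0) -sqrtr_sqr ler_sqrt ?sqr_ge0//.
apply: (le_trans (mxbound_opnorm_sum (fun i j => x i j) xi)).
by rewrite ler_piMr ?sqr_ge0.
Qed.

Lemma mxopnorm_ge0 : 0 <= mxopnorm x.
Proof.
apply: (le_trans (sqrtr_ge0 _)); apply: ub_le_sup mxopnorm_ubound _ _.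
by exists (fun=> 0) => //=; rewrite big1// => i _; rewrite hilnorm0 expr0n.
Qed.

Lemma mxopnormP : mxbound (fun i j => x i j) (mxopnorm x).
Proof.
move=> z; set N := \sum_q hilnorm (z q) ^+ 2.
have N0 : 0 <= N := sum_hilnorm_sqr_ge0 z.
have [N00|Nn0] := eqVneq N 0.
  have z0 q : z q = 0.
    apply: hilnorm_eq0; apply/eqP; rewrite -sqrf_eq0 -/(_ ^+ 2).
    move/eqP: N00; rewrite psumr_eq0 => [|i _]; last exact: sqr_ge0.
    by move/allP => /(_ q (mem_index_enum _)).
  rewrite N00 mulr0 big1// => p _; rewrite big1 ?hilnorm0 ?expr0n// => q _.
  by rewrite z0 linear0.
have Np : 0 < N by rewrite lt_def Nn0.
pose n := Num.sqrt N; have n0 : 0 < n by rewrite sqrtr_gt0.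
have nN : n ^+ 2 = N by rewrite sqr_sqrtr.
have nv : normc n^-1%:C%C = n^-1 by rewrite normcR ger0_norm// invr_ge0 ltW.
have : Num.sqrt (\sum_i hilnorm (\sum_j x i j (n^-1%:C%C *: z j)) ^+ 2) <= mxopnorm x.
  apply: ub_le_sup mxopnorm_ubound _ _; exists (fun j => n^-1%:C%C *: z j) => //=.
  under eq_bigr do rewrite hilnormZ nv exprMn.
  by rewrite -mulr_sumr -/N exprVn nN mulVf.
under eq_bigr do (under eq_bigr do rewrite linearZ/=;
  rewrite -scaler_sumr hilnormZ nv exprMn exprVn nN).
rewrite -mulr_sumr => h; rewrite -ler_pdivrMr// mulrC.
set S := _ * _ in h *; have S0 : 0 <= S.
  by rewrite mulr_ge0 ?invr_ge0// sumr_ge0// => i _; exact: sqr_ge0.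
by rewrite -(sqr_sqrtr S0) ler_pXn2r// nnegrE ?sqrtr_ge0 ?mxopnorm_ge0.
Qed.

Lemma mxopnorm_le B : 0 <= B -> mxbound (fun i j => x i j) B -> mxopnorm x <= B.
Proof.
move=> B0 xB; apply: ge_sup.
  exists (Num.sqrt (\sum_i hilnorm (\sum_j x i j 0) ^+ 2)), (fun=> 0) => //=.
  by rewrite big1// => i _; rewrite hilnorm0 expr0n.
move=> _ [xi /= xi1 <-]; rewrite -(ger0_norm B0) -sqrtr_sqr ler_sqrt ?sqr_ge0//.
by apply: (le_trans (xB xi)); rewrite ler_piMr ?sqr_ge0.
Qed.

End mxopnorm.

End matrix_bounds.

(** * Complete boundedness through matrix bounds *)

Section complete_bounds.
Variables (R : realType) (V : hilbertType R).

Definition lsubspace (U : lmodType R[i]) (X : set U) : Prop :=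
  X 0 /\ forall (a : R[i]) x y, X x -> X y -> X (a *: x + y).

Lemma lsubspaceZ (U : lmodType R[i]) (X : set U) a x : lsubspace X -> X x -> X (a *: x).
Proof. by move=> [X0 XD] Xx; rewrite -[a *: x]addr0; exact: XD. Qed.

Lemma lsubspaceD (U : lmodType R[i]) (X : set U) x y :
  lsubspace X -> X x -> X y -> X (x + y).
Proof. by move=> [X0 XD] Xx Xy; rewrite -[x]scale1r; exact: XD. Qed.

Lemma lsubspaceB (U : lmodType R[i]) (X : set U) x y :
  lsubspace X -> X x -> X y -> X (x - y).
Proof. by move=> [X0 XD] Xx Xy; rewrite -scaleN1r addrC; exact: XD. Qed.

Lemma lsubspace_sum (U : lmodType R[i]) (X : set U) (I : Type) (r : seq I)
  (Q : pred I) (f : I -> U) : lsubspace X -> (forall i, Q i -> X (f i)) ->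
  X (\sum_(i <- r | Q i) f i).
Proof.
move=> sX Xf; apply: big_ind => //; first by case: sX.
by move=> x y; exact: lsubspaceD.
Qed.

Section linear_on.
Variables (U U' : lmodType R[i]) (X : set U) (Phi : U -> U').
Hypotheses (sX : lsubspace X) (lPhi : linear_on X Phi).

Lemma linear_on0 : Phi 0 = 0.
Proof.
have [X0 _] := sX; have := lPhi 1 X0 X0; rewrite !scale1r addr0.
by move/eqP; rewrite -subr_eq0 opprD addrA subrr add0r oppr_eq0 => /eqP.
Qed.

Lemma linear_onZ a x : X x -> Phi (a *: x) = a *: Phi x.
Proof.
by move=> Xx; rewrite -[a *: x]addr0 lPhi ?linear_on0 ?addr0//; case: sX.
Qed.

Lemma linear_onD x y : X x -> X y -> Phi (x + y) = Phi x + Phi y.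
Proof. by move=> Xx Xy; rewrite -{1}[x]scale1r lPhi// scale1r. Qed.

Lemma linear_onB x y : X x -> X y -> Phi (x - y) = Phi x - Phi y.
Proof. by move=> Xx Xy; rewrite addrC -scaleN1r lPhi// scaleN1r addrC. Qed.

Lemma linear_on_sum (I : Type) (r : seq I) (Q : pred I) (f : I -> U) :
  (forall i, Q i -> X (f i)) ->
  Phi (\sum_(i <- r | Q i) f i) = \sum_(i <- r | Q i) Phi (f i).
Proof.
move=> Xf; suff [] : X (\sum_(i <- r | Q i) f i) /\
  Phi (\sum_(i <- r | Q i) f i) = \sum_(i <- r | Q i) Phi (f i) by [].
elim/big_ind2: _ => [|x x' y y' [Xx xx'] [Xy yy']|i Qi].
- by rewrite linear_on0; case: sX.
- by rewrite linear_onD// xx' yy'; split => //; exact: lsubspaceD.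
- by split => //; exact: Xf.
Qed.

End linear_on.

(** For linear maps on a subspace this is the same as [cbnorm X Phi <= c] ([cb_le_cbnorm],
    [cbnorm_cb_le]). Any finite index type and any bound [B] are allowed, so estimates compose
    without renormalising or renumbering. *)
Definition cb_le (W : hilbertType R) (X : set (bop V)) (Phi : bop V -> bop W)
    (c : R) : Prop :=
  forall (P : finType) (x : P -> P -> bop V) B, 0 <= B ->
    (forall p q, X (x p q)) -> mxbound x B ->
    mxbound (fun p q => Phi (x p q)) (c * B).

Variables (W : hilbertType R) (X : set (bop V)).
Implicit Types Phi Psi : bop V -> bop W.

Lemma cb_leP Phi c x : 0 <= c -> cb_le X Phi c -> X x ->
  opnorm (Phi x) <= c * opnorm x.
Proof.
move=> c0 h Xx; have := h _ _ _ (opnorm_ge0 x) (fun _ _ => Xx) (mxbound_unit x).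
by move/mxbound_entry => /(_ tt tt); apply; rewrite mulr_ge0 ?opnorm_ge0.
Qed.

Lemma cb_leD Phi Psi c d : 0 <= c -> 0 <= d -> cb_le X Phi c -> cb_le X Psi d ->
  cb_le X (fun x => Phi x + Psi x) (c + d).
Proof.
move=> c0 d0 h k P x B B0 Xx xB; rewrite mulrDl.
by apply: mxboundD; rewrite ?mulr_ge0//; [exact: h|exact: k].
Qed.

Lemma cb_le_le Phi c d : 0 <= c -> c <= d -> cb_le X Phi c -> cb_le X Phi d.
Proof.
move=> c0 cd h P x B B0 Xx xB; apply: (@mxbound_le _ _ _ _ (c * B)).
- exact: mulr_ge0.
- by rewrite ler_wpM2r.
- exact: h.
Qed.

Lemma cb_le_cbnorm Phi c : 0 <= c -> cb_le X Phi c -> (cbnorm X Phi <= c%:E)%E.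
Proof.
move=> c0 h; apply: ge_ereal_sup => _ [m [x [Xx x1 ->]]].
rewrite lee_fin; apply: mxopnorm_le => //.
have k : mxbound (fun i j => x i j) 1.
  by apply: mxbound_le (mxopnormP x) => //; exact: mxopnorm_ge0.
have := h _ _ _ ler01 Xx k; rewrite mulr1.
by apply: eq_mxbound => p q; rewrite mxE.
Qed.

Lemma cbnorm_ge0 Phi : (0 <= cbnorm X Phi)%E.
Proof.
(* The 0 by 0 matrix has its entries in every [X], even an empty one, so the supremum is over a
   nonempty set. *)
apply: (@le_trans _ _ (mxopnorm (map_mx Phi (0 : 'M[bop V]_0)))%:E).
  by rewrite lee_fin mxopnorm_ge0.
apply: ereal_sup_ubound; exists 0%N, 0; split => //; first by case.
apply: mxopnorm_le => // z; rewrite big_ord0 mulr_ge0 ?sqr_ge0//.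
exact: sum_hilnorm_sqr_ge0.
Qed.

Lemma cbnorm_cb_le Phi : lsubspace X -> linear_on X Phi ->
  (cbnorm X Phi < +oo)%E -> cb_le X Phi (fine (cbnorm X Phi)).
Proof.
move=> sX lPhi fPhi; set c := fine _.
have c0 : 0 <= c by rewrite fine_ge0 ?cbnorm_ge0.
have cE : (cbnorm X Phi = c%:E)%E by rewrite fineK// ge0_fin_numE ?cbnorm_ge0.
(* As [B] may be 0, the matrix is normalised by [B + e], and [e] is removed at the end by
   [mxbound_lim]. *)
move=> P x B B0 Xx xB; apply: (@mxbound_lim _ _ _ _ _ c); rewrite ?mulr_ge0//.
move=> e e0; rewrite -mulrDr.
have Be : 0 < B + e by lra.
have nE : normc (B + e)^-1%:C%C = (B + e)^-1 by rewrite normcR ger0_norm ?invr_ge0 ?ltW.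
pose y : 'M[bop V]_#|P| := \matrix_(i, j) ((B + e)^-1%:C%C *: x (enum_val i) (enum_val j)).
have bij := enum_val_bij P.
have y1 : mxopnorm y <= 1.
  apply: mxopnorm_le => //.
  apply: (@eq_mxbound _ _ _ (fun i j => (B + e)^-1%:C%C *: x (enum_val i) (enum_val j))).
    by move=> i j; rewrite mxE.
  have /(mxbound_reindex x (B + e) bij) : mxbound x (B + e).
    by apply: mxbound_le xB => //; lra.
  by move=> /mxboundZ -/(_ (B + e)^-1%:C%C); rewrite nE mulVf ?gt_eqF.
have : ((mxopnorm (map_mx Phi y))%:E <= cbnorm X Phi)%E.
  apply: ereal_sup_ubound; exists #|P|, y; split => // i j.
  by rewrite mxE; exact: lsubspaceZ.
rewrite cE lee_fin => yc.
have /mxboundZ -/(_ (B + e)%:C%C) := mxbound_le (mxopnorm_ge0 _) yc (mxopnormP _).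
rewrite normcR ger0_norm ?(ltW Be)// mulrC => h.
apply/(mxbound_reindex _ (c * (B + e)) bij).
apply: eq_mxbound h => i j; rewrite !mxE (linear_onZ sX lPhi)// scalerA.
by rewrite -rmorphM mulfV ?gt_eqF// scale1r.
Qed.

Lemma completely_bounded_cb_le Z Phi : lsubspace X -> completely_bounded X Z Phi ->
  exists2 c, 0 <= c & cb_le X Phi c.
Proof.
move=> sX [_ lPhi fPhi]; exists (fine (cbnorm X Phi)).
  by rewrite fine_ge0 ?cbnorm_ge0.
exact: cbnorm_cb_le.
Qed.

Lemma cb_le_completely_bounded Z Phi c : (forall x, X x -> Z (Phi x)) ->
  linear_on X Phi -> 0 <= c -> cb_le X Phi c -> completely_bounded X Z Phi.
Proof.
by move=> XZ lPhi c0 h; split => //; apply: le_lt_trans (cb_le_cbnorm c0 h) (ltry _).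
Qed.

End complete_bounds.

(** * Square-summable families *)

Section l2_tools.
Variables (R : realType) (I : choiceType) (V : hilbertType R).
Implicit Types (f : I -> V) (x y : l2 I V) (s E : seq I).

Lemma l2_ext x y : (forall i, x i = y i) -> x = y.
Proof. by move=> h; apply/val_inj/funext. Qed.

Lemma l2DE x y i : (x + y) i = x i + y i. Proof. by []. Qed.
Lemma l2BE x y i : (x - y) i = x i - y i. Proof. by []. Qed.
Lemma l2ZE a x i : (a *: x) i = a *: x i. Proof. by []. Qed.
Lemma l2_sumE (J : Type) (r : seq J) (Q : pred J) (F : J -> l2 I V) i :
  (\sum_(j <- r | Q j) F j) i = \sum_(j <- r | Q j) F j i.
Proof. by elim/big_rec2: _ => // j u v _ <-. Qed.

Lemma esum_le_uniq (a : I -> R) (B : R) :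
  (forall s, uniq s -> \sum_(i <- s) a i <= B) ->
  (\esum_(i in setT) (a i)%:E <= B%:E)%E.
Proof.
move=> h; apply: ge_ereal_sup => _ [A [finA _] <-].
by rewrite fsbig_finite// sumEFin lee_fin h// fset_uniq.
Qed.

Lemma l2_predP f (B : R) :
  (forall s, uniq s -> \sum_(i <- s) hilnorm (f i) ^+ 2 <= B) ->
  f \in l2_pred (I := I) (V := V).
Proof.
by move=> h; apply/asboolP; apply: le_lt_trans (esum_le_uniq h) (ltry _).
Qed.

Lemma hilnorm_l2E x :
  ((hilnorm x ^+ 2)%:E = \esum_(i in setT) (hilnorm (x i) ^+ 2)%:E)%E.
Proof.
rewrite l2_hilnorm_sqr usum_ge0E; last by move=> i; exact: sqr_ge0.
rewrite fineK//.
by apply: (ge0_usummable_fin (f := fun i => hilnorm (x i) ^+ 2)) => [i|];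
  [exact: sqr_ge0|exact: l2_summable].
Qed.

Lemma hilnorm_l2_le x (B : R) : 0 <= B ->
  (forall s, uniq s -> \sum_(i <- s) hilnorm (x i) ^+ 2 <= B ^+ 2) ->
  hilnorm x <= B.
Proof.
move=> B0 h; rewrite hilnorm_le_sqr// -lee_fin hilnorm_l2E.
exact: esum_le_uniq.
Qed.

Lemma sum_uniq_sub_le (a : I -> R) s s' : (forall i, 0 <= a i) ->
  uniq s -> {subset s <= s'} -> uniq s' ->
  \sum_(i <- s) a i <= \sum_(i <- s') a i.
Proof.
move=> a0 us ss us'; rewrite [leRHS](bigID (mem s))/=.
have -> : \sum_(i <- s) a i = \sum_(i <- s' | i \in s) a i.
  rewrite -[RHS]big_filter; apply: perm_big; apply: uniq_perm => //.
    exact: filter_uniq.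
  by move=> i; rewrite mem_filter; case si : (i \in s) => //=; rewrite ss.
by rewrite lerDl sumr_ge0.
Qed.

Lemma l2_partial_sum x (e : R) : 0 < e ->
  exists2 E, uniq E & hilnorm x ^+ 2 - e < \sum_(i <- E) hilnorm (x i) ^+ 2.
Proof.
move=> e0.
have fin : (\esum_(i in setT) (hilnorm (x i) ^+ 2)%:E)%E \is a fin_num.
  by rewrite -hilnorm_l2E.
have [_ [A [finA _] <-]] := ub_ereal_sup_adherent e0 fin.
rewrite -[ereal_sup _]/(\esum_(i in setT) (hilnorm (x i) ^+ 2)%:E)%E -hilnorm_l2E.
rewrite fsbig_finite// sumEFin -EFinB lte_fin => h.
by exists (fset_set A) => //; exact: fset_uniq.
Qed.

Lemma fin_l2_subproof E f :
  (fun i => if i \in E then f i else 0) \in l2_pred (I := I) (V := V).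
Proof.
apply: (@l2_predP _ (\sum_(i <- undup E) hilnorm (f i) ^+ 2)) => s us.
rewrite (bigID (mem E))/= [X in _ + X]big1 ?addr0; last first.
  by move=> i /negbTE->; rewrite hilnorm0 expr0n.
under eq_bigr => i iE do rewrite iE.
rewrite -big_filter; apply: sum_uniq_sub_le => [i||i|]; rewrite ?undup_uniq//.
- exact: sqr_ge0.
- exact: filter_uniq.
- by rewrite mem_filter mem_undup => /andP[].
Qed.

Definition fin_l2 E f : l2 I V := L2 (fin_l2_subproof E f).

Lemma fin_l2E E f i : fin_l2 E f i = if i \in E then f i else 0.
Proof. by []. Qed.

Lemma hilnorm_fin_l2 E f : uniq E ->
  hilnorm (fin_l2 E f) ^+ 2 = \sum_(i <- E) hilnorm (f i) ^+ 2.
Proof.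
move=> uE; have Ef : \sum_(i <- E) hilnorm (fin_l2 E f i) ^+ 2 =
    \sum_(i <- E) hilnorm (f i) ^+ 2.
  by apply: eq_big_seq => i iE; rewrite fin_l2E iE.
apply/le_anti/andP; split; last by rewrite -Ef l2_hilnorm_ge_sum.
rewrite -lee_fin hilnorm_l2E; apply: esum_le_uniq => s us.
rewrite (bigID (mem E))/= [X in _ + X]big1 ?addr0; last first.
  by move=> i /negbTE iE; rewrite iE hilnorm0 expr0n.
rewrite -Ef -big_filter; apply: sum_uniq_sub_le => [i||i|] //.
- exact: sqr_ge0.
- exact: filter_uniq.
- by rewrite mem_filter => /andP[].
Qed.

Lemma hilnorm_sub_fin_l2 x E : uniq E ->
  hilnorm (x - fin_l2 E x) ^+ 2 <= hilnorm x ^+ 2 - \sum_(i <- E) hilnorm (x i) ^+ 2.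
Proof.
move=> uE; pose y : l2 I V := x - fin_l2 E x; rewrite -/y.
have yE i : i \in E -> y i = 0 by move=> iE; rewrite l2BE fin_l2E iE subrr.
have ynE i : i \notin E -> y i = x i.
  by move=> /negbTE iE; rewrite l2BE fin_l2E iE subr0.
clearbody y; rewrite -lee_fin hilnorm_l2E; apply: esum_le_uniq => s us.
rewrite (bigID (mem E))/= big1 ?add0r; last first.
  by move=> i iE; rewrite yE// hilnorm0 expr0n.
under eq_bigr => i iE do rewrite ynE//.
rewrite lerBrDr -big_filter -big_cat; apply: l2_hilnorm_ge_sum.
rewrite cat_uniq filter_uniq// uE andbT/=.
by apply/hasPn => i iE; rewrite mem_filter /= iE.
Qed.

(** The estimate is stated for every finite set containing [E], so that several vectors can be
    truncated along one common set. *)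
Lemma l2_fin_approx x (e : R) : 0 < e -> exists2 E, uniq E &
  forall E', uniq E' -> {subset E <= E'} -> hilnorm (x - fin_l2 E' x) < e.
Proof.
move=> e0; have [E uE xE] := l2_partial_sum x (exprn_gt0 2 e0).
exists E => // E' uE' EE'.
rewrite -(ltr_pXn2r (n := 2))// ?nnegrE ?hilnorm_ge0 ?(ltW e0)//.
apply: le_lt_trans (hilnorm_sub_fin_l2 x uE') _.
have : \sum_(i <- E) hilnorm (x i) ^+ 2 <= \sum_(i <- E') hilnorm (x i) ^+ 2.
  by apply: sum_uniq_sub_le => // i; exact: sqr_ge0.
lra.
Qed.

Definition dlt (i : I) (v : V) : l2 I V := fin_l2 [:: i] (fun=> v).

Lemma dltE i v j : dlt i v j = if j == i then v else 0.
Proof. by rewrite fin_l2E inE. Qed.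

Lemma hilnorm_dlt i v : hilnorm (dlt i v) = hilnorm v.
Proof.
apply/eqP; rewrite -(eqrXn2 (n := 2)) ?hilnorm_ge0//.
by rewrite hilnorm_fin_l2// big_seq1.
Qed.

Lemma dlt_linear i : linear (dlt i).
Proof.
move=> a u v; apply: l2_ext => j; rewrite l2DE l2ZE !dltE.
by case: ifP => // _; rewrite scaler0 addr0.
Qed.

HB.instance Definition _ i :=
  GRing.isLinear.Build R[i] V (l2 I V) *:%R (dlt i) (dlt_linear i).

Lemma fin_l2_sum_dlt E f : uniq E -> fin_l2 E f = \sum_(i <- E) dlt i (f i).
Proof.
move=> uE; apply: l2_ext => j; rewrite l2_sumE fin_l2E.
under eq_bigr do rewrite dltE.
case: ifPn => [jE|jE].
  rewrite (bigD1_seq j)//= eqxx big1 ?addr0// => i.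
  by rewrite eq_sym => /negbTE->.
by rewrite big_seq big1// => i iE; case: eqP jE => // ->; rewrite iE.
Qed.

(** [l2_op] is picked by [xget], so its formula becomes available only after a bounded operator with
    that formula has been exhibited; bounds on finite partial sums provide one. *)
Lemma l2_opP (g : (I -> V) -> I -> V) (M : R) : 0 <= M ->
  (forall a x y i, g (a *: x + y : l2 I V) i = a *: g x i + g y i) ->
  (forall x s, uniq s -> \sum_(i <- s) hilnorm (g x i) ^+ 2 <= M ^+ 2 * hilnorm x ^+ 2) ->
  (forall x, l2_op g x = g x :> (I -> V)) /\ opnorm (l2_op g) <= M.
Proof.
move=> M0 lg gM.
have gl2 x : g x \in l2_pred (I := I) (V := V) by exact: l2_predP (gM x).
pose f x : l2 I V := L2 (gl2 x).
have fM x : hilnorm (f x) <= M * hilnorm x.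
  apply: hilnorm_l2_le => [|s us]; first by rewrite mulr_ge0 ?hilnorm_ge0.
  by rewrite exprMn gM.
have lf : linear f by move=> a x y; apply: l2_ext => i; exact: lg.
have ex : exists T : bop (l2 I V), forall x : l2 I V, T x = g x :> (I -> V).
  by exists (Bop (mkbop lf fM)).
have h : forall x : l2 I V, l2_op g x = g x :> (I -> V) := xgetPex 0 ex.
split=> //; apply: opnorm_le => // x.
by rewrite (_ : l2_op g x = f x)//; apply: l2_ext => i; rewrite h.
Qed.

Lemma entry_subproof (T : bop (l2 I V)) p q :
  (fun v => T (dlt q v) p) \in bop_pred (V := V).
Proof.
apply: (@mkbop _ _ _ (opnorm T)) => [a u v|v]; first by rewrite !linearP l2DE l2ZE.
apply: (le_trans (l2_hilnorm_ge (T (dlt q v)) p)).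
by apply: (le_trans (opnormP T (dlt q v))); rewrite hilnorm_dlt.
Qed.

(* Locked: otherwise unification compares distinct entries by unfolding them. *)
Definition entry p q (T : bop (l2 I V)) : bop V := locked (Bop (entry_subproof T p q)).

Lemma entryE p q T v : entry p q T v = T (dlt q v) p.
Proof. by rewrite /entry -lock. Qed.

Lemma entryP p q a S T : entry p q (a *: S + T) = a *: entry p q S + entry p q T.
Proof. by apply: bop_ext => v; rewrite bopDE bopZE !entryE. Qed.

Lemma entryB p q S T : entry p q (S - T) = entry p q S - entry p q T.
Proof. by apply: bop_ext => v; rewrite bopBE !entryE. Qed.

Lemma entryZ p q a T : entry p q (a *: T) = a *: entry p q T.
Proof. by apply: bop_ext => v; rewrite bopZE !entryE. Qed.

Lemma entry_sum (J : Type) (r : seq J) (Q : pred J) (F : J -> bop (l2 I V)) p q :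
  entry p q (\sum_(j <- r | Q j) F j) = \sum_(j <- r | Q j) entry p q (F j).
Proof.
apply: bop_ext => v; rewrite entryE !bop_sumE l2_sumE.
by under [RHS]eq_bigr do rewrite entryE.
Qed.

Lemma opnorm_entry p q T : opnorm (entry p q T) <= opnorm T.
Proof.
apply: opnorm_le => [|v]; first exact: opnorm_ge0.
rewrite entryE; apply: (le_trans (l2_hilnorm_ge (T (dlt q v)) p)).
by apply: (le_trans (opnormP T (dlt q v))); rewrite hilnorm_dlt.
Qed.

Lemma bop_fin_l2 (T : bop (l2 I V)) E f p : uniq E ->
  T (fin_l2 E f) p = \sum_(q <- E) entry p q T (f q).
Proof.
move=> uE; rewrite fin_l2_sum_dlt// linear_sum l2_sumE.
by under [RHS]eq_bigr do rewrite entryE.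
Qed.

End l2_tools.

(** * Automorphisms are contractive *)

Section star_contractive.
Variables (R : realType) (H : hilbertType R).
Implicit Types (A : set (bop H)) (S T : bop H).

Lemma opnorm_adjoint_le S T : is_adjoint S T -> opnorm T <= opnorm S.
Proof.
move=> ST; apply: opnorm_le => [|v]; first exact: opnorm_ge0.
have [->|Tv0] := eqVneq (T v) 0; first by rewrite hilnorm0 mulr_ge0 ?opnorm_ge0 ?hilnorm_ge0.
have n0 : 0 < hilnorm (T v).
  by rewrite lt_def hilnorm_ge0 andbT; apply: contra Tv0 => /eqP/hilnorm_eq0 ->.
rewrite -(ler_pM2l n0) -expr2 hilnorm_sqr -ST.
apply: (le_trans (Re_dotp_le (S (T v)) v)).
rewrite [leRHS]mulrA ler_wpM2r ?hilnorm_ge0// [leRHS]mulrC.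
exact: opnormP.
Qed.

Lemma self_adjoint_lim T :
  (forall e : R, 0 < e -> exists2 S, is_adjoint S S & opnorm (S - T) <= e) ->
  is_adjoint T T.
Proof.
move=> h x y; apply/eqP; rewrite -subr_eq0; apply/eqP/eq0_normc/le_anti.
rewrite normc_ge0 andbT; apply/ler_addgt0Pr => e e0; rewrite add0r.
pose k := 2 * (hilnorm x * hilnorm y) + 1.
have xy0 : 0 <= hilnorm x * hilnorm y by rewrite mulr_ge0 ?hilnorm_ge0.
have k0 : 0 < k by rewrite /k; lra.
have [S SS ST] := h _ (divr_gt0 e0 k0).
have -> : dotp (T x) y - dotp x (T y) = dotp x ((S - T) y) - dotp ((S - T) x) y.
  rewrite !bopBE linearBr linearBl/= -(SS x y); ring.
apply: le_trans (le_normcD _ _) _; rewrite normcN.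
have le (v w : H) : hilnorm ((S - T) v) * hilnorm w <= e / k * (hilnorm v * hilnorm w).
  rewrite mulrA ler_wpM2r ?hilnorm_ge0// (le_trans (opnormP _ _))//.
  by rewrite ler_wpM2r ?hilnorm_ge0.
have := le_trans (normc_dotp_le x ((S - T) y)) _.
move=> /(_ (e / k * (hilnorm x * hilnorm y))); rewrite mulrC [_ * hilnorm y]mulrC le => /(_ isT) h1.
have := le_trans (normc_dotp_le ((S - T) x) y) (le x y) => h2.
have : e / k * k = e by rewrite divfK// gt_eqF.
rewrite /k in h1 h2 *; have := divr_gt0 e0 k0; rewrite /k; lra.
Qed.

Lemma expr_lt_ex (r e : R) : 0 <= r -> r < 1 -> 0 < e -> exists n, r ^+ n < e.
Proof.
move=> r0 r1 e0.
have /cvgrPdist_lt/(_ _ e0) : (fun n => r ^+ n) @ \oo --> (0 : R).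
  by apply: cvg_expr; rewrite ger0_norm.
move=> [N _ /(_ N (leqnn N))]; rewrite sub0r normrN ger0_norm ?exprn_ge0// => ?.
by exists N.
Qed.

(* A fixed point [k] of [k = (b + k^2) / 2] is [1 - sqrt (1 - b)]. *)
Lemma half_square_fixpoint A (b : bop H) :
  cstar_algebra A -> A b -> is_adjoint b b -> opnorm b < 1 ->
  exists k, [/\ A k, is_adjoint k k & k = 2^-1 *: (b + bop_comp k k)].
Proof.
move=> [A0 AD AM _ Acl] Ab bb b1; set r := opnorm b.
have r0 : 0 <= r := opnorm_ge0 b.
pose f (x : bop H) : bop H := 2^-1 *: (b + bop_comp x x).
have half : normc (2^-1 : R[i]) = 2^-1.
  have -> : (2^-1 : R[i]) = (2^-1 : R)%:C%C by rewrite fmorphV rmorph_nat.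
  by rewrite normcR ger0_norm ?invr_ge0.
(* On the ball of radius [r = opnorm b < 1] this makes [f] a contraction of ratio [r]. The iterates
   from 0 stay in that ball, in [A], and self-adjoint. *)
have fD x y : opnorm (f x - f y) <= 2^-1 * (opnorm x + opnorm y) * opnorm (x - y).
  have -> : f x - f y = 2^-1 *: (bop_comp x (x - y) + bop_comp (x - y) y).
    apply: bop_ext => v; rewrite bopBE !bopZE !bopDE -scalerBr.
    congr (_ *: _); rewrite !bop_compE !bopBE linearB/= opprD addrACA subrr add0r.
    by rewrite addrA subrK.
  apply: (le_trans (opnormZ_le _ _)); rewrite half -mulrA ler_wpM2l ?invr_ge0//.
  apply: (le_trans (ler_opnormD _ _)); rewrite mulrDl lerD ?opnorm_comp//.
  by rewrite [leRHS]mulrC opnorm_comp.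
pose u n := iter n f 0.
have Au n : A (u n).
  elim: n => [|n IH]//=; rewrite /f -[_ *: _]addr0; apply: (AD) => //.
  by rewrite -[b]scale1r; apply: (AD) => //; exact: AM.
have su n : is_adjoint (u n) (u n).
  elim: n => [|n IH] x y.
    by rewrite -[u 0%N]/(0 : bop H) !bop0E linear0l linear0r.
  rewrite -[u n.+1]/(f (u n)) /f !bopZE !bopDE !bop_compE linearZl_LR linearZr_LR/=.
  rewrite linearDl linearDr/= bb !IH; congr (_ * _).
  have -> : (2^-1 : R[i]) = (2^-1 : R)%:C%C by rewrite fmorphV rmorph_nat.
  by apply/eqP; rewrite eq_complex/= oppr0 !eqxx.
have ru n : opnorm (u n) <= r.
  elim: n => [|n IH] /=; first by rewrite opnorm0.
  apply: (le_trans (opnormZ_le _ _)); rewrite half.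
  have := ler_opnormD b (bop_comp (u n) (u n)); rewrite -/r.
  have h1 := opnorm_comp (u n) (u n); have h2 := opnorm_ge0 (u n).
  have h3 : opnorm (u n) * opnorm (u n) <= r * 1.
    by apply: ler_pM => //; apply: (le_trans IH); exact: ltW.
  move=> h4; rewrite ler_pdivrMl//; apply: (le_trans h4).
  by rewrite mulrDl mul1r lerD2l (le_trans h1)// (le_trans h3)// mulr1.
have step n d : opnorm (u (n + d)%N - u n) <= r ^+ n.
  elim: n => [|n IH]; first by rewrite add0n subr0 expr0 (le_trans (ru d))// ltW.
  rewrite addSn exprS; apply: (le_trans (fD _ _)).
  rewrite -/(u _) -/(u n); apply: ler_pM => //; rewrite ?opnorm_ge0//.
    by rewrite mulr_ge0 ?invr_ge0// addr_ge0 ?opnorm_ge0.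
  by have := ru (n + d)%N; have := ru n; lra.
have [|k uk] := @bop_complete _ _ u.
  move=> e e0; have [N rN] := expr_lt_ex r0 b1 (divr_gt0 e0 (ltr0n R 2)).
  exists N => m n Nm Nn; apply: le_lt_trans (ler_opnormB _ (u N) _) _.
  rewrite [X in _ + X]opnormB -(subnKC Nm) -(subnKC Nn).
  by apply: le_lt_trans (lerD (step N _) (step N _)) _; lra.
exists k; split.
- apply: Acl => e e0; have [N /(_ N (leqnn N)) h] := uk _ (divr_gt0 e0 (ltr0n R 2)).
  by exists (u N) => //; rewrite opnormB; lra.
- apply: self_adjoint_lim => e e0; have [N /(_ N (leqnn N)) h] := uk _ e0.
  by exists (u N).
- apply/eqP; rewrite -subr_eq0 -/(f k); apply/eqP.
  apply: (@opnorm_small_eq0 _ _ _ (1 + 2^-1 * (r + opnorm k))).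
    by rewrite addr_ge0// mulr_ge0 ?invr_ge0// addr_ge0 ?opnorm_ge0.
  move=> e e0; have [N uN] := uk _ e0.
  have h := uN _ (leqnSn N); have {uN} h' := uN _ (leqnn N).
  apply: (le_trans (ler_opnormB _ (u N.+1) _)); rewrite mulrDl mul1r.
  apply: lerD; first (rewrite opnormB; exact: h).
  apply: (le_trans (fD (u N) k)); apply: ler_pM; rewrite ?opnorm_ge0//.
    by rewrite mulr_ge0 ?invr_ge0// addr_ge0 ?opnorm_ge0.
  by rewrite ler_wpM2l ?invr_ge0// lerD2r ru.
Qed.

(* With [k = 1 - sqrt (1 - a^* a)] in [A], the image [c] of [k] satisfies     *)
(* |phi(a) v|^2 = |v|^2 - |v - c v|^2.                                        *)
Lemma star_automorphism_contractive A (phi : bop H -> bop H) a :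
  cstar_algebra A -> star_automorphism A phi -> A a -> opnorm (phi a) <= opnorm a.
Proof.
move=> cA [_ lphi mphi sphi].
have sA : lsubspace A by case: cA.
have unit_case x : A x -> opnorm x < 1 -> opnorm (phi x) <= 1.
  move=> Ax x1; have [_ _ AM Aadj _] := cA.
  have [y Ay xy] := Aadj x Ax; pose b := bop_comp y x.
  have Ab : A b by exact: AM.
  have bb : is_adjoint b b.
    by move=> v w; rewrite !bop_compE -xy (dotpC w) -xy -dotpC.
  have b1 : opnorm b < 1.
    apply: le_lt_trans (opnorm_comp y x) _.
    apply: le_lt_trans (x1); rewrite ler_piMl ?opnorm_ge0//.
    by apply: (le_trans (opnorm_adjoint_le xy)); exact: ltW.
  have [k [Ak kk kE]] := half_square_fixpoint cA Ab bb b1.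
  pose c := phi k; have cc : is_adjoint c c by exact: sphi.
  (* The relation 2k = b + k^2 contains no unit, so [phi] transports it even if [A] is not
     unital. *)
  have cE : c + c = bop_comp (phi y) (phi x) + bop_comp c c.
    have Akk : A (bop_comp k k) by exact: (AM).
    rewrite -!mphi// -(linear_onD lphi Ab Akk) /c -(linear_onD lphi Ak Ak).
    congr phi.
    have <- : (2 : R[i]) *: k = b + bop_comp k k.
      by rewrite {1}kE scalerA mulfV ?scale1r// pnatr_eq0.
    by rewrite scaler_nat mulr2n.
  apply: opnorm_le => // v; rewrite mul1r hilnorm_le_sqr ?hilnorm_ge0//.
  rewrite hilnorm_sqr (sphi _ _ Ax Ay xy).
  have -> : phi y (phi x v) = c v + c v - c (c v).
    by rewrite -bopDE cE bopDE addrK.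
  have := sqr_ge0 (hilnorm (v - c v)).
  rewrite hilnorm_sqrD hilnormN linearNr linearBr linearDr/= -(cc v (c v)).
  by rewrite -/(hilnorm _) !raddfB !raddfD raddfN/= -hilnorm_sqr; lra.
move=> Aa; apply/ler_addgt0Pr => e e0.
have ae : 0 < opnorm a + e by have := opnorm_ge0 a; lra.
have nE : normc (opnorm a + e)^-1%:C%C = (opnorm a + e)^-1.
  by rewrite normcR ger0_norm// invr_ge0 ltW.
have : opnorm (phi ((opnorm a + e)^-1%:C%C *: a)) <= 1.
  apply: unit_case; first exact: lsubspaceZ.
  apply: le_lt_trans (opnormZ_le _ _) _; rewrite nE mulrC ltr_pdivrMr// mul1r.
  lra.
rewrite (linear_onZ sA lphi)// => h.
have -> : phi a = (opnorm a + e)%:C%C *: ((opnorm a + e)^-1%:C%C *: phi a).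
  by rewrite scalerA -rmorphM mulfV ?gt_eqF// scale1r.
apply: (le_trans (opnormZ_le _ _)); rewrite normcR ger0_norm ?(ltW ae)//.
by rewrite ler_piMr// ltW.
Qed.

End star_contractive.

(** * The reduced crossed product *)

Section operator_sums.
Variables (R : realType) (V : hilbertType R).

Lemma op_closureS (X : set (bop V)) : X `<=` op_closure X.
Proof. by move=> x Xx e e0; exists x => //; rewrite subrr opnorm0. Qed.

Lemma op_closure_lsubspace (X : set (bop V)) : lsubspace X -> lsubspace (op_closure X).
Proof.
move=> sX; have [X0 XD] := sX; split=> [|a x y Xx Xy e e0]; first exact: op_closureS.
have a1 : 0 < normc a + 1 by have := normc_ge0 a; lra.
have d0 := divr_gt0 e0 a1; set d := e / _ in d0.
have [x' Xx' xx'] := Xx _ d0; have [y' Xy' yy'] := Xy _ d0.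
exists (a *: x' + y'); first exact: (XD).
rewrite opprD addrACA -scalerBr; apply: le_lt_trans (ler_opnormD _ _) _.
have := le_trans (opnormZ_le a (x - x')) (ler_wpM2l (normc_ge0 a) (ltW xx')).
have -> : e = (normc a + 1) * d by rewrite mulrC divfK// gt_eqF.
lra.
Qed.

(** Density argument: an identity between bounded linear maps on a closure need only be checked on
    [X]. *)
Lemma bop_closed_eq (V' : hilbertType R) (f : bop V -> bop V') (X : set (bop V)) (M : R) :
  0 <= M -> lsubspace X -> linear_on (op_closure X) f ->
  (forall x, op_closure X x -> opnorm (f x) <= M * opnorm x) ->
  (forall x, X x -> f x = 0) -> forall x, op_closure X x -> f x = 0.
Proof.
move=> M0 sX lf fM f0 x Xx; have sX' := op_closure_lsubspace sX.
apply: (opnorm_small_eq0 M0) => e e0; have [y Xy xy] := Xx _ e0.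
have Xy' := op_closureS Xy.
rewrite -[f x]subr0 -(f0 y Xy) -(linear_onB lf Xx Xy').
apply: (le_trans (fM _ (lsubspaceB sX' Xx Xy'))).
by rewrite ler_wpM2l// ltW.
Qed.

Variable I : choiceType.
Implicit Types u : I -> bop V.

(** The finite set [J n] leaves a tail of norms below 1/(n+1). Comparing through the union of [J m]
    and [J n] shows that the sums over the [J n] form a Cauchy sequence. *)
Lemma abs_op_has_sum u : (\esum_(i in setT) (opnorm (u i))%:E < +oo)%E ->
  exists T, op_has_sum u T.
Proof.
move=> fin; have ge0 : (0 <= \esum_(i in setT) (opnorm (u i))%:E)%E.
  by apply: esum_ge0 => i _; rewrite lee_fin opnorm_ge0.
have finE : (\esum_(i in setT) (opnorm (u i))%:E)%E \is a fin_num.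
  by rewrite ge0_fin_numE.
pose S := fine (\esum_(i in setT) (opnorm (u i))%:E)%E.
have SE : (\esum_(i in setT) (opnorm (u i))%:E)%E = S%:E by rewrite fineK.
have leS (J : {fset I}) : \sum_(i <- J) opnorm (u i) <= S.
  rewrite -lee_fin -SE; apply: esum_ge; exists [set` J].
    by split => //; exact: finite_fset.
  by rewrite -fsbig_seq ?fset_uniq// sumEFin.
have ltS e : 0 < e -> exists J : {fset I}, S - e < \sum_(i <- J) opnorm (u i).
  move=> e0; have [_ [B [finB _] <-]] := ub_ereal_sup_adherent e0 finE.
  rewrite -[ereal_sup _]/(\esum_(i in setT) (opnorm (u i))%:E)%E SE.
  rewrite fsbig_finite// sumEFin -EFinB lte_fin => h.
  by exists (fset_set B).
have inv0 (n : nat) : 0 < n.+1%:R^-1 :> R by rewrite invr_gt0.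
have [J hJ] := choice (fun n => ltS _ (inv0 n)).
have near n (K : {fset I}) : (J n `<=` K)%fset ->
    opnorm (\sum_(i <- K) u i - \sum_(i <- J n) u i) < n.+1%:R^-1.
  move=> JK; have KE (W : nmodType) (f : I -> W) : \sum_(i <- K) f i =
      \sum_(i <- J n) f i + \sum_(i <- (K `\` J n)%fset) f i.
    by rewrite (big_fsetID _ (mem (J n)))/=; congr (_ + _); apply: eq_fbigl => i;
      rewrite !inE/=; case iJ : (i \in J n); rewrite ?andbF ?andbT// (fsubsetP JK).
  rewrite KE addrC addKr; apply: le_lt_trans (opnorm_sum _ _ _) _.
  have h1 := leS K; rewrite KE in h1; have h2 := hJ n; rewrite ltrBlDr in h2.
  by rewrite -(ltrD2l (\sum_(i <- J n) opnorm (u i))); exact: le_lt_trans h1 h2.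
pose v n := \sum_(i <- J n) u i.
have vD m n : opnorm (v m - v n) < m.+1%:R^-1 + n.+1%:R^-1.
  have h1 := near m _ (fsubsetUl (J m) (J n)).
  have h2 := near n _ (fsubsetUr (J m) (J n)).
  apply: le_lt_trans (ler_opnormB _ (\sum_(i <- (J m `|` J n)%fset) u i) _) _.
  by rewrite [X in X + _]opnormB ltrD.
have [|T vT] := @bop_complete _ _ v.
  move=> e e0; have [N hN] := invS_small (divr_gt0 e0 (ltr0n R 2)).
  exists N => m n /hN Nm /hN Nn; apply: (lt_trans (vD m n)).
  by rewrite [ltRHS]splitr ltrD.
exists T => e e0; have e20 := divr_gt0 e0 (ltr0n R 2).
have [N1 h1] := invS_small e20; have [N2 h2] := vT _ e20.
pose N := maxn N1 N2; exists (J N) => K /near.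
have /h1 {}h1 : (N1 <= N)%N by rewrite leq_max leqnn.
have /h2 {}h2 : (N2 <= N)%N by rewrite leq_max leqnn orbT.
move=> h; apply: le_lt_trans (ler_opnormB _ (v N) _) _.
rewrite [ltRHS]splitr ler_ltD//; first by rewrite opnormB.
by rewrite opnormB (lt_trans h).
Qed.

Lemma op_sumP u : (\esum_(i in setT) (opnorm (u i))%:E < +oo)%E ->
  op_has_sum u (op_sum u).
Proof. by move=> /abs_op_has_sum; exact: xgetPex. Qed.

End operator_sums.

(** Finitely supported vectors are dense, and on them an operator is given by its entries. *)
Lemma bop_entry_ext (R : realType) (V : hilbertType R) (I : choiceType)
    (S T : bop (l2 I V)) : (forall p q, entry p q S = entry p q T) -> S = T.
Proof.
move=> ST; apply/eqP; rewrite -subr_eq0; apply/eqP.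
have fin0 E f : uniq E -> (S - T) (fin_l2 E f) = 0.
  move=> uE; apply: l2_ext => p; rewrite bop_fin_l2// big1// => q _.
  have -> : entry p q (S - T) = 0 by rewrite entryB ST subrr.
  by [].
apply: bop_ext => x; apply: hilnorm_eq0; apply/le_anti; rewrite hilnorm_ge0 andbT.
apply/ler_addgt0Pr => e e0; rewrite add0r.
have k0 : 0 < opnorm (S - T) + 1 by have := opnorm_ge0 (S - T); lra.
have [E uE /(_ E uE (fun _ => id)) xE] := l2_fin_approx x (divr_gt0 e0 k0).
have -> : (S - T) x = (S - T) (x - fin_l2 E x) by rewrite [RHS]bopB fin0// subr0.
apply: (le_trans (opnormP (S - T) _)).
apply: (@le_trans _ _ (opnorm (S - T) * (e / (opnorm (S - T) + 1)))).
  by rewrite ler_wpM2l ?opnorm_ge0// ltW.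
rewrite mulrA ler_pdivrMr// mulrC ler_wpM2l// ?(ltW e0)//; lra.
Qed.

(** * Monomials, matrix entries and Fourier coefficients *)

Section crossed_calculus.
Variables (R : realType) (G : groupType) (H : hilbertType R).
Variables (A : set (bop H)) (alpha : G -> bop H -> bop H).
Hypotheses (cA : cstar_algebra A) (act : cstar_action A alpha).
Implicit Types (f : G -> bop H) (r q s t : G) (a : bop H).

Lemma cstar_lsubspace : lsubspace A.
Proof. by case: cA. Qed.
Let sA := cstar_lsubspace.

Lemma alphaA t a : A a -> A (alpha t a).
Proof. by move=> Aa; have [/(_ t) [[+ _ _] _ _ _] _] := act; exact. Qed.

Lemma alpha_lin t : linear_on A (alpha t).
Proof. by have [/(_ t) []] := act. Qed.

Lemma opnorm_alpha t a : A a -> opnorm (alpha t a) <= opnorm a.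
Proof. by have [/(_ t) h _] := act; exact: star_automorphism_contractive. Qed.

Lemma alpha0 t : alpha t 0 = 0.
Proof. exact: linear_on0 sA (@alpha_lin t). Qed.

Lemma alpha1 a : A a -> alpha 1%g a = a.
Proof.
move=> Aa; have [/(_ 1%g) [[_ inj _] _ _ _] aM] := act.
apply: inj; rewrite ?inE//; first exact: alphaA.
by rewrite -aM// mulg1.
Qed.

Lemma lamE t (x : l2 G H) s : lam H t x s = x (t^-1 * s)%g.
Proof.
have [|||h _] := @l2_opP R G H (fun xi s => xi (t^-1 * s)%g) 1 => //.
  move=> y u uu; rewrite expr1n mul1r.
  rewrite -(big_map (fun i => t^-1 * i)%g predT (fun i => hilnorm (y i) ^+ 2)).
  by apply: l2_hilnorm_ge_sum; rewrite map_inj_uniq//; exact: mulgI.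
by rewrite h.
Qed.

(** Contractivity of automorphisms bounds the operators alpha_(s^-1)(a) uniformly in s, so the
    [xget] behind [pi_rep] does find an operator. *)
Lemma pi_repE a (x : l2 G H) s : A a -> pi_rep alpha a x s = alpha s^-1%g a (x s).
Proof.
move=> Aa.
have [|||h _] := @l2_opP R G H (fun xi s => alpha s^-1%g a (xi s)) (opnorm a).
- exact: opnorm_ge0.
- by move=> b y z i; rewrite l2DE l2ZE bopP.
- move=> y u uu; apply: (@le_trans _ _ (opnorm a ^+ 2 * \sum_(i <- u) hilnorm (y i) ^+ 2)).
    rewrite mulr_sumr; apply: ler_sum => i _.
    rewrite -exprMn -hilnorm_le_sqr ?mulr_ge0 ?opnorm_ge0 ?hilnorm_ge0//.
    apply: (le_trans (opnormP _ _)); rewrite ler_wpM2r ?hilnorm_ge0//.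
    exact: opnorm_alpha.
  by rewrite ler_wpM2l ?sqr_ge0// l2_hilnorm_ge_sum.
by rewrite /pi_rep h.
Qed.

(** The monomials pi(a) lam_t with a in [A] span a dense subspace of the crossed product, as
    [crossed_fin_approx] together with [pi_tilde_fin] shows. *)
Definition mono t a : bop (l2 G H) := locked (bop_comp (pi_rep alpha a) (lam H t)).

Lemma mono_comp t a : mono t a = bop_comp (pi_rep alpha a) (lam H t).
Proof. by rewrite /mono -lock. Qed.

Lemma monoE t a (x : l2 G H) s : A a -> mono t a x s = alpha s^-1%g a (x (t^-1 * s)%g).
Proof. by move=> Aa; rewrite mono_comp bop_compE pi_repE// lamE. Qed.

Lemma entry_mono t a r q : A a ->
  entry r q (mono t a) = if q == (t^-1 * r)%g then alpha r^-1%g a else 0.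
Proof.
move=> Aa; apply: bop_ext => v; rewrite entryE monoE// dltE eq_sym.
by case: ifP => // _; exact: linear0.
Qed.

Lemma mono_lin t : linear_on A (mono t).
Proof.
move=> b x y Ax Ay; apply: bop_ext => z; apply: l2_ext => s.
rewrite monoE; last by apply: lsubspaceD => //; exact: lsubspaceZ.
by rewrite bopDE bopZE l2DE l2ZE !monoE// alpha_lin// bopDE bopZE.
Qed.

Lemma opnorm_mono t a : A a -> opnorm (mono t a) <= opnorm a.
Proof.
move=> Aa; apply: opnorm_le => [|x]; first exact: opnorm_ge0.
apply: hilnorm_l2_le => [|u uu]; first by rewrite mulr_ge0 ?opnorm_ge0 ?hilnorm_ge0.
apply: (@le_trans _ _ (opnorm a ^+ 2 * \sum_(i <- [seq (t^-1 * i)%g | i <- u]) hilnorm (x i) ^+ 2)).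
  rewrite big_map mulr_sumr; apply: ler_sum => i _; rewrite monoE//.
  rewrite -exprMn -hilnorm_le_sqr ?mulr_ge0 ?opnorm_ge0 ?hilnorm_ge0//.
  apply: (le_trans (opnormP _ _)); rewrite ler_wpM2r ?hilnorm_ge0//.
  exact: opnorm_alpha.
rewrite exprMn ler_wpM2l ?sqr_ge0// l2_hilnorm_ge_sum// map_inj_uniq//.
exact: mulgI.
Qed.

Lemma pi_tilde_sum f : ell1 A f -> op_has_sum (fun s => mono s (f s)) (pi_tilde alpha f).
Proof.
have -> : (fun s => mono s (f s)) = (fun s => bop_comp (pi_rep alpha (f s)) (lam H s)).
  by apply/funext => s; rewrite mono_comp.
move=> [Af fin]; apply: op_sumP; apply: le_lt_trans fin.
by apply: le_esum => s _; rewrite lee_fin -mono_comp opnorm_mono.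
Qed.

(** Only the monomial at t = r q^-1 has a nonzero (r, q) entry, so every finite partial sum
    containing t already has the right entry, and entries are norm continuous. *)
Lemma entry_pi_tilde f r q : ell1 A f ->
  entry r q (pi_tilde alpha f) = alpha r^-1%g (f (r * q^-1)%g).
Proof.
move=> lf; have [Af _] := lf; have fs := pi_tilde_sum lf.
apply/eqP; rewrite -subr_eq0; apply/eqP; apply: (@opnorm_small_eq0 _ _ _ 1) => // e e0.
rewrite mul1r; have [J0 hJ] := fs _ e0; pose t := (r * q^-1)%g.
have {}hJ := hJ _ (fsubsetUr [fset t]%fset J0); set J := (_ `|` _)%fset in hJ.
have tJ : t \in J by rewrite !inE eqxx.
have -> : alpha r^-1%g (f t) = entry r q (\sum_(s <- J) mono s (f s)).
  rewrite entry_sum (bigD1_seq t) ?fset_uniq//= entry_mono// /t invgM invgK mulgVK eqxx.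
  rewrite big1 ?addr0// => s st; rewrite entry_mono//; case: ifP => // /eqP qE.
  by case/eqP: st; rewrite /t qE invgM invgK mulgA mulgV mul1g.
by rewrite -entryB; apply: (le_trans (opnorm_entry _ _ _)); exact: ltW.
Qed.

Lemma ell1_le f (g : G -> bop H) (M : R) : 0 <= M -> (forall s, A (g s)) ->
  (forall s, opnorm (g s) <= M * opnorm (f s)) -> ell1 A f -> ell1 A g.
Proof.
move=> M0 Ag gf [Af fin]; split => //.
apply/(ge0_usummable (fun s => opnorm_ge0 (g s))).
apply: (@usummable_le _ _ _ (fun s => M * opnorm (f s))).
  by move=> s; rewrite ger0_norm ?opnorm_ge0.
by apply: usummableZ; apply/(ge0_usummable (fun s => opnorm_ge0 (f s))).
Qed.

Lemma ell1_lsubspace : lsubspace (ell1 A : set (G -> bop H)).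
Proof.
have [A0 AD] := sA; split.
  split=> // ; rewrite esum1// => s _; by rewrite opnorm0.
move=> a f g [Af ff] [Ag fg]; split=> [s|]; first exact: (AD).
apply/(ge0_usummable (fun s => opnorm_ge0 ((a *: f + g) s))).
apply: (@usummable_le _ _ _ (fun s => normc a * opnorm (f s) + opnorm (g s))).
  move=> s; rewrite ger0_norm ?opnorm_ge0//.
  by apply: (le_trans (ler_opnormD _ _)); rewrite lerD2r opnormZ_le.
apply: usummableD.
  by apply: usummableZ; apply/(ge0_usummable (fun s => opnorm_ge0 (f s))).
by apply/(ge0_usummable (fun s => opnorm_ge0 (g s))).
Qed.

Lemma pi_tilde_lin : linear_on (ell1 A) (pi_tilde alpha).
Proof.
move=> a f g lf lg; have [[Af _] [Ag _]] := (lf, lg).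
have [_ lD] := ell1_lsubspace; apply: bop_entry_ext => r q.
apply: etrans (entry_pi_tilde r q (lD a f g lf lg)) _.
apply: etrans (alpha_lin _ a (Af _) (Ag _)) _.
apply/esym; apply: etrans (entryP _ _ _ _ _) _.
by congr (_ *: _ + _); exact: entry_pi_tilde.
Qed.

Lemma pi_tilde_ell1_lsubspace : lsubspace (pi_tilde_ell1 A alpha).
Proof.
have sl := ell1_lsubspace; have [l0 lD] := sl; split.
  by exists 0 => //; exact: linear_on0 sl pi_tilde_lin.
by move=> a _ _ [f lf <-] [g lg <-]; exists (a *: f + g); [exact: (lD)|exact: pi_tilde_lin].
Qed.

Lemma crossed_lsubspace : lsubspace (reduced_crossed_product A alpha).
Proof. exact: op_closure_lsubspace pi_tilde_ell1_lsubspace. Qed.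

Lemma fin_ell1 f (E : seq G) : (forall s, A (f s)) -> (forall s, s \notin E -> f s = 0) ->
  ell1 A f.
Proof.
move=> Af fE; split=> //.
apply: (@le_lt_trans _ _ (\sum_(s <- undup E) opnorm (f s))%:E); last exact: ltry.
apply: esum_le_uniq => s us; rewrite (bigID (mem E))/= [X in _ + X]big1 ?addr0; last first.
  by move=> i /fE ->; rewrite opnorm0.
rewrite -big_filter; apply: sum_uniq_sub_le => [i||i|]; rewrite ?undup_uniq//.
- exact: opnorm_ge0.
- exact: filter_uniq.
- by rewrite mem_filter mem_undup => /andP[].
Qed.

Lemma pi_tilde_fin f (E : seq G) : uniq E -> (forall s, A (f s)) ->
  (forall s, s \notin E -> f s = 0) ->
  pi_tilde alpha f = \sum_(s <- E) mono s (f s).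
Proof.
move=> uE Af fE; apply: bop_entry_ext => r q; rewrite entry_pi_tilde; last exact: fin_ell1 fE.
rewrite entry_sum; set t := (r * q^-1)%g.
have mE s : entry r q (mono s (f s)) = if s == t then alpha r^-1%g (f s) else 0.
  rewrite entry_mono//; congr (if _ then _ else _); apply/eqP/eqP => [qE|sE].
    by rewrite /t qE invgM invgK mulgA mulgV mul1g.
  by rewrite sE /t invgM invgK mulgVK.
under eq_bigr do rewrite mE.
have [tE|tE] := boolP (t \in E).
  by rewrite (bigD1_seq t)//= eqxx big1 ?addr0// => s /negbTE->.
rewrite fE// alpha0 big_seq big1// => s sE; case: eqP => // st.
by rewrite st (negbTE tE) in sE.
Qed.

Lemma mono_pi_tilde t a : A a ->
  mono t a = pi_tilde alpha (fun s => if s == t then a else 0).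
Proof.
move=> Aa; rewrite (@pi_tilde_fin _ [:: t])//.
- by rewrite big_seq1 eqxx.
- by move=> s; case: ifP => // _; case: sA.
- by move=> s; rewrite inE => /negbTE->.
Qed.

Lemma mono_ell1 t a : A a -> ell1 A (fun s => if s == t then a else 0).
Proof.
move=> Aa; apply: (@fin_ell1 _ [:: t]).
- by move=> s; case: ifP => // _; case: sA.
- by move=> s; rewrite inE => /negbTE->.
Qed.

Lemma mono_pi_tilde_ell1 t a : A a -> pi_tilde_ell1 A alpha (mono t a).
Proof.
by move=> Aa; rewrite mono_pi_tilde//; eexists; first exact: mono_ell1 Aa.
Qed.

Lemma mono_crossed t a : A a -> reduced_crossed_product A alpha (mono t a).
Proof. by move=> Aa; apply: op_closureS; exact: mono_pi_tilde_ell1. Qed.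

Lemma entry_crossedA x t : reduced_crossed_product A alpha x -> A (entry 1%g t x).
Proof.
move=> Xx; have [_ _ _ _ Acl] := cA; apply: Acl => e e0.
have [_ [f lf <-] xf] := Xx _ e0; exists (entry 1%g t (pi_tilde alpha f)).
  by have [Af _] := lf; rewrite entry_pi_tilde// invg1 alpha1.
by rewrite -entryB; apply: le_lt_trans (opnorm_entry _ _ _) xf.
Qed.

(** On pi_tilde(f) both sides are alpha_(r^-1)(f(t)); the difference [d] is bounded and linear, so
    it vanishes on the closure. Row 1 therefore carries all Fourier coefficients and determines the
    whole matrix. *)
Lemma entry_crossed x t r : reduced_crossed_product A alpha x ->
  entry r (t^-1 * r)%g x = alpha r^-1%g (entry 1%g t^-1%g x).
Proof.
have sX0 := pi_tilde_ell1_lsubspace; have sX := crossed_lsubspace.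
pose d y := entry r (t^-1 * r)%g y - alpha r^-1%g (entry 1%g t^-1%g y).
move=> Xx; apply/eqP; rewrite -subr_eq0; apply/eqP; rewrite -/(d x).
apply: (@bop_closed_eq _ _ _ d (pi_tilde_ell1 A alpha) 2) => //.
- move=> a y z Xy Xz; rewrite /d !entryP.
  rewrite (alpha_lin _ a (entry_crossedA _ Xy) (entry_crossedA _ Xz)).
  by rewrite scalerBr opprD addrACA.
- move=> y Xy; apply: (le_trans (ler_opnormD _ _)); rewrite opnormN.
  have := opnorm_alpha r^-1%g (entry_crossedA t^-1%g Xy).
  have := opnorm_entry 1%g t^-1%g y; have := opnorm_entry r (t^-1 * r)%g y; lra.
- move=> _ [f lf <-]; have [Af _] := lf; rewrite /d !entry_pi_tilde//.
  by rewrite invg1 alpha1// mul1g invgM !invgK mulgA mulgV mul1g subrr.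
Qed.

Lemma crossed_fin_approx x (e : R) : reduced_crossed_product A alpha x -> 0 < e ->
  exists f (E : seq G), [/\ forall s, A (f s), forall s, s \notin E -> f s = 0 &
    opnorm (x - pi_tilde alpha f) < e].
Proof.
move=> Xx e0; have e20 := divr_gt0 e0 (ltr0n R 2).
have [_ [f lf <-] xf] := Xx _ e20; have [Af _] := lf; have [A0 _] := sA.
have [J /(_ J (fsubset_refl J)) fJ] := pi_tilde_sum lf e20.
pose g s := if s \in J then f s else 0.
have Ag s : A (g s) by rewrite /g; case: ifP.
have gJ s : s \notin (J : seq G) -> g s = 0 by rewrite /g => /negbTE->.
exists g, J; split=> //.
rewrite (pi_tilde_fin _ Ag gJ) ?fset_uniq//.
have -> : \sum_(s <- J) mono s (g s) = \sum_(s <- J) mono s (f s).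
  by apply: eq_big_seq => s sJ; rewrite /g sJ.
apply: le_lt_trans (ler_opnormB _ (pi_tilde alpha f) _) _; lra.
Qed.

End crossed_calculus.

(** * Extension of completely bounded maps by continuity *)

Section cb_extension.
Variables (R : realType) (V W : hilbertType R) (X0 : set (bop V)).
Hypothesis sX0 : lsubspace X0.
Let X := op_closure X0.
Let sX : lsubspace X := op_closure_lsubspace sX0.

(** Each entry is moved into [X0] by less than [e]; with [N] the number of entries, this costs a
    fixed multiple of [e]. The a priori bound [M] controls [Phi] on the differences. *)
Lemma cb_le_closure (Phi : bop V -> bop W) (M c : R) : 0 <= M -> 0 <= c ->
  linear_on X Phi -> (forall x, X x -> opnorm (Phi x) <= M * opnorm x) ->
  cb_le X0 Phi c -> cb_le X Phi c.
Proof.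
move=> M0 c0 lPhi PhiM h P x B B0 Xx xB.
pose N : R := \sum_(p : P) \sum_(q : P) 1.
have N0 : 0 <= N by apply: sumr_ge0 => p _; apply: sumr_ge0.
have sumN (f : P -> P -> R) (e : R) : (forall p q, f p q <= e) ->
    \sum_p \sum_q f p q <= N * e.
  move=> fe; rewrite /N mulr_suml; apply: ler_sum => p _.
  by rewrite mulr_suml; apply: ler_sum => q _; rewrite mul1r.
have sum0 (f : P -> P -> bop W) : 0 <= \sum_p \sum_q opnorm (f p q).
  by apply: sumr_ge0 => p _; apply: sumr_ge0 => q _; exact: opnorm_ge0.
have sum0' (f : P -> P -> bop V) : 0 <= \sum_p \sum_q opnorm (f p q).
  by apply: sumr_ge0 => p _; apply: sumr_ge0 => q _; exact: opnorm_ge0.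
apply: (@mxbound_lim _ _ _ _ _ (c * N + N * M)).
- exact: mulr_ge0.
- by rewrite addr_ge0 ?mulr_ge0.
move=> e e0.
have ex (pq : P * P) : exists y, X0 y /\ opnorm (x pq.1 pq.2 - y) < e.
  by have [y Xy xy] := Xx pq.1 pq.2 e e0; exists y.
have {ex}[y hy] := choice ex.
pose y' p q := y (p, q).
have Xy p q : X0 (y' p q) by have [] := hy (p, q).
have xy p q : opnorm (x p q - y' p q) <= e by have [_ /ltW] := hy (p, q).
have yB : mxbound y' (B + N * e).
  have d := mxbound_opnorm_sum (fun p q => y' p q - x p q).
  have {}d : mxbound (fun p q => y' p q - x p q) (N * e).
    apply: mxbound_le d => //; apply: sumN => p q; rewrite opnormB; exact: xy.
  have := mxboundD B0 (mulr_ge0 N0 (ltW e0)) xB d.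
  by apply: eq_mxbound => p q; rewrite addrC subrK.
have BN : 0 <= B + N * e by rewrite addr_ge0 ?mulr_ge0 ?(ltW e0).
have h1 := h _ _ _ BN Xy yB.
have Xd p q : X (x p q - y' p q).
  by apply: lsubspaceB sX _ _ => //; exact: op_closureS.
have h2 : mxbound (fun p q => Phi (x p q - y' p q)) (N * (M * e)).
  apply: mxbound_le (mxbound_opnorm_sum _) => //; apply: sumN => p q.
  by apply: (le_trans (PhiM _ (Xd p q))); rewrite ler_wpM2l// xy.
have NM : 0 <= N * (M * e) by rewrite !mulr_ge0 ?(ltW e0).
have := mxboundD (mulr_ge0 c0 BN) NM h1 h2.
have -> : c * (B + N * e) + N * (M * e) = c * B + (c * N + N * M) * e by ring.
apply: eq_mxbound => p q.
rewrite -(linear_onD lPhi) ?[_ + (_ - _)]addrC ?subrK//.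
exact: op_closureS.
Qed.

Variables (S0 : bop V -> bop W) (c : R).
Hypotheses (c0 : 0 <= c) (lS0 : linear_on X0 S0) (cS0 : cb_le X0 S0 c).

(** Says that [y] is the value at [x] of the continuous extension of [S0]. Quantifying over all of
    [X0] instead of one approximating sequence gives uniqueness, linearity and the norm bound
    directly. *)
Let good x y := forall x0, X0 x0 -> opnorm (y - S0 x0) <= c * opnorm (x - x0).

Let S0B x y : X0 x -> X0 y -> opnorm (S0 x - S0 y) <= c * opnorm (x - y).
Proof.
move=> Xx Xy; rewrite -(linear_onB lS0)//; apply: cb_leP cS0 _ => //.
exact: lsubspaceB.
Qed.

Let good_ex x : X x -> exists y, good x y.
Proof.
move=> Xx; have inv0 (n : nat) : 0 < n.+1%:R^-1 :> R by rewrite invr_gt0.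
have ex n : exists y, X0 y /\ opnorm (x - y) < n.+1%:R^-1.
  by have [y Xy xy] := Xx _ (inv0 n); exists y.
have [u hu] := choice ex.
have c1 : 0 < c + 1 by rewrite ltr_wpDl.
have [|y uy] := @bop_complete _ _ (S0 \o u).
  move=> e e0; have d0 : 0 < e / (c + 1) / 2 by rewrite !divr_gt0.
  have [N hN] := invS_small d0; exists N => m n /hN Nm /hN Nn /=.
  have [Xm xm] := hu m; have [Xn xn] := hu n.
  apply: le_lt_trans (S0B Xm Xn) _.
  have hmn : opnorm (u m - u n) < e / (c + 1).
    apply: le_lt_trans (ler_opnormB _ x _) _; rewrite [ltRHS]splitr.
    rewrite opnormB; apply: ltrD; [exact: lt_trans xm Nm|exact: lt_trans xn Nn].
  have he : (c + 1) * (e / (c + 1)) = e by rewrite mulrC divfK// gt_eqF.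
  apply: (le_lt_trans (ler_wpM2l c0 (ltW hmn))).
  by rewrite -[ltRHS]he mulrDl mul1r ltrDl divr_gt0.
exists y => x0 Xx0; apply/ler_addgt0Pr => e e0.
have d0 : 0 < e / (c + 1) by rewrite divr_gt0.
have [N1 h1] := uy _ d0; have [N2 h2] := invS_small d0.
pose N := maxn N1 N2.
have /h1 {}h1 : (N1 <= N)%N by rewrite leq_max leqnn.
have /h2 {}h2 : (N2 <= N)%N by rewrite leq_max leqnn orbT.
have [XN xN] := hu N.
apply: (le_trans (ler_opnormB _ (S0 (u N)) _)).
have a1 : opnorm (y - S0 (u N)) <= e / (c + 1) by rewrite opnormB; exact: h1.
have a2 := S0B XN Xx0.
have a3 : opnorm (u N - x0) <= e / (c + 1) + opnorm (x - x0).
  apply: (le_trans (ler_opnormB _ x _)); rewrite lerD2r opnormB.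
  exact: ltW (lt_trans xN h2).
have a4 := le_trans a2 (ler_wpM2l c0 a3).
have he : (c + 1) * (e / (c + 1)) = e by rewrite mulrC divfK// gt_eqF.
have -> : c * opnorm (x - x0) + e =
    e / (c + 1) + c * (e / (c + 1) + opnorm (x - x0)) by rewrite -[in LHS]he; ring.
exact: lerD.
Qed.

Let S x : bop W := xget 0 [set y | good x y].

Let Sgood x : X x -> good x (S x).
Proof. by move=> /good_ex; exact: xgetPex. Qed.

Lemma cb_extension : exists S : bop V -> bop W,
  [/\ linear_on X S, forall x, X0 x -> S x = S0 x, cb_le X S c &
      forall x, X x -> op_closure (S0 @` X0) (S x)].
Proof.
have SE x : X0 x -> S x = S0 x.
  move=> Xx; apply/eqP; rewrite -subr_eq0; apply/eqP/opnorm_eq0/le_anti.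
  rewrite opnorm_ge0 andbT; apply: le_trans (Sgood (op_closureS Xx) Xx) _.
  by rewrite subrr opnorm0 mulr0.
have [X00 X0D] := sX0; have [_ XD] := sX.
have lS : linear_on X S.
  move=> a x y Xx Xy; apply/eqP; rewrite -subr_eq0; apply/eqP.
  have na := normc_ge0 a.
  apply: (@opnorm_small_eq0 _ _ _ (2 * (c * (normc a + 1)))).
    by rewrite !mulr_ge0// addr_ge0.
  move=> e e0; have [x' Xx' xx'] := Xx e e0; have [y' Xy' yy'] := Xy e e0.
  have h1 := Sgood (XD a x y Xx Xy) (X0D a x' y' Xx' Xy').
  have h2 := Sgood Xx Xx'; have h3 := Sgood Xy Xy'.
  have k1 : opnorm (a *: x + y - (a *: x' + y')) <= (normc a + 1) * e.
    rewrite opprD addrACA -scalerBr mulrDl mul1r.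
    apply: (le_trans (ler_opnormD _ _)); apply: lerD; last exact: ltW.
    by apply: (le_trans (opnormZ_le _ _)); rewrite ler_wpM2l// ltW.
  have k2 : opnorm (a *: S x + S y - S0 (a *: x' + y')) <= c * ((normc a + 1) * e).
    rewrite lS0// opprD addrACA -scalerBr.
    apply: (le_trans (ler_opnormD _ _)).
    rewrite [in leRHS]mulrDl mulrDr mul1r; apply: lerD.
      apply: (le_trans (opnormZ_le _ _)); rewrite mulrCA ler_wpM2l//.
      by apply: (le_trans h2); rewrite ler_wpM2l// ltW.
    by apply: (le_trans h3); rewrite ler_wpM2l// ltW.
  apply: (le_trans (ler_opnormB _ (S0 (a *: x' + y')) _)).
  rewrite -mulrA mulr_natl mulr2n -mulrA; apply: lerD.
    by apply: (le_trans h1); rewrite ler_wpM2l.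
  by rewrite opnormB.
exists S; split=> //.
- apply: (cb_le_closure c0 c0 lS) => [x Xx|].
    by have := Sgood Xx X00; rewrite (linear_on0 sX0 lS0) !subr0.
  move=> P x B B0 Xx xB; apply: (eq_mxbound _ (cS0 B0 Xx xB)) => p q.
  by rewrite SE.
- move=> x Xx e e0; have c1 : 0 < c + 1 by rewrite ltr_wpDl.
  have [x' Xx' xx'] := Xx _ (divr_gt0 e0 c1).
  exists (S0 x'); first by exists x'.
  apply: le_lt_trans (Sgood Xx Xx') _.
  rewrite ltr_pdivlMr// in xx'; apply: le_lt_trans xx'.
  by rewrite mulrC ler_wpM2l ?opnorm_ge0// lerDl.
Qed.

End cb_extension.

(** * Finite-dimensional operator spaces *)

Section linear_span.
Variables (R : realType) (U : lmodType R[i]).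
Implicit Types (X W : set U).

Lemma lspan_gen X : X `<=` lspan X.
Proof.
move=> x Xx; exists 1%N, (fun=> 1), (fun=> x); split=> //.
by rewrite big_ord1 scale1r.
Qed.

Lemma lspan_lsubspace X : lsubspace (lspan X).
Proof.
split; first by exists 0%N, (fun=> 0), (fun=> 0); split=> [[]//|]; rewrite big_ord0.
move=> a v w [n [c [x [Xx ->]]]] [m [d [y [Xy ->]]]].
exists (n + m)%N, (fun i => match fintype.split i with inl j => a * c j | inr j => d j end),
  (fun i => match fintype.split i with inl j => x j | inr j => y j end).
split=> [i|]; first by case: (fintype.split i).
rewrite big_split_ord/= scaler_sumr; congr (_ + _); apply: eq_bigr => i _.
  by rewrite (unsplitK (inl i : 'I_n + 'I_m)) scalerA.
by rewrite (unsplitK (inr i : 'I_n + 'I_m)).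
Qed.

Lemma lspan_min X W : lsubspace W -> X `<=` W -> lspan X `<=` W.
Proof.
move=> sW XW v [n [c [x [Xx ->]]]]; apply: lsubspace_sum => // i _.
by apply: lsubspaceZ => //; exact: (XW).
Qed.

(** Induction on the number of coordinates: the kernel of the last coordinate in [W] needs one
    fewer, and a vector with nonzero last coordinate completes a generating list. The vectors [e i]
    may lie outside [W]. *)
Lemma finite_dim_sub (g : nat -> U -> R[i]) (e : nat -> U) k W : lsubspace W ->
  (forall i a x y, g i (a *: x + y) = a * g i x + g i y) ->
  (forall w, W w -> w = \sum_(i < k) g i w *: e i) -> finite_dim W.
Proof.
move=> + lg; elim: k W => [|k IH] W sW WE.
  exists [::]; apply/seteqP; split=> [w /WE ->|].
    by rewrite big_ord0; have [] := lspan_lsubspace [set` [::]].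
  by apply: lspan_min => // w.
have [[w0 [Ww0 gw0]]|all0] := pselect (exists w, W w /\ g k w <> 0); last first.
  apply: IH => // w Ww; rewrite {1}(WE w Ww) big_ord_recr/=.
  have -> : g k w = 0 by apply: contrapT => gw; apply: all0; exists w.
  by rewrite scale0r addr0.
have gZ i a x : g i (a *: x) = a * g i x.
  have g0 : g i 0 = 0.
    have := lg i 1 0 0; rewrite scaler0 addr0 mul1r => /eqP.
    by rewrite -subr_eq0 opprD addrA subrr add0r oppr_eq0 => /eqP.
  by rewrite -[a *: x]addr0 lg g0 addr0.
pose W' := [set w | W w /\ g k w = 0].
have sW' : lsubspace W'.
  have [W0 WD] := sW; split; first by split=> //; rewrite -(scale0r w0) gZ mul0r.
  move=> a x y [Wx gx] [Wy gy]; split; first exact: (WD).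
  by rewrite lg gx gy mulr0 addr0.
have [|ys W'E] := IH W' sW'.
  by move=> w [Ww gw]; rewrite {1}(WE w Ww) big_ord_recr/= gw scale0r addr0.
exists (w0 :: ys); apply/seteqP; split=> [w Ww|]; last first.
  apply: lspan_min => // w; rewrite /= inE => /orP[/eqP->//|wys].
  have : W' w by rewrite W'E; exact: lspan_gen.
  by case.
pose w' := w - (g k w / g k w0) *: w0.
have : W' w'.
  split; first by apply: lsubspaceB => //; exact: lsubspaceZ.
  rewrite /w' addrC -scaleNr lg mulNr divfK; last exact/eqP.
  by rewrite addNr.
rewrite W'E => w'ys; have sl := lspan_lsubspace [set` w0 :: ys].
rewrite -[w](subrK ((g k w / g k w0) *: w0)) -/w'; apply: (lsubspaceD sl).
  move: w'ys; apply: lspan_min => // y /= yys; apply: lspan_gen.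
  by rewrite /= inE yys orbT.
by apply: (lsubspaceZ _ sl); apply: lspan_gen; rewrite /= inE eqxx.
Qed.

End linear_span.

(** * Bounded functionals and dual bases *)

Section functionals.
Variables (R : realType) (V : hilbertType R).

Definition bounded_functional (X : set (bop V)) (phi : bop V -> R[i]) (C : R) : Prop :=
  [/\ 0 <= C, forall a x y, X x -> X y -> phi (a *: x + y) = a * phi x + phi y &
      forall x, X x -> normc (phi x) <= C * opnorm x].

Lemma functional0 X phi C : lsubspace X -> bounded_functional X phi C -> phi 0 = 0.
Proof.
move=> [X0 _] [_ lphi _]; have := lphi 1 0 0 X0 X0; rewrite scaler0 addr0 mul1r => /eqP.
by rewrite -subr_eq0 opprD addrA subrr add0r oppr_eq0 => /eqP.
Qed.

Lemma functionalZ X phi C a x : lsubspace X -> bounded_functional X phi C ->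
  X x -> phi (a *: x) = a * phi x.
Proof.
move=> sX bphi Xx; have [_ lphi _] := bphi; have [X0 _] := sX.
by rewrite -[a *: x]addr0 lphi// (functional0 sX bphi) addr0.
Qed.

Lemma functional_sum X phi C (I : Type) (r : seq I) (f : I -> bop V) :
  lsubspace X -> bounded_functional X phi C ->
  (forall i, X (f i)) -> phi (\sum_(i <- r) f i) = \sum_(i <- r) phi (f i).
Proof.
move=> sX bphi Xf; have [_ lphi _] := bphi.
elim: r => [|i r IH]; first by rewrite !big_nil (functional0 sX bphi).
rewrite !big_cons -IH -{1}[f i]scale1r lphi ?mul1r//.
exact: lsubspace_sum.
Qed.

Lemma bounded_functional_lin phi psi C D a :
  bounded_functional setT phi C -> bounded_functional setT psi D ->
  bounded_functional setT (fun x => a * phi x + psi x) (normc a * C + D).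
Proof.
move=> [C0 lphi bphi] [D0 lpsi bpsi]; have na := normc_ge0 a; split.
- by rewrite addr_ge0// mulr_ge0.
- by move=> b x y _ _; rewrite lphi// lpsi//; ring.
- move=> x _; apply: (le_trans (le_normcD _ _)); rewrite normcM mulrDl -mulrA.
  by apply: lerD; [rewrite ler_wpM2l// bphi|exact: bpsi].
Qed.

Lemma bounded_functional_dotp (v w : V) :
  bounded_functional setT (fun x => dotp (x v) w) (hilnorm v * hilnorm w).
Proof.
split=> [|a x y _ _|x _]; first by rewrite mulr_ge0 ?hilnorm_ge0.
  by rewrite bopDE bopZE linearPl.
apply: (le_trans (normc_dotp_le _ _)); rewrite mulrAC [_ * opnorm x]mulrC.
by rewrite ler_wpM2r ?hilnorm_ge0 ?opnormP.
Qed.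

Lemma bounded_functional_sum k (a : nat -> R[i]) (phi : nat -> bop V -> R[i]) :
  (forall i, (i < k)%N -> exists C, bounded_functional setT (phi i) C) ->
  exists C, bounded_functional setT (fun x => \sum_(i < k) a i * phi i x) C.
Proof.
elim: k => [_|k IH bphi].
  exists 0; split=> // [b x y _ _|x _]; first by rewrite !big_ord0 mulr0 addr0.
  by rewrite big_ord0 normc0 mul0r.
have [C bC] := IH (fun i ik => bphi i (ltnW ik)); have [D bD] := bphi k (ltnSn k).
have h := bounded_functional_lin (a k) bD bC; exists (normc (a k) * D + C).
move: h; congr bounded_functional; apply/funext => x.
by rewrite big_ord_recr addrC.
Qed.

(* Functionals [x |-> <x v, w>] separate points, so a biorthogonal system of *)
(* bounded functionals is obtained by Gaussian elimination.                  *)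
Lemma biorthogonal (ys : seq (bop V)) :
  exists k (g : nat -> bop V -> R[i]) (e : nat -> bop V),
    [/\ forall i, (i < k)%N -> lspan [set` ys] (e i),
        forall i, (i < k)%N -> exists C, bounded_functional setT (g i) C,
        forall i j, (i < k)%N -> (j < k)%N -> g i (e j) = (i == j)%:R &
        forall y, y \in ys -> y = \sum_(i < k) g i y *: e i].
Proof.
have sT : lsubspace [set: bop V] by [].
elim: ys => [|y0 ys [k [g [e [Ye bg ge ysE]]]]].
  by exists 0%N, (fun _ _ => 0), (fun=> 0); split.
have sY := lspan_lsubspace [set` y0 :: ys].
have Y' : lspan [set` ys] `<=` lspan [set` y0 :: ys].
  apply: lspan_min => // y /= yys; apply: lspan_gen.
  by rewrite /= inE yys orbT.
have Yy0 : lspan [set` y0 :: ys] y0 by apply: lspan_gen; rewrite /= inE eqxx.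
pose r : bop V := y0 - \sum_(i < k) g i y0 *: e i.
have [r0|rn0] := eqVneq r 0.
  exists k, g, e; split=> // [i ik|y].
    by apply: (Y'); exact: (Ye).
  by rewrite inE => /orP[/eqP->|]; [apply/eqP; rewrite -subr_eq0 -/r r0|exact: ysE].
have gsum i y : (i < k)%N -> g i (\sum_(j < k) g j y *: e j) = g i y.
  move=> ik; have [C bC] := bg i ik.
  rewrite (functional_sum _ sT bC)// (bigD1 (Ordinal ik))//= (functionalZ _ sT bC)//.
  rewrite ge// eqxx mulr1 big1 ?addr0// => j; rewrite -val_eqE/= eq_sym => ij.
  by rewrite (functionalZ _ sT bC)// ge// (negbTE ij) mulr0.
have gB i x y : (i < k)%N -> g i (x - y) = g i x - g i y.
  move=> ik; have [C [_ lC _]] := bg i ik.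
  by rewrite addrC -scaleN1r lC// mulN1r addrC.
have gr i : (i < k)%N -> g i r = 0 by move=> ik; rewrite gB// gsum// subrr.
have [v rv] : exists v, bop_fun r v != 0.
  apply: contrapT => h; case/eqP: rn0; apply: bop_ext => v.
  by apply/eqP/negPn/negP => rv; apply: h; exists v.
pose f (x : bop V) : R[i] := dotp (x v) (r v).
have fr : f r != 0 by apply: lt0r_neq0; exact: neq0_dnorm_gt0.
(* Each [g i] kills [r], so dividing by [f r] gives [h r = 1]; the correction terms make [h] vanish
   at every [e j]. *)
pose h (x : bop V) := (f r)^-1 * f x + \sum_(i < k) (- ((f r)^-1 * f (e i))) * g i x.
have [C bC] := bounded_functional_sum (fun i => - ((f r)^-1 * f (e i))) bg.
have [D bh] : exists D, bounded_functional setT h D.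
  by eexists; exact: bounded_functional_lin (f r)^-1 (bounded_functional_dotp v (r v)) bC.
have hr : h r = 1.
  rewrite /h mulVf// big1 ?addr0// => i _; by rewrite gr ?mulr0.
have he j : (j < k)%N -> h (e j) = 0.
  move=> jk; rewrite /h (bigD1 (Ordinal jk))//= ge// eqxx mulr1 big1 ?addr0 ?subrr//.
  by move=> i; rewrite -val_eqE/= => ij; rewrite ge// (negbTE ij) mulr0.
have hsum y : h (\sum_(j < k) g j y *: e j) = 0.
  rewrite (functional_sum _ sT bh)// big1// => j _.
  by rewrite (functionalZ _ sT bh)// he// mulr0.
pose g' i := if (i == k)%N then h else g i.
pose e' i := if (i == k)%N then r else e i.
have g'k : g' k = h by rewrite /g' eqxx.
have e'k : e' k = r by rewrite /e' eqxx.
have g'i i : (i < k)%N -> g' i = g i by move=> ik; rewrite /g' ltn_eqF.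
have e'i i : (i < k)%N -> e' i = e i by move=> ik; rewrite /e' ltn_eqF.
have sumE y : \sum_(i < k.+1) g' i y *: e' i = \sum_(i < k) g i y *: e i + h y *: r.
  rewrite big_ord_recr/= g'k e'k; congr (_ + _).
  by apply: eq_bigr => i _; rewrite g'i// e'i.
exists k.+1, g', e'; split.
- move=> i; rewrite ltnS leq_eqVlt => /orP[/eqP->|ik].
    rewrite e'k; apply: lsubspaceB => //; apply: lsubspace_sum => // j _.
    by apply: lsubspaceZ => //; apply: (Y'); exact: (Ye).
  by rewrite e'i//; apply: (Y'); exact: (Ye).
- move=> i; rewrite ltnS leq_eqVlt => /orP[/eqP->|ik]; last by rewrite g'i//; exact: bg.
  by rewrite g'k; exists D.
- move=> i j; rewrite !ltnS leq_eqVlt [(j <= k)%N]leq_eqVlt.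
  move=> /orP[/eqP->|ik] /orP[/eqP->|jk].
  + by rewrite g'k e'k hr eqxx.
  + by rewrite g'k e'i// he// gtn_eqF.
  + by rewrite g'i// e'k gr// ltn_eqF.
  + by rewrite g'i// e'i// ge.
- move=> y; rewrite inE sumE => /orP[/eqP->|yys].
    have hy0 : h y0 = 1.
      have y0E : y0 = 1 *: r + \sum_(i < k) g i y0 *: e i by rewrite scale1r subrK.
      by have [_ lh _] := bh; rewrite {1}y0E lh// hr hsum mulr1 addr0.
    by rewrite hy0 scale1r /r addrC subrK.
  by rewrite {3}(ysE y yys) hsum scale0r addr0 -ysE.
Qed.

Lemma dual_basis (Y : set (bop V)) : finite_dim Y ->
  exists k (g : nat -> bop V -> R[i]) (e : nat -> bop V),
    [/\ forall i, (i < k)%N -> Y (e i),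
        forall i, (i < k)%N -> exists C, bounded_functional setT (g i) C &
        forall y, Y y -> y = \sum_(i < k) g i y *: e i].
Proof.
move=> [ys ->]; have [k [g [e [Ye bg _ ysE]]]] := biorthogonal ys.
exists k, g, e; split=> // y [n [c [x [xys ->]]]].
have gsum i : (i < k)%N -> g i (\sum_j c j *: x j) = \sum_j c j * g i (x j).
  move=> /bg[C bC]; have sT : lsubspace [set: bop V] by [].
  rewrite (functional_sum _ sT bC)//; apply: eq_bigr => j _.
  exact: functionalZ sT bC _.
under [RHS]eq_bigr => i _ do rewrite gsum// scaler_suml.
rewrite exchange_big/=; apply: eq_bigr => j _.
by under eq_bigr do rewrite -scalerA; rewrite -scaler_sumr -ysE//; exact: xys.
Qed.

(** Subtracting from [y] its coordinate expansion is a bounded linear operation that vanishes on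
    [Y], hence on its closure. *)
Lemma finite_dim_closed (Y : set (bop V)) : finite_dim Y -> op_closure Y `<=` Y.
Proof.
move=> fY y cy; have [k [g [e [Ye bg YE]]]] := dual_basis fY.
have sY : lsubspace Y by case: fY => ys ->; exact: lspan_lsubspace.
have [C hC] := choice (fun i : 'I_k => bg i (ltn_ord i)).
pose f x : bop V := x - \sum_(i < k) g i x *: e i.
have f0 : f y = 0.
  apply: (@bop_closed_eq _ _ _ f Y (1 + \sum_i C i * opnorm (e i))) => //.
  - rewrite addr_ge0// sumr_ge0// => i _; have [C0 _ _] := hC i.
    by rewrite mulr_ge0 ?opnorm_ge0.
  - move=> a x z _ _; rewrite /f scalerBr addrACA -opprD; congr (_ - _).
    rewrite scaler_sumr -big_split/=; apply: eq_bigr => i _.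
    by have [_ -> //_] := hC i; rewrite scalerDl scalerA.
  - move=> x _; rewrite mulrDl mul1r; apply: (le_trans (ler_opnormD _ _)).
    rewrite opnormN; apply: lerD => //; apply: (le_trans (opnorm_sum _ _ _)).
    rewrite mulr_suml; apply: ler_sum => i _; have [_ _ gC] := hC i.
    apply: (le_trans (opnormZ_le _ _)); rewrite mulrAC.
    by rewrite ler_wpM2r ?opnorm_ge0 ?gC.
  - by move=> x Yx; rewrite /f -YE// subrr.
have -> : y = \sum_(i < k) g i y *: e i by apply/eqP; rewrite -subr_eq0 -/(f y) f0.
apply: lsubspace_sum => // i _; apply: lsubspaceZ => //; exact: (Ye).
Qed.

End functionals.

(** * Orthonormal expansions *)

Section gram_schmidt.
Variables (R : realType) (W : preHilbertType R).

Lemma gram_schmidt (s : seq W) : exists k (f : nat -> W),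
  (forall i j, (i < k)%N -> (j < k)%N -> dotp (f i) (f j) = (i == j)%:R) /\
  forall w, w \in s -> exists c : nat -> R[i], w = \sum_(i < k) c i *: f i.
Proof.
elim: s => [|w0 s [k [f [orthf fs]]]]; first by exists 0%N, (fun=> 0).
pose r := w0 - \sum_(i < k) dotp w0 (f i) *: f i.
have dr j : (j < k)%N -> dotp r (f j) = 0.
  move=> jk; rewrite /r linearBl/= linear_sumlz (bigD1 (Ordinal jk))//= linearZl_LR/=.
  rewrite orthf// eqxx mulr1 big1 ?addr0 ?subrr// => i.
  by rewrite -val_eqE/= => ij; rewrite linearZl_LR/= orthf// (negbTE ij) mulr0.
have [r0|rn0] := eqVneq r 0.
  exists k, f; split=> // w; rewrite inE => /orP[/eqP->|/fs//].
  by exists (fun i => dotp w0 (f i)); apply/eqP; rewrite -subr_eq0 -/r r0.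
have n0 : 0 < hilnorm r.
  by rewrite lt_def hilnorm_ge0 andbT; apply: contra rn0 => /eqP/hilnorm_eq0 ->.
pose u := (hilnorm r)^-1%:C%C *: r.
have uu : dotp u u = 1.
  rewrite dotpE hilnormZ normcR ger0_norm ?invr_ge0 ?hilnorm_ge0//.
  by rewrite mulVf ?gt_eqF// expr1n.
have du j : (j < k)%N -> dotp u (f j) = 0.
  by move=> jk; rewrite linearZl_LR/= dr// mulr0.
pose f' i := if (i == k)%N then u else f i.
have f'k : f' k = u by rewrite /f' eqxx.
have f'i i : (i < k)%N -> f' i = f i by move=> ik; rewrite /f' ltn_eqF.
exists k.+1, f'; split=> [i j|w].
  rewrite !ltnS leq_eqVlt [(j <= k)%N]leq_eqVlt.
  move=> /orP[/eqP->|ik] /orP[/eqP->|jk].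
  + by rewrite f'k uu eqxx.
  + by rewrite f'k f'i// du// gtn_eqF.
  + by rewrite f'i// f'k dotpC du// rmorph0 ltn_eqF.
  + by rewrite !f'i// orthf.
rewrite inE => /orP[/eqP->|/fs[c ->]].
  exists (fun i => if (i == k)%N then (hilnorm r)%:C%C else dotp w0 (f i)).
  rewrite big_ord_recr/= eqxx f'k scalerA -rmorphM mulfV ?gt_eqF// scale1r.
  rewrite {1}(_ : w0 = \sum_(i < k) dotp w0 (f i) *: f i + r); last first.
    by rewrite /r addrC subrK.
  by congr (_ + _); apply: eq_bigr => i _; rewrite f'i// ltn_eqF.
exists (fun i => if (i == k)%N then 0 else c i).
rewrite big_ord_recr/= eqxx scale0r addr0.
by apply: eq_bigr => i _; rewrite f'i// ltn_eqF.
Qed.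

Lemma hilnorm_orthonormal k (f : nat -> W) (c : nat -> R[i]) :
  (forall i j, (i < k)%N -> (j < k)%N -> dotp (f i) (f j) = (i == j)%:R) ->
  hilnorm (\sum_(i < k) c i *: f i) ^+ 2 = \sum_(i < k) normc (c i) ^+ 2.
Proof.
move=> orthf; rewrite hilnorm_sqr linear_sumlz/= raddf_sum; apply: eq_bigr => i _.
rewrite linear_sumr/= (bigD1 i)//= linearZl_LR linearZr_LR/= orthf// eqxx mulr1.
rewrite big1 ?addr0 => [|j]; last first.
  rewrite -val_eqE/= eq_sym => ij; rewrite linearZl_LR linearZr_LR/= orthf//.
  by rewrite (negbTE ij) !mulr0.
by case: (c i) => a b /=; rewrite sqr_sqrtr ?addr_ge0 ?sqr_ge0//; ring.
Qed.

End gram_schmidt.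

(** * Bounded functionals are completely bounded *)

Section functional_bounds.
Variables (R : realType) (V : hilbertType R) (X : set (bop V)).
Variables (phi : bop V -> R[i]) (C : R).
Hypotheses (sX : lsubspace X) (bphi : bounded_functional X phi C).
Variables (P : finType) (x : P -> P -> bop V) (B : R).
Hypotheses (B0 : 0 <= B) (Xx : forall p q, X (x p q)) (xB : mxbound x B).

(* Pairing [y_p = sum_q phi(x_pq) z_q] with itself exhibits [sum_p |y_p|^2] as *)
(* the value of [phi] at [sum_pq conj(y_p) z_q x_pq].                          *)
Lemma functional_scalar_bound (z : P -> R[i]) :
  \sum_p normc (\sum_q phi (x p q) * z q) ^+ 2 <=
  (C * B) ^+ 2 * \sum_q normc (z q) ^+ 2.
Proof.
have [C0 _ phiC] := bphi.
pose y p := \sum_q phi (x p q) * z q.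
set S := \sum_p _; pose N := \sum_q normc (z q) ^+ 2.
have S0 : 0 <= S by apply: sumr_ge0 => p _; exact: sqr_ge0.
have N0 : 0 <= N by apply: sumr_ge0 => p _; exact: sqr_ge0.
have nconj (a : R[i]) : normc (Num.conj a) = normc a by case: a => a b /=; rewrite sqrrN.
have conjM (a : R[i]) : Num.conj a * a = (normc a ^+ 2)%:C%C.
  case: a => a b; rewrite /= sqr_sqrtr ?addr_ge0 ?sqr_ge0//.
  by apply/eqP; rewrite eq_complex/=; apply/andP; split; apply/eqP; ring.
pose T : bop V := \sum_p \sum_q (Num.conj (y p) * z q) *: x p q.
have phiT : phi T = S%:C%C.
  rewrite (functional_sum _ sX bphi); last first.
    by move=> p; apply: lsubspace_sum => // q _; exact: lsubspaceZ.
  rewrite /S rmorph_sum/=; apply: eq_bigr => p _.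
  rewrite (functional_sum _ sX bphi); last by move=> q; exact: lsubspaceZ.
  rewrite -/(y p) -conjM {2}/y mulr_sumr; apply: eq_bigr => q _.
  by rewrite (functionalZ _ sX bphi)// -mulrA [z q * _]mulrC.
have XT : X T by apply: lsubspace_sum => // p _; apply: lsubspace_sum => // q _; exact: lsubspaceZ.
have Y0 := sqrtr_ge0 S; have Z0 := sqrtr_ge0 N.
have YS := sqr_sqrtr S0; have ZN := sqr_sqrtr N0.
set Y := Num.sqrt S in Y0 YS; set Z := Num.sqrt N in Z0 ZN.
have TB : opnorm T <= Y * (B * Z).
  apply: opnorm_le => [|v]; first by rewrite !mulr_ge0.
  pose w p := \sum_q x p q (z q *: v).
  have -> : T v = \sum_p Num.conj (y p) *: w p.
    rewrite bop_sumE; apply: eq_bigr => p _; rewrite bop_sumE scaler_sumr.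
    by apply: eq_bigr => q _; rewrite bopZE bopZ scalerA.
  apply: (le_trans (hilnorm_sum _ _ _)).
  under eq_bigr do rewrite hilnormZ nconj.
  rewrite -mulrA; apply: sum_mul_le => //.
  - by rewrite !mulr_ge0 ?hilnorm_ge0.
  - by rewrite YS.
  - apply: (le_trans (xB (fun q => z q *: v))).
    rewrite !exprMn ZN -mulrA ler_wpM2l ?sqr_ge0// mulr_suml.
    by apply: ler_sum => q _; rewrite hilnormZ exprMn.
have h : Y ^+ 2 <= C * (Y * (B * Z)).
  have := phiC T XT; rewrite phiT normcR ger0_norm// YS => /le_trans; apply.
  by rewrite ler_wpM2l.
rewrite -/N -ZN -exprMn -[leLHS]YS ler_pXn2r// ?nnegrE ?mulr_ge0//.
have [->|Yn0] := eqVneq Y 0; first by rewrite !mulr_ge0.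
have Yp : 0 < Y by rewrite lt_def Yn0.
by rewrite -(ler_pM2l Yp) -expr2 (le_trans h)// mulrCA !mulrA.
Qed.

(** Expanding all [z q] in one orthonormal system splits the inequality into a scalar instance for
    each coordinate. *)
Lemma functional_bound (W : preHilbertType R) (z : P -> W) :
  \sum_p hilnorm (\sum_q phi (x p q) *: z q) ^+ 2 <=
  (C * B) ^+ 2 * \sum_q hilnorm (z q) ^+ 2.
Proof.
have [k [f [of1 fs]]] := gram_schmidt (map z (enum P)).
have ex q : exists c : nat -> R[i], z q = \sum_(i < k) c i *: f i.
  by apply: fs; exact/map_f/mem_enum.
have [c zc] := choice ex.
have zE q : hilnorm (z q) ^+ 2 = \sum_(i < k) normc (c q i) ^+ 2.
  by rewrite zc hilnorm_orthonormal.
have yE p : hilnorm (\sum_q phi (x p q) *: z q) ^+ 2 =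
    \sum_(i < k) normc (\sum_q phi (x p q) * c q i) ^+ 2.
  rewrite -(@hilnorm_orthonormal _ _ k f (fun i => \sum_q phi (x p q) * c q i))//.
  congr (hilnorm _ ^+ 2); under eq_bigr do rewrite zc scaler_sumr.
  rewrite exchange_big/=; apply: eq_bigr => i _; rewrite scaler_suml.
  by apply: eq_bigr => q _; rewrite scalerA.
under eq_bigr do rewrite yE; under [X in _ <= _ * X]eq_bigr do rewrite zE.
rewrite exchange_big [X in _ <= _ * X]exchange_big/= mulr_sumr.
by apply: ler_sum => i _; exact: functional_scalar_bound.
Qed.

Lemma functional_mxbound (W : hilbertType R) (e : bop W) :
  mxbound (fun p q => phi (x p q) *: e) (C * B * opnorm e).
Proof.
have [C0 _ _] := bphi; move=> z.
apply: le_trans (functional_bound (fun q => e (z q))) _.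
rewrite [(_ * opnorm e) ^+ 2]exprMn -[leRHS]mulrA ler_wpM2l ?sqr_ge0// mulr_sumr.
apply: ler_sum => q _.
by rewrite -exprMn -hilnorm_le_sqr ?opnormP// mulr_ge0 ?opnorm_ge0 ?hilnorm_ge0.
Qed.

End functional_bounds.

Section finite_rank_bounds.
Variables (R : realType) (V W : hilbertType R) (X : set (bop V)).
Hypothesis sX : lsubspace X.

Lemma cb_le_functional phi C (e : bop W) : bounded_functional X phi C ->
  cb_le X (fun x => phi x *: e) (C * opnorm e).
Proof.
move=> bphi P x B B0 Xx xB; rewrite mulrAC.
exact: (functional_mxbound sX bphi B0 Xx xB e).
Qed.

Lemma cb_le_sum_functional k (phi : 'I_k -> bop V -> R[i]) (C : 'I_k -> R)
    (e : 'I_k -> bop W) : (forall i, bounded_functional X (phi i) (C i)) ->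
  cb_le X (fun x => \sum_i phi i x *: e i) (\sum_i C i * opnorm (e i)).
Proof.
move=> bphi; have C0 i : 0 <= C i * opnorm (e i).
  by have [? _ _] := bphi i; rewrite mulr_ge0 ?opnorm_ge0.
suff h : forall r : seq 'I_k, cb_le X (fun x => \sum_(i <- r) phi i x *: e i)
    (\sum_(i <- r) C i * opnorm (e i)) by exact: h.
elim=> [|i r IH].
  move=> P x B B0 Xx xB z; rewrite big_nil mul0r expr0n mul0r big1// => p _.
  by rewrite big1 ?hilnorm0 ?expr0n// => q _; rewrite big_nil.
have S0 : 0 <= \sum_(j <- r) C j * opnorm (e j) by apply: sumr_ge0.
have := cb_leD (C0 i) S0 (cb_le_functional (e i) (bphi i)) IH.
rewrite big_cons; congr cb_le; apply/funext => x; by rewrite big_cons.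
Qed.

End finite_rank_bounds.

(** * Approximation from the SOAP *)

Section complex_hilbert.
Variable R : realType.

Definition cplx : Type := R[i]^o.

HB.instance Definition _ := GRing.Lmodule.copy cplx R[i]^o.

Definition cdot (x y : cplx) : R[i] := (x : R[i]) * Num.conj (y : R[i]).

Lemma cdotC x y : cdot x y = (-1) ^+ false * Num.conj (cdot y x).
Proof. by rewrite expr0 mul1r /cdot rmorphM/= conjCK mulrC. Qed.

Lemma cdot_bilinear : bilinear_for *%R (@Num.conj R[i] \; *%R) cdot.
Proof.
split=> [g a f h|f a g h]; rewrite /cdot; first by rewrite mulrDl -mulrA.
by rewrite rmorphD rmorphM/= mulrDr mulrCA.
Qed.

HB.instance Definition _ := @bilinear_isBilinear.Build R[i] cplx cplx R[i]
  *%R (@Num.conj R[i] \; *%R) cdot cdot_bilinear.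
HB.instance Definition _ := @isHermitianSesquilinear.Build R[i] cplx false
  (@Num.conj R[i]) cdot cdotC.

Lemma cdotE (x : cplx) : cdot x x = (normc x ^+ 2)%:C%C.
Proof.
rewrite /cdot; case: x => a b; rewrite /= sqr_sqrtr ?addr_ge0 ?sqr_ge0//.
by apply/eqP; rewrite eq_complex/=; apply/andP; split; apply/eqP; ring.
Qed.

Lemma cdot_gt0 (x : cplx) : x != 0 -> 0 < cdot x x.
Proof.
move=> x0; rewrite cdotE ltcE/= eqxx/= exprn_gt0// lt_def normc_ge0 andbT.
by apply: contra x0 => /eqP/eq0_normc ->.
Qed.

HB.instance Definition _ := @isDotProduct.Build R[i] cplx cdot cdot_gt0.
HB.instance Definition _ := Lmodule_hasDot.Build R cplx cdot.

Lemma hilnorm_cplx (x : cplx) : hilnorm x = normc x.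
Proof.
apply/eqP; rewrite -(eqrXn2 (n := 2)) ?hilnorm_ge0 ?normc_ge0//.
by rewrite hilnorm_sqr [dotp x x]cdotE.
Qed.

Lemma real_complete (u : nat -> R) :
  (forall e : R, 0 < e -> exists N, forall m n, (N <= m)%N -> (N <= n)%N ->
    `|u m - u n| < e) ->
  exists l, forall e : R, 0 < e -> exists N, forall n, (N <= n)%N -> `|u n - l| < e.
Proof.
move=> uC; have : cvg (u @ \oo).
  apply/cauchy_cvgP; apply: cauchy_exP => e e0; have [N uN] := uC e e0.
  by exists (u N); exists N => // n /= Nn; rewrite /ball/=; exact: uN.
move=> /cvgrPdist_lt ul; exists (lim (u @ \oo)) => e /ul [N _ hN].
by exists N => n /hN; rewrite distrC.
Qed.

Lemma cplx_complete (u : nat -> cplx) :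
  (forall e : R, 0 < e -> exists N, forall m n, (N <= m)%N -> (N <= n)%N ->
     hilnorm (u m - u n) < e) ->
  exists l : cplx, forall e : R, 0 < e -> exists N, forall n, (N <= n)%N ->
    hilnorm (u n - l) < e.
Proof.
move=> uC; have le_normc (z : R[i]) :
    [/\ `|complex.Re z| <= normc z, `|complex.Im z| <= normc z &
      normc z <= `|complex.Re z| + `|complex.Im z|].
  case: z => a b /=; have ab : 0 <= a ^+ 2 + b ^+ 2 by rewrite addr_ge0 ?sqr_ge0.
  split; rewrite -(ler_pXn2r (n := 2))// ?nnegrE ?sqrtr_ge0 ?addr_ge0// sqr_sqrtr//.
  - by rewrite real_normK ?num_real// lerDl sqr_ge0.
  - by rewrite real_normK ?num_real// lerDr sqr_ge0.
  - by rewrite sqrrD !real_normK ?num_real// -addrA lerD2l lerDr mulrn_wge0// mulr_ge0.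
have [|a ua] := @real_complete (fun n => complex.Re (u n)).
  move=> e /uC[N uN]; exists N => m n Nm Nn; have := uN m n Nm Nn.
  rewrite hilnorm_cplx; apply: le_lt_trans.
  by have [+ _ _] := le_normc (u m - u n); rewrite raddfB.
have [|b ub] := @real_complete (fun n => complex.Im (u n)).
  move=> e /uC[N uN]; exists N => m n Nm Nn; have := uN m n Nm Nn.
  rewrite hilnorm_cplx; apply: le_lt_trans.
  by have [_ + _] := le_normc (u m - u n); rewrite raddfB.
exists (a +i* b)%C => e e0; have e20 := divr_gt0 e0 (ltr0n R 2).
have [N1 h1] := ua _ e20; have [N2 h2] := ub _ e20.
exists (maxn N1 N2) => n; rewrite geq_max => /andP[/h1 {}h1 /h2 {}h2].
rewrite hilnorm_cplx; have [_ _ h] := le_normc (u n - (a +i* b)%C).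
apply: (le_lt_trans h); rewrite [ltRHS]splitr; apply: ltrD.
  by move: h1; rewrite raddfB.
by move: h2; rewrite raddfB.
Qed.

HB.instance Definition _ := PreHilbert_isComplete.Build R cplx cplx_complete.

End complex_hilbert.

(** * ell^2(J, V) as a Hilbert space tensor product *)

Section l2_tensor.
Variables (R : realType) (J : choiceType) (V : hilbertType R).

Lemma l2_tensor_subproof (k : l2 J (cplx R)) (v : V) :
  (fun j => (k j : R[i]) *: v) \in l2_pred (I := J) (V := V).
Proof.
apply: (@l2_predP _ _ _ _ (hilnorm k ^+ 2 * hilnorm v ^+ 2)) => s us.
under eq_bigr do rewrite hilnormZ exprMn -hilnorm_cplx.
by rewrite -mulr_suml ler_wpM2r ?sqr_ge0// l2_hilnorm_ge_sum.
Qed.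

Definition l2_tensor (k : l2 J (cplx R)) (v : V) : l2 J V :=
  L2 (l2_tensor_subproof k v).

Lemma l2_tensorE k v j : l2_tensor k v j = (k j : R[i]) *: v.
Proof. by []. Qed.

Lemma dlt_l2_tensor j v : dlt j v = l2_tensor (dlt j ((1 : R[i]) : cplx R)) v.
Proof.
apply: l2_ext => i; rewrite l2_tensorE !dltE.
by case: ifP => _; rewrite ?scale1r ?scale0r.
Qed.

Lemma l2_tensor_dotp k k' v v' :
  dotp (l2_tensor k v) (l2_tensor k' v') = dotp k k' * dotp v v'.
Proof.
rewrite [LHS]/(l2_dot _ _) [dotp k k']/(l2_dot _ _) /l2_dot.
have sr := l2_Re_summable k k'; have si := l2_Im_summable k k'.
have dE j : dotp (l2_tensor k v j) (l2_tensor k' v' j) = dotp (k j) (k' j) * dotp v v'.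
  by rewrite !l2_tensorE linearZl_LR linearZr_LR/= mulrA.
case: (dotp v v') dE => a b dE.
have -> : (fun j => complex.Re (dotp (l2_tensor k v j) (l2_tensor k' v' j))) =
    (fun j => a * complex.Re (dotp (k j) (k' j))) \+
    (fun j => - b * complex.Im (dotp (k j) (k' j))).
  apply/funext => j; rewrite dE -[RHS]/(a * complex.Re (dotp (k j) (k' j)) +
    - b * complex.Im (dotp (k j) (k' j))).
  by case: (dotp (k j) (k' j)) => x y /=; ring.
have -> : (fun j => complex.Im (dotp (l2_tensor k v j) (l2_tensor k' v' j))) =
    (fun j => b * complex.Re (dotp (k j) (k' j))) \+
    (fun j => a * complex.Im (dotp (k j) (k' j))).
  apply/funext => j; rewrite dE -[RHS]/(b * complex.Re (dotp (k j) (k' j)) +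
    a * complex.Im (dotp (k j) (k' j))).
  by case: (dotp (k j) (k' j)) => x y /=; ring.
rewrite !usumD ?usumZ//; try exact: usummableZ.
by apply/eqP; rewrite eq_complex/=; apply/andP; split; apply/eqP; ring.
Qed.

Lemma l2_hilbert_tensor : hilbert_tensor l2_tensor.
Proof.
split.
- by move=> v a k k'; apply: l2_ext => j; rewrite l2DE l2ZE !l2_tensorE scalerDl scalerA.
- move=> k a v v'; apply: l2_ext => j; rewrite l2DE l2ZE !l2_tensorE scalerDr.
  by rewrite !scalerA mulrC.
- exact: l2_tensor_dotp.
- move=> t e e0; have [E uE /(_ E uE (fun _ => id)) tE] := l2_fin_approx t e0.
  exists (fin_l2 E t) => //; rewrite fin_l2_sum_dlt//.
  apply: lsubspace_sum => [|j _]; first exact: lspan_lsubspace.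
  rewrite dlt_l2_tensor; apply: lspan_gen.
  by exists (dlt j ((1 : R[i]) : cplx R), t j).
Qed.

(** The vectors [dlt j v] are elementary tensors, so values on elementary tensors fix all entries
    and the choice made by [op_tensor] is forced. *)
Lemma l2_op_tensor_eq (b : bop (l2 J (cplx R))) (x : bop V) (S : bop (l2 J V)) :
  (forall k v, S (l2_tensor k v) = l2_tensor (b k) (x v)) ->
  op_tensor l2_tensor b x = S.
Proof.
move=> hS; have h : forall k v, op_tensor l2_tensor b x (l2_tensor k v) =
    l2_tensor (b k) (x v).
  have ex : exists T : bop (l2 J V), forall k v, T (l2_tensor k v) = l2_tensor (b k) (x v).
    by exists S.
  exact: (xgetPex 0 ex).
apply: bop_entry_ext => p q; apply: bop_ext => v.
by rewrite !entryE dlt_l2_tensor h hS.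
Qed.

End l2_tensor.

(** The entries at positions in the image of [f] form a compression: the [z (q, j)] are placed
    isometrically at the coordinates [f j], and the other coordinates of the result are dropped. *)
Lemma entry_mxbound_mx (R : realType) (J : choiceType) (V : hilbertType R)
    (P K : finType) (x : P -> P -> bop (l2 J V)) (B : R) (f : K -> J) :
  injective f -> mxbound x B ->
  mxbound (fun u v : P * K => entry (f u.2) (f v.2) (x u.1 v.1)) B.
Proof.
move=> injf xB z; pose y q : l2 J V := \sum_j dlt (f j) (z (q, j)).
have yf q j : y q (f j) = z (q, j).
  rewrite l2_sumE; under eq_bigr do rewrite dltE (inj_eq injf).
  rewrite (bigD1 j)//= eqxx big1 ?addr0// => r rj.
  by rewrite eq_sym (negbTE rj).
have um : uniq (map f (enum K)) by rewrite map_inj_uniq// enum_uniq.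
have yE q : y q = fin_l2 (map f (enum K)) (y q).
  apply: l2_ext => j; rewrite fin_l2E; case: ifPn => // jK.
  rewrite l2_sumE big1// => k _; rewrite dltE; case: eqP => // jk.
  by rewrite jk map_f ?mem_enum in jK.
have -> : \sum_v hilnorm (z v) ^+ 2 = \sum_q hilnorm (y q) ^+ 2.
  apply: (@etrans _ _ (\sum_q \sum_j hilnorm (z (q, j)) ^+ 2)).
    by rewrite pair_bigA; apply: eq_bigr => -[].
  apply: eq_bigr => q _; rewrite [in RHS]yE hilnorm_fin_l2// big_map big_enum/=.
  by apply: eq_bigr => j _; rewrite yf.
apply: le_trans (xB y); pose w p : l2 J V := \sum_q x p q (y q).
rewrite (_ : \sum_u _ = \sum_p \sum_i hilnorm (w p (f i)) ^+ 2); last first.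
  rewrite pair_bigA; apply: eq_bigr => -[p i] _ /=; congr (hilnorm _ ^+ 2).
  apply: (@etrans _ _ (\sum_q \sum_j entry (f i) (f j) (x p q) (z (q, j)))).
    by rewrite pair_bigA; apply: eq_bigr => -[].
  rewrite /w l2_sumE; apply: eq_bigr => q _; rewrite /y bop_sum l2_sumE.
  by apply: eq_bigr => j _; rewrite entryE.
apply: ler_sum => p _; apply: le_trans (l2_hilnorm_ge_sum (w p) um).
by rewrite big_map big_enum.
Qed.

Lemma entry_mxbound (R : realType) (J : choiceType) (V : hilbertType R)
    (T : bop (l2 J V)) (K : finType) (f : K -> J) : injective f ->
  mxbound (fun i j => entry (f i) (f j) T) (opnorm T).
Proof.
move=> injf; have h := entry_mxbound_mx injf (mxbound_unit T).
have bij : bijective (fun k : K => (tt, k)) by exists snd => // -[[]].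
exact: (mxbound_reindex _ _ bij).2 h.
Qed.

(** * Block diagonal operators *)

Section block_operators.
Variables (R : realType) (D : choiceType) (n : D -> nat).
Let J : choiceType := {j : D & 'I_(n j)}.
Let ix j (a : 'I_(n j)) : J := Tagged (fun j => 'I_(n j)) a.

Definition blk (W : hilbertType R) (c : forall j, 'I_(n j) -> 'I_(n j) -> bop W) :
    bop (l2 J W) :=
  l2_op (fun x i => \sum_b c (tag i) (tagged i) b (x (ix b))).

Variable W : hilbertType R.
Implicit Type c : forall j, 'I_(n j) -> 'I_(n j) -> bop W.

Lemma blkP c M : 0 <= M -> (forall j, mxbound (c j) M) ->
  (forall x j (a : 'I_(n j)), blk c x (ix a) = \sum_b c j a b (x (ix b))) /\
  opnorm (blk c) <= M.
Proof.
move=> M0 cM.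
have [|||h hM] := @l2_opP R J W (fun x i => \sum_b c (tag i) (tagged i) b (x (ix b))) M => //.
- move=> a x y i; rewrite scaler_sumr -big_split/=; apply: eq_bigr => b _.
  exact: (bopP (c _ _ b) a (x (ix b)) (y (ix b))).
- move=> x s us; pose js := undup (map tag s).
  (* The finite index set is completed to whole blocks, since the bound on [c j] controls only full
     sums over a block. *)
  pose s' : seq J := [seq ix a | j <- js, a <- enum 'I_(n j)].
  have us' : uniq s'.
    apply: allpairs_uniq_dep => [|j _|]; rewrite ?undup_uniq ?enum_uniq//.
    by move=> [j a] [j' a'] _ _ /= e; exact: e.
  have ss' : {subset s <= s'}.
    move=> [j a] js_; apply/allpairsPdep; exists j, a; split=> //.
    - by rewrite mem_undup; apply/mapP; exists (existT _ j a).
    - by rewrite mem_enum.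
  have sum_s' (F : J -> R) : \sum_(i <- s') F i = \sum_(j <- js) \sum_(a < n j) F (ix a).
    by rewrite big_allpairs_dep; apply: eq_bigr => j _; rewrite big_enum.
  apply: (@le_trans _ _ (\sum_(i <- s') hilnorm
      (\sum_b c (tag i) (tagged i) b (x (ix b))) ^+ 2)).
    by apply: sum_uniq_sub_le => // i; exact: sqr_ge0.
  apply: (@le_trans _ _ (M ^+ 2 * \sum_(i <- s') hilnorm (x i) ^+ 2)).
    rewrite !sum_s' mulr_sumr; apply: ler_sum => j _.
    exact: (cM j (fun b => x (ix b))).
  by rewrite ler_wpM2l ?sqr_ge0// l2_hilnorm_ge_sum.
by split=> // x j a; rewrite /blk h.
Qed.

Lemma entry_blk c M j (a b : 'I_(n j)) : 0 <= M -> (forall j, mxbound (c j) M) ->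
  entry (ix a) (ix b) (blk c) = c j a b.
Proof.
move=> M0 cM; have [cE _] := blkP M0 cM; apply: bop_ext => v.
rewrite entryE cE; under eq_bigr do rewrite dltE.
rewrite (bigD1 b)//= eqxx big1 ?addr0// => b' bb'.
rewrite ifF ?bop0//; apply/negbTE; apply: contra bb' => /eqP e.
by apply/eqP; exact: eq_from_Tagged e.
Qed.

End block_operators.

Section identity_operator.
Variables (R : realType) (W : hilbertType R).

Lemma id_bop_subproof : id \in bop_pred (V := W).
Proof. by apply: (@mkbop _ _ _ 1) => // x; rewrite mul1r. Qed.

Definition id_bop : bop W := Bop id_bop_subproof.

End identity_operator.

Section soap_approximation.
Variables (R : realType) (V : hilbertType R) (X : set (bop V)).
Hypothesis sX : lsubspace X.

(** [D] indexes all square matrices over B(V) and [J] all their rows, so one operator on ell^2(J, V)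
    has room for every matrix at once. *)
Let D : choiceType := {m : nat & 'M[bop V]_m}.
Let n (j : D) : nat := tag j.
Let J : choiceType := {j : D & 'I_(n j)}.
Let tau := @l2_tensor R J V.
Let elementary := [set S | exists (b : bop (l2 J (cplx R))) x, X x /\ S = op_tensor tau b x].

Let sM : lsubspace (min_tensor tau X).
Proof. exact: op_closure_lsubspace (lspan_lsubspace _). Qed.

(* Coordinates of the entries turn a bounded block diagonal family with        *)
(* entries in a finite-dimensional space into a finite sum of elementary       *)
(* tensors.                                                                    *)
Lemma blk_finite_dim (Y : set (bop V)) (y : forall j, 'I_(n j) -> 'I_(n j) -> bop V) M :
  finite_dim Y -> Y `<=` X -> (forall j a b, Y (y j a b)) ->
  0 <= M -> (forall j, mxbound (y j) M) ->
  lspan elementary (blk y) /\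
  forall Phi Theta d, linear_on X Phi -> 0 <= d -> cb_le X Phi d ->
    is_amplification tau X Phi Theta ->
    Theta (blk y) = blk (fun j a b => Phi (y j a b)).
Proof.
move=> fY YX Yy M0 yM; have [k [g [e [Ye bg YE]]]] := dual_basis fY.
have sT : lsubspace [set: bop V] by [].
have [C hC] := choice (fun i : 'I_k => bg i (ltn_ord i)).
(* With [f] the identity of the scalars this family is the matrix of [l]-th coordinates and defines
   [B l] on ell^2(J); with [f] in B(V) it gives the blocks of the tensor of [B l] with [f], as [BE]
   states. *)
pose G l (W : hilbertType R) (f : bop W) j a b : bop W := g l (y j a b) *: f.
have Gb (l : 'I_k) W f j : mxbound (@G l W f j) (C l * M * opnorm f).
  exact: (functional_mxbound sT (hC l) M0 (fun _ _ => I) (yM j) f).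
have GM (l : 'I_k) W (f : bop W) : 0 <= C l * M * opnorm f.
  by have [C0 _ _] := hC l; rewrite !mulr_ge0 ?opnorm_ge0.
pose B (l : 'I_k) := blk (G l (cplx R) (id_bop (cplx R))).
have BE (l : 'I_k) (f : bop V) : op_tensor tau (B l) f = blk (G l V f).
  apply: l2_op_tensor_eq => z v.
  have [E1 _] := blkP (GM l V f) (Gb l V f).
  have [E2 _] := blkP (GM l _ (id_bop (cplx R))) (Gb l _ (id_bop (cplx R))).
  apply: l2_ext => -[j a]; rewrite (E1 _ j a) l2_tensorE (E2 _ j a) scaler_suml.
  by apply: eq_bigr => b _; rewrite bopZE l2_tensorE bopZ scalerA.
have sumE (f : nat -> bop V) : \sum_(l < k) blk (G l V (f l)) =
    blk (fun j a b => \sum_(l < k) g l (y j a b) *: f l).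
  have bnd j : mxbound (fun a b => \sum_(l < k) g l (y j a b) *: f l)
      ((\sum_(l < k) C l * opnorm (f l)) * M).
    exact: (cb_le_sum_functional sT (fun l : 'I_k => f l) hC M0 _ (yM j)).
  have S0 : 0 <= (\sum_(l < k) C l * opnorm (f l)) * M.
    rewrite mulr_ge0// sumr_ge0// => l _; have [C0 _ _] := hC l.
    by rewrite mulr_ge0 ?opnorm_ge0.
  have [E _] := blkP S0 bnd.
  apply: bop_ext => z; apply: l2_ext => -[j a]; rewrite (E z j a) bop_sumE l2_sumE.
  under [RHS]eq_bigr do rewrite bop_sumE; rewrite exchange_big/=.
  apply: eq_bigr => l _; have [E1 _] := blkP (GM l V (f l)) (Gb l V (f l)).
  by rewrite (E1 z j a).
have Xe l : (l < k)%N -> X (e l) by move=> lk; apply: (YX); exact: (Ye).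
have yE : blk y = \sum_(l < k) op_tensor tau (B l) (e l).
  under eq_bigr do rewrite BE; rewrite (sumE e).
  by congr blk; apply/functional_extensionality_dep => j; apply/funext => a;
    apply/funext => b; exact: YE.
have el (l : 'I_k) : lspan elementary (op_tensor tau (B l) (e l)).
  by apply: lspan_gen; exists (B l), (e l); split=> //; exact: Xe.
split=> [|Phi Theta d lPhi d0 cPhi [lTh _ ThE]].
  by rewrite yE; apply: lsubspace_sum => //; exact: lspan_lsubspace.
rewrite yE (linear_on_sum sM lTh); last by move=> l _; apply: op_closureS; exact: el.
have -> : \sum_(l < k) Theta (op_tensor tau (B l) (e l)) =
    \sum_(l < k) blk (G l V (Phi (e l))).
  by apply: eq_bigr => l _; rewrite ThE; [exact: BE|exact: Xe].
rewrite (sumE (Phi \o e)); congr blk; apply/functional_extensionality_dep => j.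
apply/funext => a; apply/funext => b; rewrite [in RHS](YE _ (Yy j a b)).
rewrite (linear_on_sum sX lPhi); last first.
  by move=> l _; apply: lsubspaceZ => //; exact: Xe.
by apply: eq_bigr => l _; rewrite (linear_onZ sX lPhi)//; exact: Xe.
Qed.

Variables (Psi : bop V -> bop V).
Hypothesis Psi_cc : completely_compact X X Psi.

Let good (j : D) : Prop := mx_in X (tagged j) /\ mxopnorm (tagged j) <= 1.

(** Matrices not in the unit ball over [X] get the block 0, which keeps the family bounded over all
    of [D]. *)
Let U (j : D) (a b : 'I_(n j)) : bop V :=
  if `[< good j >] then Psi (tagged j a b) else 0.

Let mxbound0 (P : finType) (M : R) : mxbound (fun _ _ : P => (0 : bop V)) M.
Proof.
move=> z; rewrite big1 => [|p _].
  by apply: mulr_ge0; [exact: sqr_ge0|exact: sum_hilnorm_sqr_ge0].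
by rewrite big1 ?hilnorm0 ?expr0n.
Qed.

(** Complete compactness provides one [Y] for all matrix sizes, while the approximating matrix over
    [Y] is chosen separately for each block. *)
Let compact_approx (eps : R) : 0 < eps ->
  exists (Y : set (bop V)) (y : forall j, 'I_(n j) -> 'I_(n j) -> bop V),
    [/\ finite_dim Y, Y `<=` X, forall j a b, Y (y j a b) &
        forall j, mxbound (fun a b => U a b - y j a b) eps].
Proof.
have [_ cc] := Psi_cc; move=> e0; have [Y [fY YX hY]] := cc eps e0.
have [Y0 _] : lsubspace Y by case: fY => ys ->; exact: lspan_lsubspace.
have ex (j : D) : exists y : 'I_(n j) -> 'I_(n j) -> bop V,
    (forall a b, Y (y a b)) /\ mxbound (fun a b => U a b - y a b) eps.
  have [gj|ngj] := pselect (good j); last first.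
    exists (fun _ _ => 0); split=> //.
    apply: eq_mxbound (@mxbound0 _ eps) => a b.
    by rewrite /U asboolF// subr0.
  have [Xj j1] := gj; have := hY _ _ Xj j1 => /inf_lt[].
    exists (mxopnorm (map_mx Psi (tagged j) - 0)), 0 => //.
    by move=> a b; rewrite mxE.
  move=> _ [y Yy <-] yl; exists (fun a b => y a b); split=> //.
  have := mxbound_le (mxopnorm_ge0 _) (ltW yl) (mxopnormP _).
  by apply: eq_mxbound => a b; rewrite !mxE /U asboolT.
exists Y, (fun j => projT1 (cid (ex j))); split=> // j.
  by case: (cid (ex j)) => ? [].
by case: (cid (ex j)) => ? [].
Qed.

(* The SOAP is applied to the single block diagonal operator whose blocks are  *)
(* the matrices [Psi(x)], [x] running over all matrices of norm at most 1.     *)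
(* Complete compactness is what puts it in B(K) (x)_min X.                     *)
Lemma soap_approx (e : R) : SOAP X -> 0 < e ->
  exists Phi, [/\ completely_bounded X X Phi, finite_rank X Phi &
    cb_le X (fun x => Phi (Psi x) - Psi x) e].
Proof.
move=> [I [le [Phi [[_ lexx _ _] cbPhi frPhi hTheta]]]] e0.
have [Theta [amp conv]] := hTheta _ _ _ (@l2_hilbert_tensor R J V).
have [[PsiX lPsi _] _] := Psi_cc.
have [c c0 cPsi] := completely_bounded_cb_le sX (proj1 Psi_cc).
have UM j : mxbound (@U j) c.
  have [gj|ngj] := pselect (good j); last first.
    by apply: eq_mxbound (@mxbound0 _ c) => a b; rewrite /U asboolF.
  have [Xj j1] := gj.
  have k1 : mxbound (fun a b => tagged j a b) 1.
    by apply: mxbound_le (mxopnormP _) => //; exact: mxopnorm_ge0.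
  have := cPsi _ _ _ ler01 Xj k1; rewrite mulr1.
  by apply: eq_mxbound => a b; rewrite /U asboolT.
pose u := blk U.
have approx eps : 0 < eps -> exists y : forall j, 'I_(n j) -> 'I_(n j) -> bop V,
    [/\ forall j a b, X (y j a b), lspan elementary (blk y),
        forall i, Theta i (blk y) = blk (fun j a b => Phi i (y j a b)),
        forall j, mxbound (fun a b => U a b - y j a b) eps &
        opnorm (u - blk y) <= eps].
  move=> eps0; have [Y [y [fY YX Yy yU]]] := compact_approx eps0.
  have ce : 0 <= c + eps by rewrite addr_ge0// ltW.
  have yM j : mxbound (y j) (c + eps).
    have := mxboundD c0 (ltW eps0) (UM j) (mxboundN (yU j)).
    by apply: eq_mxbound => a b; rewrite opprB addrC subrK.
  have [yl yTh] := blk_finite_dim fY YX Yy ce yM.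
  exists y; split=> // [j a b|i|].
  - by apply: (YX).
  - have [_ lPhi _] := cbPhi i; have [d d0 cPhi] := completely_bounded_cb_le sX (cbPhi i).
    exact: (yTh _ _ d lPhi d0 cPhi (amp i)).
  - have [E hE] := blkP (ltW eps0) yU.
    rewrite (_ : u - blk y = blk (fun j a b => U a b - y j a b))//.
    have [EU _] := blkP c0 UM; have [Ey _] := blkP ce yM.
    apply: bop_ext => z; apply: l2_ext => -[j a]; rewrite (E z j a) bopBE l2BE.
    rewrite (EU z j a) (Ey z j a) -sumrB.
    by apply: eq_bigr => b _; rewrite bopBE.
have uM : min_tensor tau X u.
  move=> eps eps0; have [y [_ yl _ _ uy]] := approx _ (divr_gt0 eps0 (ltr0n R 2)).
  exists (blk y) => //; apply: (le_lt_trans uy); rewrite ltr_pdivrMr// ltr_pMr//.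
  by rewrite ltr1n.
(* A single index is enough: convergence at [u] is used at its own threshold. *)
have [i /(_ i (lexx i)) Tu] := conv u uM e e0.
have [lTh [M hM] _] := amp i; have [PhiX lPhi _] := cbPhi i.
have [d d0 cPhi] := completely_bounded_cb_le sX (cbPhi i).
have XU (j : D) (a b : 'I_(n j)) : X (U a b).
  rewrite /U; case: asboolP => [[Xj _]|_]; first exact: PsiX (Xj a b).
  by case: sX.
pose ix (j : D) (a : 'I_(n j)) : J := Tagged (fun j => 'I_(n j)) a.
have ix_inj j : injective (@ix j) by move=> a b; exact: eq_from_Tagged.
pose T0 := Theta i u - u.
(* [Theta i] is explicit only at [blk y]. So a block of Phi Psi - Psi is split into the entries of
   [T0], the term Phi(U - y), and the entries of Theta(blk y - u); the last two are of order
   [eps]. *)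
have main j : good j ->
    mxbound (fun a b => Phi i (Psi (tagged j a b)) - Psi (tagged j a b)) (opnorm T0).
  move=> gj; apply: (@mxbound_lim _ _ _ _ _ (d + `|M|)); rewrite ?opnorm_ge0//.
    by rewrite addr_ge0.
  move=> eps eps0; have [y [Xy yl yTh yU uy]] := approx eps eps0.
  have deps : 0 <= d * eps by rewrite mulr_ge0// ltW.
  have Meps : 0 <= `|M| * eps by rewrite mulr_ge0// ltW.
  have yM := op_closureS yl.
  have XUy (a b : 'I_(n j)) : X (U a b - y j a b) by exact: lsubspaceB.
  have h1 := entry_mxbound T0 (@ix_inj j).
  have h2 := cPhi _ _ _ (ltW eps0) XUy (yU j).
  have h3 : mxbound (fun a b => entry (ix j a) (ix j b) (Theta i (blk y - u))) (`|M| * eps).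
    apply: mxbound_le (entry_mxbound _ (@ix_inj j)); first exact: opnorm_ge0.
    apply: le_trans (hM _ (lsubspaceB sM yM uM)) _.
    apply: (@le_trans _ _ (`|M| * opnorm (blk y - u))).
      by rewrite ler_wpM2r ?opnorm_ge0// ler_norm.
    by rewrite opnormB; exact: (ler_wpM2l (normr_ge0 M) uy).
  have := mxboundD (opnorm_ge0 T0) (addr_ge0 deps Meps) h1 (mxboundD deps Meps h2 h3).
  rewrite -mulrDl; apply: eq_mxbound => a b.
  rewrite (linear_onB lTh yM uM) yTh (linear_onB lPhi (XU j a b) (Xy j a b)).
  rewrite !entryB.
  have [yb yb0 ybM] : exists2 B, 0 <= B & forall j, mxbound (fun a b => Phi i (y j a b)) B.
    exists (d * (c + eps)); first by rewrite mulr_ge0// addr_ge0// ltW.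
    move=> j'; apply: cPhi => //; first by rewrite addr_ge0// ltW.
    have := mxboundD c0 (ltW eps0) (UM j') (mxboundN (yU j')).
    by apply: eq_mxbound => a' b'; rewrite opprB addrC subrK.
  rewrite [entry _ _ u](entry_blk a b c0 UM).
  rewrite (entry_blk a b yb0 ybM).
  have -> : U a b = Psi (tagged j a b) by rewrite /U asboolT.
  move: (entry _ _ _) (Psi _) (Phi i (Psi _)) (Phi i (y j a b)) => p q r s.
  by rewrite subrKA addrC subrKA.
exists (Phi i); split=> //.
have lD : linear_on X (fun x => Phi i (Psi x) - Psi x).
  move=> a x y Xx Xy; rewrite lPsi// lPhi; try exact: PsiX.
  by rewrite scalerBr opprD addrACA.
(* [main] concerns matrices indexed by ordinals and of norm at most 1; passing through [cbnorm]
   extends it to the generality of [cb_le]. *)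
have nle : (cbnorm X (fun x => Phi i (Psi x) - Psi x)%R <= (opnorm T0)%:E)%E.
  apply: ge_ereal_sup => _ [m [x [Xx x1 ->]]]; rewrite lee_fin.
  apply: mxopnorm_le; first exact: opnorm_ge0.
  have := main (Tagged (fun m => 'M[bop V]_m) x) (conj Xx x1).
  by apply: eq_mxbound => a b; rewrite mxE.
have fin := le_lt_trans nle (ltry _).
apply: (cb_le_le _ _ (cbnorm_cb_le sX lD fin)).
  by rewrite fine_ge0 ?cbnorm_ge0.
apply: le_trans (ltW Tu); rewrite -lee_fin fineK//.
by rewrite ge0_fin_numE ?cbnorm_ge0.
Qed.

End soap_approximation.

(** * Multipliers associated with completely bounded maps *)

Section l2_matrix_tests.
Variables (R : realType) (I : choiceType) (V : hilbertType R).
Implicit Types (E : seq I).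

Lemma fin_l2D E (x y : l2 I V) :
  fin_l2 E (fun i => x i + y i) = fin_l2 E x + fin_l2 E y.
Proof. by apply: l2_ext => i; rewrite l2DE !fin_l2E; case: ifP; rewrite ?addr0. Qed.

Lemma hilnorm_fin_l2_le E (x : l2 I V) : uniq E -> hilnorm (fin_l2 E x) <= hilnorm x.
Proof.
move=> uE; rewrite hilnorm_le_sqr ?hilnorm_ge0// hilnorm_fin_l2//.
exact: l2_hilnorm_ge_sum.
Qed.

(** The finitely many vectors [z q] and their images [w p] all lie within [d] of their truncations
    to a common finite [E], and [d] is as small as needed. This reduces [S0_cb] to finitely many
    group elements. *)
Lemma mxbound_fin_test (P : finType) (y : P -> P -> bop (l2 I V)) (C : R) : 0 <= C ->
  (forall E (z : P -> l2 I V), uniq E ->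
    \sum_p hilnorm (fin_l2 E (\sum_q y p q (fin_l2 E (z q)))) ^+ 2 <=
    C ^+ 2 * \sum_q hilnorm (z q) ^+ 2) ->
  mxbound y C.
Proof.
move=> C0 h z; set N := \sum_q hilnorm (z q) ^+ 2; have N0 : 0 <= N := sum_hilnorm_sqr_ge0 z.
pose W := C * Num.sqrt N; have W0 : 0 <= W by rewrite mulr_ge0 ?sqrtr_ge0.
have WE : W ^+ 2 = C ^+ 2 * N by rewrite exprMn sqr_sqrtr.
pose K := \sum_p \sum_q opnorm (y p q).
have K0 : 0 <= K by apply: sumr_ge0 => p _; apply: sumr_ge0 => q _; exact: opnorm_ge0.
pose k := 1 + K; have k0 : 0 <= k by rewrite addr_ge0.
pose L := \sum_(p : P) (2 * W * k + k ^+ 2).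
have L0 : 0 <= L by apply: sumr_ge0 => p _; rewrite addr_ge0 ?sqr_ge0// !mulr_ge0.
have L1 : 0 < L + 1 by rewrite ltr_wpDl.
apply/ler_addgt0Pr => e e0.
pose d := Num.min 1 (e / (L + 1)).
have d0 : 0 < d by rewrite lt_min ltr01 divr_gt0.
have d1 : d <= 1 by rewrite ge_min lexx.
have dL : d * (L + 1) <= e by rewrite -ler_pdivlMr// ge_min lexx orbT.
pose w p : l2 I V := \sum_q y p q (z q).
have exz q : exists E, uniq E /\ forall E', uniq E' -> {subset E <= E'} ->
    hilnorm (z q - fin_l2 E' (z q)) < d.
  by have [E uE hE] := l2_fin_approx (z q) d0; exists E.
have exw p : exists E, uniq E /\ forall E', uniq E' -> {subset E <= E'} ->
    hilnorm (w p - fin_l2 E' (w p)) < d.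
  by have [E uE hE] := l2_fin_approx (w p) d0; exists E.
have [Ez hz] := choice exz; have [Ew hw] := choice exw.
pose E := undup (flatten [seq Ez q ++ Ew q | q <- enum P]).
have uE : uniq E := undup_uniq _.
have Ezw q i : (i \in Ez q) || (i \in Ew q) -> i \in E.
  move=> iq; rewrite mem_undup; apply/flatten_mapP; exists q; first exact: mem_enum.
  by rewrite mem_cat.
have zd q : hilnorm (z q - fin_l2 E (z q)) <= d.
  by have [_ /(_ E uE) hq] := hz q; apply/ltW/hq => i iq; apply: (Ezw q); rewrite iq.
have wd p : hilnorm (w p - fin_l2 E (w p)) <= d.
  by have [_ /(_ E uE) hp] := hw p; apply/ltW/hp => i ip; apply: (Ezw p); rewrite ip orbT.
pose w' p : l2 I V := \sum_q y p q (fin_l2 E (z q)).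
pose a p := hilnorm (fin_l2 E (w' p)).
have aN : \sum_p a p ^+ 2 <= W ^+ 2 by rewrite WE; exact: h.
have aW p : a p <= W.
  rewrite /a hilnorm_le_sqr// -/(a p); apply: le_trans aN.
  by rewrite (bigD1 p)//= lerDl sumr_ge0// => q _; exact: sqr_ge0.
have rowK p : \sum_q opnorm (y p q) <= K.
  rewrite /K [leRHS](bigD1 p)//= lerDl.
  by apply: sumr_ge0 => p' _; apply: sumr_ge0 => q _; exact: opnorm_ge0.
have wa p : hilnorm (w p) <= a p + k * d.
  pose t := w p - w' p.
  have td : hilnorm t <= K * d.
    rewrite /t /w /w' -sumrB; apply: (le_trans (hilnorm_sum _ _ _)).
    apply: (@le_trans _ _ (\sum_q opnorm (y p q) * d)).
      apply: ler_sum => q _; rewrite -bopB; apply: (le_trans (opnormP _ _)).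
      by rewrite ler_wpM2l ?opnorm_ge0.
    rewrite -mulr_suml; apply: ler_wpM2r; [exact: ltW|exact: rowK].
  have wE : fin_l2 E (w p) = fin_l2 E (w' p) + fin_l2 E t.
    rewrite -fin_l2D; apply: l2_ext => i; rewrite !fin_l2E; case: ifP => // _.
    by rewrite /t l2BE addrC subrK.
  rewrite -[w p](subrK (fin_l2 E (w p))); apply: (le_trans (ler_hilnormD _ _)).
  rewrite /k mulrDl mul1r addrCA; apply: lerD; first exact: wd.
  rewrite wE; apply: (le_trans (ler_hilnormD _ _)); apply: lerD => //.
  exact: le_trans (hilnorm_fin_l2_le _ uE) td.
have a0 p : 0 <= a p := hilnorm_ge0 _.
apply: (@le_trans _ _ (\sum_p (a p ^+ 2 + (2 * W * k + k ^+ 2) * d))).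
  apply: ler_sum => p _; rewrite -/(w p).
  have kd : 0 <= k * d by rewrite mulr_ge0// ltW.
  apply: (@le_trans _ _ ((a p + k * d) ^+ 2)); first by rewrite -hilnorm_le_sqr// addr_ge0.
  have -> : (a p + k * d) ^+ 2 = a p ^+ 2 + (2 * a p * k + k ^+ 2 * d) * d by ring.
  rewrite lerD2l ler_wpM2r ?(ltW d0)//; apply: lerD.
    by rewrite ler_wpM2r// ler_wpM2l.
  by rewrite ler_piMr ?sqr_ge0.
rewrite big_split/= -mulr_suml -/L -WE; apply: lerD => //.
apply: le_trans dL; rewrite mulrC ler_wpM2l ?(ltW d0)//.
by rewrite lerDl.
Qed.

(** Each [w q] is summed along its own enumeration [s q] of [I] by [K]. A finite [ks] captures
    almost all of every norm, and for such a [ks] the sum can be estimated slice by slice. *)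
Lemma sum_hilnorm_reindexed (Q : finType) (K : choiceType) (w : Q -> l2 I V)
    (s : Q -> K -> I) (s' : Q -> I -> K) (C : R) :
  (forall q, cancel (s' q) (s q)) -> (forall q, injective (s q)) ->
  (forall ks, uniq ks -> \sum_(k <- ks) \sum_q hilnorm (w q (s q k)) ^+ 2 <= C) ->
  \sum_q hilnorm (w q) ^+ 2 <= C.
Proof.
move=> s'K sI h; apply/ler_addgt0Pr => e e0.
pose L : R := \sum_(q : Q) 1; have L0 : 0 <= L by apply: sumr_ge0.
have L1 : 0 < L + 1 by rewrite ltr_wpDl.
have d0 : 0 < e / (L + 1) by rewrite divr_gt0.
have ex q : exists E, uniq E /\
    hilnorm (w q) ^+ 2 - e / (L + 1) < \sum_(i <- E) hilnorm (w q i) ^+ 2.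
  by have [E uE hE] := l2_partial_sum (w q) d0; exists E.
have [E hE] := choice ex.
pose ks := undup (flatten [seq map (s' q) (E q) | q <- enum Q]).
have uks : uniq ks := undup_uniq _.
have le q : hilnorm (w q) ^+ 2 <=
    \sum_(k <- ks) hilnorm (w q (s q k)) ^+ 2 + e / (L + 1).
  have [uE /ltW] := hE q; rewrite lerBlDr => /le_trans; apply; rewrite lerD2r.
  rewrite -(big_map (s q) predT (fun i => hilnorm (w q i) ^+ 2)).
  apply: sum_uniq_sub_le => [i||i iE|] //; first exact: sqr_ge0.
    apply/mapP; exists (s' q i); last by rewrite s'K.
    rewrite mem_undup; apply/flatten_mapP; exists q; first exact: mem_enum.
    exact: map_f.
  by rewrite map_inj_uniq.
apply: (@le_trans _ _ (\sum_q (\sum_(k <- ks) hilnorm (w q (s q k)) ^+ 2 + e / (L + 1)))).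
  exact: ler_sum.
rewrite big_split/= exchange_big/=; apply: lerD; first exact: h.
under eq_bigr do rewrite -[e / _]mul1r.
rewrite -mulr_suml -/L mulrCA ler_piMr ?(ltW e0)// ler_pdivrMr// mul1r.
by rewrite lerDl.
Qed.

End l2_matrix_tests.

Section multipliers.
Variables (R : realType) (G : groupType) (H : hilbertType R).
Variables (A : set (bop H)) (alpha : G -> bop H -> bop H).
Hypotheses (cA : cstar_algebra A) (act : cstar_action A alpha).
Let X := reduced_crossed_product A alpha.
Let X0 := pi_tilde_ell1 A alpha.
Let sX0 : lsubspace X0 := pi_tilde_ell1_lsubspace cA act.
Let sX : lsubspace X := crossed_lsubspace cA act.

(* The Fourier coefficient [x_t] of [x = sum_t pi(x_t) lam_t]. *)
Definition coef (x : bop (l2 G H)) (t : G) : bop H := entry 1%g t^-1%g x.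

Lemma coef_pi_tilde f : ell1 A f -> coef (pi_tilde alpha f) = f.
Proof.
move=> lf; have [Af _] := lf; apply/funext => t.
by rewrite /coef (entry_pi_tilde cA act)// invgK mul1g invg1 (alpha1 act).
Qed.

Lemma coef_ell1 x : X0 x -> ell1 A (coef x).
Proof. by move=> [f lf <-]; rewrite coef_pi_tilde. Qed.

Lemma coefA x t : X x -> A (coef x t).
Proof. by move=> Xx; exact: (entry_crossedA cA act t^-1%g Xx). Qed.

Lemma entry_coef x r q : X x -> entry r q x = alpha r^-1%g (coef x (r * q^-1)%g).
Proof.
move=> Xx; rewrite /coef -(entry_crossed cA act)//; congr entry.
by rewrite invgM invgK mulgVK.
Qed.

Section amplification.
Variables (P : finType) (x : P -> P -> bop (l2 G H)) (B : R).
Hypotheses (Xx : forall p q, X (x p q)) (xB : mxbound x B).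
Variables (K : finType) (r : K -> G).
Hypothesis r_inj : injective r.

Definition amplified (u v : P * K) : bop (l2 G H) :=
  mono alpha (r u.2 * (r v.2)^-1)%g (coef (x u.1 v.1) (r u.2 * (r v.2)^-1)%g).

(* [amplified] is a corner of the coaction image [sum_t pi(x_t) lam_t (x) lam_t]. *)
(* On each slice [(q, j) |-> z_(q, j)(r_j k^-1)] it acts by entries of [x].       *)
Lemma amplified_mxbound : mxbound amplified B.
Proof.
move=> z; pose w u : l2 G H := \sum_v amplified u v (z v).
apply: (@sum_hilnorm_reindexed _ _ _ _ _ w (fun u k => r u.2 * k^-1)%g
  (fun u g => g^-1 * r u.2)%g).
- by move=> u g; rewrite invgM invgK mulgA mulgV mul1g.
- by move=> u k k' /mulgI /invg_inj.
move=> ks uks.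
have inj_k k : injective (fun i => r i * k^-1)%g by move=> i j /mulIg /r_inj.
(* For fixed k, r_i r_j^-1 = (r_i k^-1)(r_j k^-1)^-1, so on this slice the monomials act through
   honest entries of [x]. *)
have wE k u : w u (r u.2 * k^-1)%g =
    \sum_v entry (r u.2 * k^-1)%g (r v.2 * k^-1)%g (x u.1 v.1) (z v (r v.2 * k^-1)%g).
  rewrite l2_sumE; apply: eq_bigr => v _.
  rewrite /amplified (monoE cA act); last exact: coefA.
  rewrite entry_coef//; congr (alpha _ (coef _ _) (z v _)).
    by rewrite [(r v.2 * _)^-1%g]invgM invgK mulgA mulgVK.
  by rewrite invgM invgK !mulgA mulgVK.
apply: (@le_trans _ _ (\sum_(k <- ks) B ^+ 2 * \sum_v hilnorm (z v (r v.2 * k^-1)%g) ^+ 2)).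
  apply: ler_sum => k _; under eq_bigr do rewrite wE.
  exact: (entry_mxbound_mx (@inj_k k) xB (fun v => z v (r v.2 * k^-1)%g)).
rewrite -mulr_sumr ler_wpM2l ?sqr_ge0// exchange_big/=; apply: ler_sum => v _.
rewrite -(big_map (fun k => r v.2 * k^-1)%g predT (fun g => hilnorm (z v g) ^+ 2)).
by apply: l2_hilnorm_ge_sum; rewrite map_inj_uniq// => k k' /mulgI /invg_inj.
Qed.

End amplification.

(** [S_] is picked by [xget] and is not literally the extension built here. It agrees with [S0] on
    [X0] and is bounded, so it inherits the constant [c] by density. *)
Lemma multiplier_extend (F : G -> bop H -> bop H) (S0 : bop (l2 G H) -> bop (l2 G H)) c :
  0 <= c -> linear_on X0 S0 -> cb_le X0 S0 c -> (forall x, X0 x -> X0 (S0 x)) ->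
  (forall f, ell1 A f -> S0 (pi_tilde alpha f) = pi_tilde alpha (fun t => F t (f t))) ->
  multiplier_map A alpha F X (S_ A alpha F) /\ cb_le X (S_ A alpha F) c.
Proof.
move=> c0 lS0 cS0 S0X S0E; have [S [lS SE cS SX]] := cb_extension sX0 c0 lS0 cS0.
have ex : exists S, multiplier_map A alpha F X S.
  exists S; split=> [|f lf]; last by rewrite SE ?S0E//; exists f.
  apply: (cb_le_completely_bounded _ lS c0 cS) => x Xx e e0.
  have [_ [y Xy <-] xy] := SX x Xx e e0.
  by exists (S0 y) => //; exact: S0X.
have mS : multiplier_map A alpha F X (S_ A alpha F) := xgetPex _ ex.
split=> //; have [cbS eS] := mS; have [_ lS' _] := cbS.
have [M M0 cM] := completely_bounded_cb_le sX cbS.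
apply: (cb_le_closure sX0 M0 c0 lS').
  by move=> x Xx; exact: cb_leP M0 cM Xx.
move=> P x B B0 Xx xB; apply: (eq_mxbound _ (cS0 _ _ _ B0 Xx xB)) => p q.
by have [f lf <-] := Xx p q; rewrite S0E// eS.
Qed.

(** * The multiplier induced by a completely bounded map *)

Section transform.
Variables (T : bop (l2 G H) -> bop (l2 G H)) (c : R) (F : G -> bop H -> bop H).
Hypotheses (c0 : 0 <= c) (lT : linear_on X T) (TX : forall x, X x -> X (T x)).
Hypothesis cT : cb_le X T c.
(** Asked on [A] only: for the difference of two multipliers in [mnorm_finite_rank] the identity is
    available just there. *)
Hypothesis FE : forall t a, A a -> F t a = coef (T (mono alpha t a)) t.

Lemma transformA t a : A a -> A (F t a).
Proof.
by move=> Aa; rewrite FE//; apply: coefA; apply: TX; exact: mono_crossed cA act _ _ Aa.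
Qed.

Lemma transform_lin t : linear_on A (F t).
Proof.
have sA := cstar_lsubspace cA; have [_ AD] := sA.
move=> b x y Ax Ay; rewrite !FE//; last exact: (AD).
rewrite (mono_lin cA act)// lT; [exact: entryP| exact: mono_crossed | exact: mono_crossed].
Qed.

Lemma transform_le t a : A a -> opnorm (F t a) <= c * opnorm a.
Proof.
move=> Aa; rewrite FE//; apply: (le_trans (opnorm_entry _ _ _)).
have Xm := mono_crossed cA act t Aa.
apply: (le_trans (cb_leP c0 cT Xm)); rewrite ler_wpM2l//.
exact: opnorm_mono cA act t _ Aa.
Qed.

Lemma transform_ell1 f : ell1 A f -> ell1 A (fun t => F t (f t)).
Proof.
move=> lf; have [Af _] := lf; apply: (ell1_le c0 _ _ lf) => t.
  exact: transformA.
exact: transform_le.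
Qed.

Let S0 (x : bop (l2 G H)) := pi_tilde alpha (fun t => F t (coef x t)).

Let S0E f : ell1 A f -> S0 (pi_tilde alpha f) = pi_tilde alpha (fun t => F t (f t)).
Proof. by move=> lf; rewrite /S0 coef_pi_tilde. Qed.

Let S0X x : X0 x -> X0 (S0 x).
Proof.
by move=> Xx; exists (fun t => F t (coef x t)) => //; apply: transform_ell1; exact: coef_ell1.
Qed.

Let S0_lin : linear_on X0 S0.
Proof.
move=> a x y Xx Xy; have [lx ly] := (coef_ell1 Xx, coef_ell1 Xy).
have [[Ax _] [Ay _]] := (lx, ly).
apply: etrans (pi_tilde_lin cA act a (transform_ell1 lx) (transform_ell1 ly)).
congr (pi_tilde alpha _); apply/funext => t.
by rewrite {1}/coef entryP; exact: (transform_lin t a (Ax t) (Ay t)).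
Qed.

(** As [T] maps into the crossed product, the (r, q) entry of its value is alpha_(r^-1) of the
    coefficient at r q^-1, which is a value of [F] by [FE]. *)
Let entry_S0 x r q : X0 x -> entry r q (S0 x) =
  entry r q (T (mono alpha (r * q^-1)%g (coef x (r * q^-1)%g))).
Proof.
move=> Xx; have lx := coef_ell1 Xx; have [Ax _] := lx.
apply: etrans (entry_pi_tilde cA act r q (transform_ell1 lx)) _.
by rewrite entry_coef ?FE//; apply: TX; exact: mono_crossed.
Qed.

(** By [entry_S0], the (r_i, r_j) entry of S0(x) is the (r_i, r_j) entry of the block (i, j) of [T]
    applied to [amplified]. Thus S0(x), truncated to [E], is a compression of that block matrix. *)
Let S0_cb : cb_le X0 S0 c.
Proof.
move=> P x B B0 X0x xB; have Xx p q : X (x p q) := op_closureS (X0x p q).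
apply: mxbound_fin_test => [|E z uE]; first exact: mulr_ge0.
pose r (i : 'I_(size E)) : G := nth 1%g E i.
have r_inj : injective r by move=> i j /eqP; rewrite nth_uniq// => /eqP/val_inj.
have bigE (W : nmodType) (f : G -> W) : \sum_(g <- E) f g = \sum_i f (r i).
  by rewrite (big_nth 1%g) big_mkord.
have Xamp u v : X (amplified x r u v).
  by apply: mono_crossed cA act _ _ _; exact: coefA.
have := cT B0 Xamp (amplified_mxbound Xx xB r_inj).
(* Testing on these vectors selects column r_j inside the block column j; row r_i is read off
   below. *)
move=> /(_ (fun v => dlt (r v.2) (z v.1 (r v.2)))) h.
apply: (@le_trans _ _ ((c * B) ^+ 2 *
    \sum_v hilnorm (dlt (r v.2) (z v.1 (r v.2)) : l2 G H) ^+ 2)); last first.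
  rewrite ler_wpM2l ?sqr_ge0//.
  under eq_bigr do rewrite hilnorm_dlt.
  apply: (@le_trans _ _ (\sum_q \sum_j hilnorm (z q (r j)) ^+ 2)).
    by rewrite pair_bigA.
  apply: ler_sum => q _; rewrite -(bigE _ (fun g => hilnorm (z q g) ^+ 2)).
  exact: l2_hilnorm_ge_sum.
apply: le_trans h.
rewrite (_ : \sum_p _ = \sum_(u : P * 'I_(size E))
    hilnorm ((\sum_q S0 (x u.1 q) (fin_l2 E (z q))) (r u.2)) ^+ 2); last first.
  apply: (@etrans _ _ (\sum_p \sum_i
    hilnorm ((\sum_q S0 (x p q) (fin_l2 E (z q))) (r i)) ^+ 2)).
    by apply: eq_bigr => p _; rewrite hilnorm_fin_l2// bigE.
  by rewrite pair_bigA.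
apply: ler_sum => -[p i] _ /=.
pose w : l2 G H := \sum_v T (amplified x r (p, i) v) (dlt (r v.2) (z v.1 (r v.2))).
rewrite -[X in _ <= hilnorm X ^+ 2]/w.
rewrite (_ : (\sum_q S0 (x p q) (fin_l2 E (z q))) (r i) = w (r i)).
  by rewrite -hilnorm_le_sqr ?hilnorm_ge0// l2_hilnorm_ge.
rewrite /w !l2_sumE.
apply: (@etrans _ _ (\sum_q \sum_j T (amplified x r (p, i) (q, j))
  (dlt (r j) (z q (r j))) (r i))); last first.
  by rewrite pair_bigA; apply: eq_bigr => -[].
apply: eq_bigr => q _; rewrite bop_fin_l2// bigE; apply: eq_bigr => j _.
by rewrite entry_S0// entryE.
Qed.

Lemma transform_multiplier :
  (exists S, multiplier_map A alpha F X0 S) /\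
  multiplier_map A alpha F X (S_ A alpha F) /\ cb_le X (S_ A alpha F) c.
Proof.
split; last exact: multiplier_extend S0_lin S0_cb S0X S0E.
exists S0; split=> //.
exact: cb_le_completely_bounded S0_lin c0 S0_cb.
Qed.

End transform.

End multipliers.

(** * Finite rank approximation *)

Lemma finite_dim_lsubspace (R : realType) (V : hilbertType R) (Z W : set (bop V)) :
  finite_dim Z -> lsubspace W -> W `<=` Z -> finite_dim W.
Proof.
move=> fZ sW WZ; have [k [g [e [_ bg ZE]]]] := dual_basis fZ.
(* The guard supplies linear coordinates at every index, since [g i] is known to be linear only for
   [i < k]. *)
apply: (@finite_dim_sub _ _ (fun i x => if (i < k)%N then g i x else 0) e k) => //.
  move=> i a x y; case: ifPn => [ik|_]; last by rewrite mulr0 addr0.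
  by have [C [_ -> //_]] := bg i ik.
move=> w /WZ /ZE wE; rewrite {1}wE; apply: eq_bigr => i _.
by rewrite ltn_ord.
Qed.

Section approximation.
Variables (R : realType) (G : groupType) (H : hilbertType R).
Variables (A : set (bop H)) (alpha : G -> bop H -> bop H).
Hypotheses (cA : cstar_algebra A) (act : cstar_action A alpha).
Let X := reduced_crossed_product A alpha.
Let X0 := pi_tilde_ell1 A alpha.
Let sA : lsubspace A := cstar_lsubspace cA.
Let sX0 : lsubspace X0 := pi_tilde_ell1_lsubspace cA act.
Let sX : lsubspace X := crossed_lsubspace cA act.

Lemma herz_schur_extend F : herz_schur A alpha F ->
  multiplier_map A alpha F X (S_ A alpha F).
Proof.
move=> [_ [S0 [cbS0 S0E]]]; have [S0X lS0 _] := cbS0.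
have [c c0 cS0] := completely_bounded_cb_le sX0 cbS0.
by have [] := multiplier_extend cA act c0 lS0 cS0 S0X S0E.
Qed.

(** S_F sends pi(a) lam_t to pi(F(t)(a)) lam_t, so the transform of S_F is F itself. *)
Lemma coef_multiplier F t a : herz_schur A alpha F -> A a ->
  coef (S_ A alpha F (mono alpha t a)) t = F t a.
Proof.
move=> hF Aa; have [_ SE] := herz_schur_extend hF; have [[cbF _] _] := hF.
have [A0 _] := sA.
rewrite (mono_pi_tilde cA act)// SE; last exact: mono_ell1.
rewrite (@coef_pi_tilde _ _ _ A)// ?eqxx//.
apply: (@fin_ell1 _ _ _ _ _ [:: t]) => s.
  by have [FA _ _] := cbF s; apply: FA; case: ifP.
rewrite inE => /negbTE->; have [_ lF _] := cbF s; exact: linear_on0 sA lF.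
Qed.

(** * Multipliers induced by finite rank maps *)

Section finite_rank_multiplier.
Variables (k : nat) (phi : 'I_k -> bop (l2 G H) -> R[i]) (C : 'I_k -> R).
Hypothesis bphi : forall l, bounded_functional X (phi l) (C l).
Variables (f : 'I_k -> G -> bop H) (E : 'I_k -> seq G).
Hypotheses (Af : forall l t, A (f l t)) (fE : forall l t, t \notin E l -> f l t = 0).

Let T (x : bop (l2 G H)) : bop (l2 G H) := \sum_l phi l x *: pi_tilde alpha (f l).
Let F (t : G) (a : bop H) : bop H := coef (T (mono alpha t a)) t.
Let c := \sum_l C l * opnorm (pi_tilde alpha (f l)).

Let C0 l : 0 <= C l. Proof. by have [] := bphi l. Qed.

Let c0 : 0 <= c.
Proof. by apply: sumr_ge0 => l _; rewrite mulr_ge0 ?opnorm_ge0. Qed.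

Let lf l : ell1 A (f l). Proof. exact: fin_ell1 (Af l) (@fE l). Qed.

Let TX x : X x -> X (T x).
Proof.
move=> _; have Xpi l : X (pi_tilde alpha (f l)).
  have X0pi : X0 (pi_tilde alpha (f l)) by exists (f l).
  exact: (op_closureS X0pi).
exact: (lsubspace_sum _ sX (fun l _ => lsubspaceZ _ sX (Xpi l))).
Qed.

Let T_lin : linear_on X T.
Proof.
move=> a x y Xx Xy; rewrite /T scaler_sumr -big_split/=; apply: eq_bigr => l _.
by have [_ -> //_] := bphi l; rewrite scalerDl scalerA.
Qed.

Let T_cb : cb_le X T c.
Proof. exact: (cb_le_sum_functional sX (fun l => pi_tilde alpha (f l)) bphi). Qed.

Let FE t a : F t a = \sum_l phi l (mono alpha t a) *: f l t.
Proof.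
rewrite /F /coef /T entry_sum; apply: eq_bigr => l _; rewrite entryZ.
congr (_ *: _); exact: (congr1 (@^~ t) (coef_pi_tilde cA act (lf l))).
Qed.

(** Each a |-> phi_l(pi(a) lam_t) is a functional on [A] bounded by [C l], and f_l(t) has norm at
    most that of pi_tilde(f_l); so [c] bounds every [F t]. *)
Let F_bounded : bounded_CB A F.
Proof.
have bpsi t l : bounded_functional A (fun a => phi l (mono alpha t a)) (C l).
  have [_ lphi phiC] := bphi l; split=> // [a x y Ax Ay|x Ax].
    by rewrite (mono_lin cA act)// lphi//; exact: mono_crossed.
  apply: (le_trans (phiC _ (mono_crossed cA act t Ax))).
  by rewrite ler_wpM2l//; exact: opnorm_mono cA act t _ Ax.
have F_cb t : cb_le A (F t) c.
  have -> : F t = fun a => \sum_l phi l (mono alpha t a) *: f l t.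
    by apply/funext => a; exact: FE.
  apply: cb_le_le (cb_le_sum_functional sA (fun l => f l t) (bpsi t)).
    by apply: sumr_ge0 => l _; rewrite mulr_ge0 ?opnorm_ge0.
  apply: ler_sum => l _; rewrite ler_wpM2l//.
  rewrite -{1}(coef_pi_tilde cA act (lf l)); exact: opnorm_entry.
split; last by exists c => t; exact: cb_le_cbnorm c0 (F_cb t).
move=> t; apply: (cb_le_completely_bounded _ _ c0 (F_cb t)) => [a Aa|].
  exact: (transformA cA act TX (fun _ _ _ => erefl)).
exact: (transform_lin cA act T_lin (fun _ _ _ => erefl)).
Qed.

(** [F t a] is a combination of the [f l t], so S_F maps each pi_tilde(h) into the span [Z] of
    finitely many monomials. [Z] is closed, hence contains the image of the whole crossed
    product. *)
Lemma finite_rank_herz_schur : herz_schur A alpha F /\ finite_rank X (S_ A alpha F).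
Proof.
have [exS [mS _]] := @transform_multiplier _ _ _ A alpha cA act T c F c0 T_lin TX T_cb
  (fun _ _ _ => erefl).
split; first by split.
have [cbS SE] := mS; have [SX lS _] := cbS.
have [M M0 cM] := completely_bounded_cb_le sX cbS.
pose E' := undup (flatten [seq E l | l <- enum 'I_k]).
have E'f l t : t \notin E' -> f l t = 0.
  move=> tE; apply: fE; apply: contra tE => tl; rewrite mem_undup.
  by apply/flatten_mapP; exists l; rewrite ?mem_enum.
pose zs := [seq mono alpha t (f l t) | t <- E', l <- enum 'I_k].
pose Z := lspan [set` zs].
have sZ : lsubspace Z := lspan_lsubspace _.
have fZ : finite_dim Z by exists zs.
have S0Z x : X0 x -> Z (S_ A alpha F x).
  move=> [h lh <-]; rewrite SE//; have [Ah _] := lh.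
  rewrite (@pi_tilde_fin _ _ _ A _ cA act _ E'); last first.
  - move=> t tE; rewrite FE big1// => l _; by rewrite E'f// scaler0.
  - move=> t; exact: (transformA cA act TX (fun _ _ _ => erefl)).
  - exact: undup_uniq.
  rewrite big_seq; apply: (lsubspace_sum _ sZ) => t tE; rewrite FE.
  rewrite (linear_on_sum sA (mono_lin cA act t)); last first.
    by move=> l _; exact: lsubspaceZ.
  apply: (lsubspace_sum _ sZ) => l _.
  rewrite (linear_onZ sA (mono_lin cA act t))//; apply: (lsubspaceZ _ sZ).
  by apply: lspan_gen; apply/allpairsP; exists (t, l); rewrite mem_enum.
have SZ x : X x -> Z (S_ A alpha F x).
  move=> Xx; apply: (finite_dim_closed fZ) => e e0.
  have M1 : 0 < M + 1 by rewrite ltr_wpDl.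
  have [x0 Xx0 xx0] := Xx _ (divr_gt0 e0 M1).
  exists (S_ A alpha F x0); first exact: S0Z.
  have Xx0' : X x0 := op_closureS Xx0.
  rewrite -(linear_onB lS Xx Xx0').
  apply: le_lt_trans (cb_leP M0 cM (lsubspaceB sX Xx Xx0')) _.
  rewrite ltr_pdivlMr// in xx0; apply: le_lt_trans xx0.
  by rewrite mulrC ler_wpM2l ?opnorm_ge0// lerDl.
(* [finite_rank] asks the image itself to be a finite span, so it must also be seen to be a subspace
   of [Z]. *)
apply: (finite_dim_lsubspace fZ); last by move=> _ [x Xx <-]; exact: SZ.
have [X_0 XD] := sX; split; first by exists 0 => //; exact: linear_on0 sX lS.
move=> a _ _ [x Xx <-] [y Xy <-]; by exists (a *: x + y); [exact: (XD)|exact: (lS a x y Xx Xy)].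
Qed.

(** Transforms are linear, so [F - F1] is the transform of T - S_F1 and its multiplier norm is
    bounded by the cb-norm of that difference. *)
Lemma mnorm_finite_rank (F1 : G -> bop H -> bop H) e : herz_schur A alpha F1 -> 0 <= e ->
  cb_le X (fun x => T x - S_ A alpha F1 x) e ->
  (mnorm A alpha (fun t a => F t a - F1 t a)%R <= e%:E)%E.
Proof.
move=> hF1 e0 cD; have [[SX lS _] _] := herz_schur_extend hF1.
have lD : linear_on X (fun x => T x - S_ A alpha F1 x).
  by move=> a x y Xx Xy; rewrite T_lin// lS// scalerBr opprD addrACA.
have DX x : X x -> X (T x - S_ A alpha F1 x).
  by move=> Xx; exact: (lsubspaceB sX (TX Xx) (SX _ Xx)).
have DE t a : A a -> F t a - F1 t a =
    coef (T (mono alpha t a) - S_ A alpha F1 (mono alpha t a)) t.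
  by move=> Aa; rewrite /coef entryB -![entry _ _ _]/(coef _ t) (coef_multiplier t hF1 Aa).
have [_ [_ cb]] := transform_multiplier cA act e0 lD DX cD DE.
exact: cb_le_cbnorm.
Qed.

End finite_rank_multiplier.

Lemma completely_compact_approx F e : SOAP X -> herz_schur A alpha F ->
  completely_compact X X (S_ A alpha F) -> 0 < e ->
  exists F', [/\ herz_schur A alpha F', finite_rank X (S_ A alpha F') &
    (mnorm A alpha (fun t a => F' t a - F t a)%R <= e%:E)%E].
Proof.
move=> soap hF cc e0; pose Psi := S_ A alpha F.
have [Phi [cbPhi frPhi approx]] := soap_approx sX cc soap (divr_gt0 e0 (ltr0n R 2)).
have [cbPsi _] := cc; have [PsiX lPsi _] := cbPsi; have [PhiX lPhi _] := cbPhi.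
have [k [g [b [Yb bg YE]]]] := dual_basis frPhi.
have [d1 d10 cPhi] := completely_bounded_cb_le sX cbPhi.
have [d2 d20 cPsi] := completely_bounded_cb_le sX cbPsi.
have [C hC] := choice (fun l : 'I_k => bg l (ltn_ord l)).
pose phi (l : 'I_k) x := g l (Phi (Psi x)).
pose C' l := C l * (d1 * d2).
have bphi l : bounded_functional X (phi l) (C' l).
  have [C0 lg gC] := hC l; split=> [|a x y Xx Xy|x Xx].
  - by rewrite !mulr_ge0.
  - have e1 := congr1 Phi (lPsi a x y Xx Xy).
    have e2 := lPhi a _ _ (PsiX _ Xx) (PsiX _ Xy).
    exact: etrans (congr1 (g l) (etrans e1 e2)) (lg a _ _ I I).
  - apply: (le_trans (gC _ I)); rewrite -!mulrA ler_wpM2l//.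
    apply: (le_trans (cb_leP d10 cPhi (PsiX _ Xx))); rewrite ler_wpM2l//.
    exact: cb_leP d20 cPsi Xx.
have C'0 l : 0 <= C' l by have [] := bphi l.
(* Moving every [b l] by at most [e / 2 / (K + 1)] costs at most [e / 2] in cb-norm; [soap_approx]
   accounts for the other half. The [+ 1] allows [K = 0]. *)
pose K := \sum_l C' l; have K0 : 0 <= K by apply: sumr_ge0.
have K1 : 0 < K + 1 by rewrite ltr_wpDl.
have d0 : 0 < e / 2 / (K + 1) by rewrite !divr_gt0.
have Xb (l : 'I_k) : X (b l) by have [x Xx <-] := Yb l (ltn_ord l); exact: PhiX.
have exf (l : 'I_k) : exists fE : (G -> bop H) * seq G,
    [/\ forall s, A (fE.1 s), forall s, s \notin fE.2 -> fE.1 s = 0 &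
      opnorm (b l - pi_tilde alpha fE.1) < e / 2 / (K + 1)].
  by have [f [E h]] := crossed_fin_approx cA act (Xb l) d0; exists (f, E).
have [fE hfE] := choice exf.
pose f l := (fE l).1; pose E l := (fE l).2.
have Af l t : A (f l t) by have [h _ _] := hfE l; exact: (h t).
have f0 l t : t \notin E l -> f l t = 0 by have [_ h _] := hfE l; exact: (h t).
have fb l : opnorm (pi_tilde alpha (f l) - b l) <= e / 2 / (K + 1).
  by have [_ _ /ltW] := hfE l; rewrite opnormB.
have [hF' frF'] := finite_rank_herz_schur bphi Af f0.
eexists; split; [exact: hF'|exact: frF'|].
apply: (mnorm_finite_rank bphi Af f0 hF (ltW e0)).
have h := cb_le_sum_functional sX (fun l : 'I_k => pi_tilde alpha (f l) - b l) bphi.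
have S0 : 0 <= \sum_l C' l * opnorm (pi_tilde alpha (f l) - b l).
  by apply: sumr_ge0 => l _; rewrite mulr_ge0 ?opnorm_ge0.
have Sle : \sum_l C' l * opnorm (pi_tilde alpha (f l) - b l) <= e / 2.
  apply: (@le_trans _ _ (K * (e / 2 / (K + 1)))).
    rewrite mulr_suml; apply: ler_sum => l _; rewrite ler_wpM2l//.
  rewrite mulrCA ler_piMr ?divr_ge0 ?(ltW e0)// ler_pdivrMr// mul1r.
  by rewrite lerDl.
have e20 : 0 <= e / 2 by rewrite divr_ge0// ltW.
have := cb_leD e20 e20 (cb_le_le S0 Sle h) approx; rewrite -splitr.
move=> hD P x B B0 Xx xB; apply: (eq_mxbound _ (hD _ _ _ B0 Xx xB)) => p q.
have -> : Phi (S_ A alpha F (x p q)) = \sum_(l < k) phi l (x p q) *: b l.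
  by apply: YE; exists (Psi (x p q)) => //; exact: PsiX.
rewrite addrA; congr (_ - _); rewrite -big_split/=.
by apply: eq_bigr => l _; rewrite scalerBr subrK.
Qed.

End approximation.

Theorem corollary3p8 (R : realType) (G : groupType) (H : hilbertType R)
    (A : set (bop H)) (alpha : G -> bop H -> bop H)
    (A_cstar : cstar_algebra A) (A_nondeg : nondegenerate_algebra A)
    (alpha_action : cstar_action A alpha)
    (crossed_SOAP : SOAP (reduced_crossed_product A alpha))
    (F : G -> bop H -> bop H) (F_hs : herz_schur A alpha F)
    (F_cc : completely_compact (reduced_crossed_product A alpha)
              (reduced_crossed_product A alpha) (S_ A alpha F)) :
  exists F_ : nat -> G -> bop H -> bop H,
    (forall n, herz_schur A alpha (F_ n) /\
               finite_rank (reduced_crossed_product A alpha)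
                 (S_ A alpha (F_ n))) /\
    (fun n => mnorm A alpha (fun t a => F_ n t a - F t a)) @ \oo --> 0%E.
Proof.
have inv0 (n : nat) : 0 < n.+1%:R^-1 :> R by rewrite invr_gt0.
have ex n := completely_compact_approx A_cstar alpha_action crossed_SOAP F_hs F_cc (inv0 n).
have [F_ hF_] := choice ex.
exists F_; split=> [n|]; first by have [] := hF_ n.
apply: (@squeeze_cvge _ _ _ _ (fun=> 0%E) _ (fun n => (harmonic n)%:E)).
- by apply: nearW => n; have [_ _ ->] := hF_ n; rewrite andbT; exact: cbnorm_ge0.
- exact: cvg_cst.
- apply: cvg_EFin; first exact: nearW.
  exact: cvg_harmonic.
Qed.
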